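(* Let $N\ge 2$, $R>0$ and $\Omega\in\mathcal{C}_R$. Let $H:\Omega\times\mathbb{R}^N\to\mathbb{R}$ be continuous and such that $$H(x,t\xi)=tH(x,\xi)\qquad\forall (x,t,\xi)\in\Omega\times\mathbb{R}_+\times\mathbb{R}^N,$$ and such that there is a modulus of continuity $\omega$ with $$|H(x,\xi)-H(y,\xi)|\le\omega\big(|x-y|(1+|\xi|)\big)\qquad\forall x,y\in\Omega,\ \xi\in\mathbb{R}^N.$$ Let $b=\sup_{(x,\xi)\in\Omega\times B_1}|H(x,\xi)|$ and assume $bR<1$. Let $f$ be a bounded continuous function in $\Omega$. Then there exists a viscosity solution $u\in\mathrm{Lip}(\overline\Omega)$ of $$\mathcal{P}^-_1(D^2u)+H(x,\nabla u)+\mu u=f(x)\ \text{ in }\Omega,\qquad u=0\ \text{ on }\partial\Omega,$$ in the following two cases: (i) for $\mu<\mu_1^-$; (ii) for any $\mu\in\mathbb{R}$ if $f\le 0$.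
   Context: For a real symmetric $N\times N$ matrix $X$, $\mathcal{P}^-_1(X)$ is its smallest eigenvalue. $B_R(y)$ is the open ball of radius $R$ centred at $y$, $B_1=B_1(0)$; $\mathcal{C}_R$ is the class of bounded domains $\Omega\subset\mathbb{R}^N$ such that $\Omega=\bigcap_{y\in Y}B_R(y)$ for some $Y\subset\mathbb{R}^N$. $\mathrm{Lip}(\overline\Omega)$ is the space of Lipschitz continuous functions on $\overline\Omega$. A modulus of continuity is a nondecreasing function $\omega:[0,\infty)\to[0,\infty)$ with $\omega(s)\to 0=\omega(0)$ as $s\to 0^+$. Viscosity sense: a real-valued $u$ is a subsolution (resp. supersolution) of $F(x,u,\nabla u,D^2u)=0$ in $\Omega$ if it is upper (resp. lower) semicontinuous and, for every $x\in\Omega$ and every $C^2$ function $\varphi$ touching $u$ from above (resp. below) at $x$, $F(x,u(x),\nabla\varphi(x),D^2\varphi(x))\ge 0$ (resp. $\le 0$). A continuous function which is both is a solution. $\mu_1^-=\sup\{\mu\in\mathbb{R}:\ \exists\, w<0\text{ in }\Omega,\ w\text{ a subsolution of }\mathcal{P}^-_1(D^2w)+H(x,\nabla w)+\mu w=0\text{ in }\Omega\}$. *)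

(* Defs.v *)
From mathcomp Require Import all_boot all_order all_algebra.
From mathcomp Require Import all_classical all_reals all_analysis.

Set Implicit Arguments.
Unset Strict Implicit.
Unset Printing Implicit Defensive.

Import Order.TTheory GRing.Theory Num.Theory.
Import numFieldNormedType.Exports.

Local Open Scope classical_set_scope.
Local Open Scope ring_scope.

(* The norm that MathComp-Analysis puts on 'rV[R]_N is the sup norm. It defines
   the usual topology of R^N, but the balls B_r(y), the class C_r and all the
   moduli below refer to the Euclidean norm. *)
Definition enorm (R : realType) (N : nat) (x : 'rV[R]_N) : R :=
  Num.sqrt (\sum_(i < N) x ord0 i ^+ 2).

Definition eball (R : realType) (N : nat) (y : 'rV[R]_N) (r : R) :
    set 'rV[R]_N :=
  [set x | enorm (x - y) < r].

Definition bounded_domain (R : realType) (N : nat) (Om : set 'rV[R]_N) : Prop :=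
  [/\ open Om, connected Om, Om !=set0 &
      exists M : R, forall x, Om x -> enorm x <= M].

Definition class_C (R : realType) (N : nat) (r : R) (Om : set 'rV[R]_N) : Prop :=
  bounded_domain Om /\
  exists Y : set 'rV[R]_N, Om = \bigcap_(y in Y) eball y r.

Definition is_modulus (R : realType) (omega : R -> R) : Prop :=
  [/\ forall s, 0 <= s -> 0 <= omega s,
      forall s t, 0 <= s -> s <= t -> omega s <= omega t,
      omega 0 = 0 &
      omega s @[s --> 0^'+] --> (0 : R)].

Definition Lip (R : realType) (N : nat) (D : set 'rV[R]_N)
    (u : 'rV[R]_N -> R) : Prop :=
  exists L : R, forall x y, D x -> D y -> `|u x - u y| <= L * enorm (x - y).

(* The infimum is a minimum when X is real symmetric and N > 0. *)
Definition P1minus (R : realType) (N : nat) (X : 'M[R]_N) : R :=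
  inf [set a : R | eigenvalue X a].

Definition partial (R : realType) (N : nat) (i : 'I_N)
    (phi : 'rV[R]_N -> R) : 'rV[R]_N -> R :=
  fun x => 'D_(delta_mx ord0 i) phi x.

Definition grad (R : realType) (N : nat) (phi : 'rV[R]_N -> R)
    (x : 'rV[R]_N) : 'rV[R]_N :=
  \row_i partial i phi x.

Definition hessian (R : realType) (N : nat) (phi : 'rV[R]_N -> R)
    (x : 'rV[R]_N) : 'M[R]_N :=
  \matrix_(i, j) partial j (partial i phi) x.

Definition C1_on (R : realType) (N : nat) (Om : set 'rV[R]_N)
    (phi : 'rV[R]_N -> R) : Prop :=
  {within Om, continuous phi} /\
  forall i : 'I_N,
    (forall x, Om x -> derivable phi x (delta_mx ord0 i)) /\
    {within Om, continuous (partial i phi)}.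

Definition C2_on (R : realType) (N : nat) (Om : set 'rV[R]_N)
    (phi : 'rV[R]_N -> R) : Prop :=
  C1_on Om phi /\ forall i : 'I_N, C1_on Om (partial i phi).

Definition usc_on (R : realType) (N : nat) (Om : set 'rV[R]_N)
    (u : 'rV[R]_N -> R) : Prop :=
  forall x, Om x -> forall e : R, 0 < e ->
    \forall y \near within Om (nbhs x), u y < u x + e.

Definition lsc_on (R : realType) (N : nat) (Om : set 'rV[R]_N)
    (u : 'rV[R]_N -> R) : Prop :=
  forall x, Om x -> forall e : R, 0 < e ->
    \forall y \near within Om (nbhs x), u x - e < u y.

Definition touches_above (R : realType) (N : nat) (Om : set 'rV[R]_N)
    (phi u : 'rV[R]_N -> R) (x : 'rV[R]_N) : Prop :=
  phi x = u x /\ \forall y \near within Om (nbhs x), u y <= phi y.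

Definition touches_below (R : realType) (N : nat) (Om : set 'rV[R]_N)
    (phi u : 'rV[R]_N -> R) (x : 'rV[R]_N) : Prop :=
  phi x = u x /\ \forall y \near within Om (nbhs x), phi y <= u y.

Definition visc_sub (R : realType) (N : nat) (Om : set 'rV[R]_N)
    (F : 'rV[R]_N -> R -> 'rV[R]_N -> 'M[R]_N -> R) (u : 'rV[R]_N -> R) : Prop :=
  usc_on Om u /\
  forall x phi, Om x -> C2_on Om phi -> touches_above Om phi u x ->
    0 <= F x (u x) (grad phi x) (hessian phi x).

Definition visc_super (R : realType) (N : nat) (Om : set 'rV[R]_N)
    (F : 'rV[R]_N -> R -> 'rV[R]_N -> 'M[R]_N -> R) (u : 'rV[R]_N -> R) : Prop :=
  lsc_on Om u /\
  forall x phi, Om x -> C2_on Om phi -> touches_below Om phi u x ->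
    F x (u x) (grad phi x) (hessian phi x) <= 0.

Definition visc_sol (R : realType) (N : nat) (Om : set 'rV[R]_N)
    (F : 'rV[R]_N -> R -> 'rV[R]_N -> 'M[R]_N -> R) (u : 'rV[R]_N -> R) : Prop :=
  [/\ {within Om, continuous u}, visc_sub Om F u & visc_super Om F u].

(* F = 0 is the equation P_1^-(D^2 u) + H(x, grad u) + mu u = f(x). *)
Definition eqF (R : realType) (N : nat) (H : 'rV[R]_N -> 'rV[R]_N -> R)
    (mu : R) (f : 'rV[R]_N -> R) :
    'rV[R]_N -> R -> 'rV[R]_N -> 'M[R]_N -> R :=
  fun x s p X => P1minus X + H x p + mu * s - f x.

(* Extended-real valued: the set of admissible mu need not be bounded. *)
Definition mu1minus (R : realType) (N : nat) (Om : set 'rV[R]_N)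
    (H : 'rV[R]_N -> 'rV[R]_N -> R) : \bar R :=
  ereal_sup [set mu%:E | mu in [set mu : R |
    exists w : 'rV[R]_N -> R,
      (forall x, Om x -> w x < 0) /\ visc_sub Om (eqF H mu (fun=> 0)) w]].

Definition bH (R : realType) (N : nat) (Om : set 'rV[R]_N)
    (H : 'rV[R]_N -> 'rV[R]_N -> R) : \bar R :=
  ereal_sup [set (`|H p.1 p.2|)%:E | p in Om `*` eball 0 1].

(* Main.v *)
Require Import Defs.
From mathcomp Require Import all_boot all_order all_algebra.
From mathcomp Require Import all_classical all_reals all_analysis.
From mathcomp Require Import ring lra.

Set Implicit Arguments.
Unset Strict Implicit.
Unset Printing Implicit Defensive.

Import Order.TTheory GRing.Theory Num.Theory.
Import numFieldNormedType.Exports.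

Local Open Scope classical_set_scope.
Local Open Scope ring_scope.

(** The proof is by Perron's method.

    A test function enters only through its jet (p, X) at the contact point, and
    the least eigenvalue of X is the minimum of the form e X e over unit vectors e
    (P1minus_rayleigh). A subsolution may thus be tested against any quadratic,
    and one direction e in which the quadratic is concave enough to beat b |p|
    gives a contradiction (jet_sub).

    Why u is Lipschitz. Subsolutions that vanish off the domain satisfy bounds that
    depend on the data only. They are bounded above, by comparison with a Gaussian
    centred at one of the centres y, whose Hessian is very negative orthogonally
    to x - y (gaussian_bound; this is where N >= 2 enters, and why mu is
    arbitrary). They lie below C (r^2 - |x - y|^2) / 2 for every centre y, because
    b r < 1 (paraboloid_bound), hence decay linearly at the boundary. Finally they
    lie below concave cones with vertex at any point of their graph, because a cone
    is strictly concave in the radial direction (cone_comparison). If they also lie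
    above a barrier W that decays linearly, they are uniformly Lipschitz, and so is
    their supremum u. As usual, u is a subsolution as a supremum and a
    supersolution because a bump could be added otherwise (perron_existence).

    It remains to find a subsolution W vanishing on the boundary. If f <= 0, take
    W = 0. Let rho be the minimum over the centres of (r^2 - |x - y|^2) / 2; then
    - C rho is a maximum of paraboloids, on each of which the operator without its
    zero-order term is at least C (1 - b r). If mu <= 0, take W = - C rho.

    If 0 < mu < mu_1, there are nu > mu and a negative subsolution w for nu.
    Near the boundary - C rho is still a strict subsolution. In the interior so is
    -(-w)^al for mu / nu < al < 1, a convex function of w that multiplies nu by al
    (jet_above_power). A multiple of the maximum of the two is a barrier, provided
    that - C rho is the larger one near the boundary (glued_barrier_strict). This
    follows from -w >= c rho, a form of Hopf's lemma valid on convex domains with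
    corners (hopf). For a convex w it would just be convexity along rays from an interior
    ball. In general it is obtained by comparing w(y) with a slightly convex
    function of s, where z + s (xi - z) is a point close to y and xi ranges over a
    compact convex set, by doubling of variables (hopf_interior). *)

(** * Euclidean space and quadratic forms *)

Lemma entry_le_mx_norm (R : realType) m n (A : 'M[R]_(m, n)) i j :
  `|A i j| <= `|A|.
Proof.
by rewrite [leRHS]/Num.norm /= mx_normrE; apply/bigmax_geP; right; exists (i, j).
Qed.

Lemma mx_norm_le (R : realType) m n (A : 'M[R]_(m, n)) (a : R) :
  0 <= a -> (forall i j, `|A i j| <= a) -> `|A| <= a.
Proof.
move=> a0 h; rewrite [leLHS]/Num.norm /= mx_normrE.
by apply/bigmax_leP; split => // -[i j] _ /=; exact: h.
Qed.

Section Euclidean.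
Variables (R : realType) (N : nat).
Implicit Types (x y z h k : 'rV[R]_N) (X : 'M[R]_N).

Definition dot x y : R := \sum_(i < N) x ord0 i * y ord0 i.

Lemma dotC x y : dot x y = dot y x.
Proof. by apply: eq_bigr => i _; rewrite mulrC. Qed.

Lemma dotDl x y z : dot (x + y) z = dot x z + dot y z.
Proof. by rewrite /dot -big_split; apply: eq_bigr => i _; rewrite mxE mulrDl. Qed.

Lemma dotDr x y z : dot z (x + y) = dot z x + dot z y.
Proof. by rewrite ![dot z _]dotC dotDl. Qed.

Lemma dotZl a x y : dot (a *: x) y = a * dot x y.
Proof. by rewrite /dot mulr_sumr; apply: eq_bigr => i _; rewrite mxE mulrA. Qed.

Lemma dotZr a x y : dot x (a *: y) = a * dot x y.
Proof. by rewrite ![dot x _]dotC dotZl. Qed.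

Lemma dotNl x y : dot (- x) y = - dot x y.
Proof. by rewrite -scaleN1r dotZl mulN1r. Qed.

Lemma dotNr x y : dot x (- y) = - dot x y.
Proof. by rewrite ![dot x _]dotC dotNl. Qed.

Lemma dot0l y : dot 0 y = 0.
Proof. by rewrite -(scale0r 0) dotZl mul0r. Qed.

Lemma dot0r y : dot y 0 = 0.
Proof. by rewrite dotC dot0l. Qed.

Definition dotE := (dotDl, dotDr, dotNl, dotNr, dotZl, dotZr, dot0l, dot0r).

Lemma dotxx_ge0 x : 0 <= dot x x.
Proof. by apply: sumr_ge0 => i _; rewrite -expr2 sqr_ge0. Qed.

Lemma dotxx_eq0 x : dot x x = 0 -> x = 0.
Proof.
move/eqP; rewrite psumr_eq0 => [/allP h|i _]; last by rewrite -expr2 sqr_ge0.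
apply/rowP => i; have := h i (mem_index_enum i).
by rewrite mxE -expr2 sqrf_eq0 => /eqP.
Qed.

Lemma enormE x : enorm x = Num.sqrt (dot x x).
Proof. by congr Num.sqrt; apply: eq_bigr => i _; rewrite expr2. Qed.

Lemma enorm_ge0 x : 0 <= enorm x.
Proof. exact: sqrtr_ge0. Qed.

Lemma enorm_sqr x : enorm x ^+ 2 = dot x x.
Proof. by rewrite enormE sqr_sqrtr // dotxx_ge0. Qed.

Lemma enorm0 : enorm (0 : 'rV[R]_N) = 0.
Proof. by rewrite enormE dot0l sqrtr0. Qed.

Lemma enorm_eq0 x : enorm x = 0 -> x = 0.
Proof. by move=> h; apply: dotxx_eq0; rewrite -enorm_sqr h expr0n. Qed.

Lemma enorm_gt0 x : x != 0 -> 0 < enorm x.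
Proof.
by move=> x0; rewrite lt0r enorm_ge0 andbT; apply: contra_neq x0; apply: enorm_eq0.
Qed.

Lemma enormN x : enorm (- x) = enorm x.
Proof. by rewrite !enormE !dotE opprK. Qed.

Lemma enormZ a x : enorm (a *: x) = `|a| * enorm x.
Proof. by rewrite !enormE !dotE mulrA -expr2 sqrtrM ?sqr_ge0 // sqrtr_sqr. Qed.

Lemma enormB x y : enorm (x - y) = enorm (y - x).
Proof. by rewrite -enormN opprB. Qed.

Lemma ler_enorm a x : 0 <= a -> (enorm x <= a) = (dot x x <= a ^+ 2).
Proof.
by move=> a0; rewrite -enorm_sqr ler_pXn2r // ?nnegrE ?enorm_ge0.
Qed.

Lemma cauchy_schwarz x y : dot x y <= enorm x * enorm y.
Proof.
have [->|x0] := eqVneq x 0; first by rewrite dot0l enorm0 mul0r.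
have [->|y0] := eqVneq y 0; first by rewrite dot0r enorm0 mulr0.
have px := enorm_gt0 x0; have py := enorm_gt0 y0.
have := dotxx_ge0 (enorm y *: x - enorm x *: y).
rewrite !dotE (dotC y x) -!enorm_sqr => h.
have pp : 0 < enorm x * enorm y by rewrite mulr_gt0.
rewrite -(ler_pM2l pp).
set a := enorm x in h *; set b := enorm y in h *; nra.
Qed.

Lemma cauchy_schwarz_abs x y : `|dot x y| <= enorm x * enorm y.
Proof.
by rewrite ler_norml cauchy_schwarz andbT lerNl -dotNl -(enormN x) cauchy_schwarz.
Qed.

Lemma enormD x y : enorm (x + y) <= enorm x + enorm y.
Proof.
rewrite ler_enorm ?addr_ge0 ?enorm_ge0 // !dotE (dotC y x) -!enorm_sqr.
have := cauchy_schwarz x y; nra.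
Qed.

Lemma enorm_triangle z x y : enorm (x - y) <= enorm (x - z) + enorm (z - y).
Proof. by rewrite -[x - y](subrKA z) enormD. Qed.

Lemma enorm_unit e : dot e e = 1 -> enorm e = 1.
Proof. by rewrite enormE => ->; rewrite sqrtr1. Qed.

Lemma enorm_delta (i : 'I_N) : enorm (delta_mx ord0 i : 'rV[R]_N) = 1.
Proof.
apply: enorm_unit; rewrite /dot (bigD1 i) //= big1 => [|j ji].
  by rewrite !mxE !eqxx mulr1 addr0.
by rewrite !mxE (negPf ji) andbF mul0r.
Qed.

Lemma dot_delta x (i : 'I_N) : dot x (delta_mx ord0 i) = x ord0 i.
Proof.
rewrite /dot (bigD1 i) //= big1 => [|j ji]; first by rewrite !mxE !eqxx mulr1 addr0.
by rewrite !mxE (negPf ji) andbF mulr0.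
Qed.

Lemma entry_le_enorm x (i : 'I_N) : `|x ord0 i| <= enorm x.
Proof. by rewrite -dot_delta (le_trans (cauchy_schwarz_abs _ _)) // enorm_delta mulr1. Qed.

Lemma norm_le_enorm x : `|x| <= enorm x.
Proof.
apply: mx_norm_le; first exact: enorm_ge0.
by move=> i j; rewrite (ord1 i) entry_le_enorm.
Qed.

Lemma entry_le_norm x (i : 'I_N) : `|x ord0 i| <= `|x|.
Proof. exact: entry_le_mx_norm. Qed.

Lemma enorm_le_norm x : enorm x <= N%:R * `|x|.
Proof.
rewrite {1}[x]row_sum_delta.
have -> : N%:R * `|x| = \sum_(i < N) `|x| by rewrite sumr_const card_ord mulr_natl.
elim/big_ind2: _ => [|a b c d ab cd|i _]; first by rewrite enorm0.
  by rewrite (le_trans (enormD _ _)) // lerD.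
by rewrite enormZ enorm_delta mulr1 entry_le_norm.
Qed.

(** Each of the two norms is bounded by a multiple of the other, so topological
    statements can be read on Euclidean balls. *)
Lemma nbhs_enormP x (A : set 'rV[R]_N) :
  nbhs x A <-> exists2 s : R, 0 < s & forall h, enorm h < s -> A (x + h).
Proof.
have E := @nbhs_nbhs_norm R 'rV[R]_N.
split=> [|[s s0 hs]].
  rewrite -E => -[s /= s0 hs]; exists s => // h hlt; apply: hs => /=.
  by rewrite opprD addNKr normrN (le_lt_trans (norm_le_enorm h)).
have n0 : 0 < (N%:R + 1 : R) by rewrite ltr_wpDl ?ler0n.
rewrite -E; exists (s / (N%:R + 1)); first by rewrite /= divr_gt0.
move=> y /=; rewrite distrC ltr_pdivlMr // => hy.
have -> : y = x + (y - x) by rewrite addrC subrK.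
apply: hs; rewrite (le_lt_trans (enorm_le_norm _)) //.
by apply: le_lt_trans hy; rewrite mulrC ler_wpM2l // lerDl.
Qed.

Definition qf X h : R := dot (h *m X) h.

Lemma dot_mulmx X h k : dot (h *m X) k = dot h (k *m X^T).
Proof.
have E (a b : 'rV[R]_N) : dot a b = (a *m b^T) ord0 ord0.
  by rewrite mxE; apply: eq_bigr => i _; rewrite mxE.
by rewrite !E trmx_mul trmxK mulmxA.
Qed.

Lemma qfD X h k : X^T = X -> qf X (h + k) = qf X h + 2 * dot (h *m X) k + qf X k.
Proof.
move=> sX; rewrite /qf mulmxDl !dotE (dotC (k *m X) h) [dot h _]dotC.
rewrite [dot (k *m X) h]dot_mulmx sX [dot k _]dotC; ring.
Qed.

Lemma qfZ X a h : qf X (a *: h) = a ^+ 2 * qf X h.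
Proof. by rewrite /qf -scalemxAl !dotE; ring. Qed.

Lemma qf0 X : qf X 0 = 0.
Proof. by rewrite /qf mul0mx dot0l. Qed.

Lemma qf_add X1 X2 h : qf (X1 + X2) h = qf X1 h + qf X2 h.
Proof. by rewrite /qf mulmxDr !dotE. Qed.

Lemma qf_scale a X h : qf (a *: X) h = a * qf X h.
Proof. by rewrite /qf -scalemxAr !dotE. Qed.

Lemma qf_scalar a h : qf a%:M h = a * dot h h.
Proof. by rewrite /qf mul_mx_scalar !dotE. Qed.

Lemma mulmx_rank1 h e : h *m (e^T *m e) = dot h e *: e.
Proof.
rewrite mulmxA [h *m _]mx11_scalar mul_scalar_mx; congr (_ *: _).
by rewrite mxE; apply: eq_bigr => i _; rewrite mxE.
Qed.

Lemma qf_rank1 e h : qf (e^T *m e) h = dot e h ^+ 2.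
Proof. by rewrite /qf mulmx_rank1 !dotE (dotC h e) expr2. Qed.

(** All test functions built below have a Hessian of this form. *)
Definition r1mx (a c : R) (e : 'rV[R]_N) : 'M[R]_N := a%:M + c *: (e^T *m e).

Lemma qf_r1mx a c e h : qf (r1mx a c e) h = a * dot h h + c * dot e h ^+ 2.
Proof. by rewrite /r1mx qf_add qf_scale qf_scalar qf_rank1. Qed.

Lemma r1mx_sym a c e : (r1mx a c e)^T = r1mx a c e.
Proof. by rewrite /r1mx raddfD /= tr_scalar_mx linearZ /= trmx_mul trmxK. Qed.

Lemma qf_bound X : exists2 C : R, 0 <= C &
  forall h k, `|dot (h *m X) k| <= C * enorm h * enorm k.
Proof.
exists (N%:R * (N%:R * (N%:R * `|X|))); first by rewrite !mulr_ge0 ?ler0n.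
move=> h k; apply: (le_trans (cauchy_schwarz_abs _ _)).
apply: ler_wpM2r; first exact: enorm_ge0.
apply: (le_trans (enorm_le_norm _)).
rewrite -!mulrA ler_wpM2l ?ler0n //.
apply: mx_norm_le; first by rewrite !mulr_ge0 ?ler0n ?enorm_ge0.
move=> i j; rewrite (ord1 i) mxE.
apply: (le_trans (ler_norm_sum _ _ _)).
apply: (@le_trans _ _ (\sum_(k0 < N) `|X| * enorm h)).
  apply: ler_sum => l _; rewrite normrM mulrC ler_pM // ?entry_le_enorm //.
  exact: entry_le_mx_norm.
rewrite sumr_const card_ord -[leLHS]mulr_natl ler_wpM2l ?ler0n //.
have [n0|] := eqVneq N 0%N; last first.
  by rewrite -lt0n => n0; rewrite ler_peMl ?mulr_ge0 ?enorm_ge0 // ler1n.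
have -> : enorm h = 0.
  rewrite enormE /dot big1 ?sqrtr0 // => a.
  by move=> _; have := ltn_ord a; rewrite [X in (_ < X)%N]n0 ltn0.
by rewrite !mulr0.
Qed.

End Euclidean.

(** * Compactness and semicontinuity *)

Section Compactness.
Variable R : realType.

(** Used both to bound a locally bounded function and to turn a strict inequality
    into one with a uniform gap. *)
Lemma compact_uniform (T : topologicalType) (K : set T) (P : nat -> T -> Prop) :
  compact K ->
  (forall n m x, (n <= m)%N -> P n x -> P m x) ->
  (forall x, K x -> exists n, \forall y \near x, K y -> P n y) ->
  exists n, forall y, K y -> P n y.
Proof.
move=> /compact_near_coveringP/near_covering_withinP cK mono loc.
have : \forall n \near \oo, K `<=` P n.
  apply: cK => x Kx; have [n hn] := loc x Kx.
  exists ([set y | K y -> P n y], [set m | (n <= m)%N]).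
    by split=> //; exists n.
  by move=> [y m] [/= hy nm] Ky; apply: (mono n) => //; exact: hy.
by move=> [n _ hn]; exists n => y; apply: hn => /=.
Qed.

Lemma usc_attains_max (T : topologicalType) (K : set T) (v : T -> R) :
  compact K -> K !=set0 ->
  (forall x, K x -> forall a, v x < a -> \forall y \near x, K y -> v y < a) ->
  exists2 x, K x & forall y, K y -> v y <= v x.
Proof.
move=> cK [x0 Kx0] usc.
have [n hn] : exists n : nat, forall y, K y -> v y < n%:R.
  apply: (compact_uniform cK) => [n m x nm|x Kx].
    by move=> /lt_le_trans; apply; rewrite ler_nat.
  exists (Num.truncn `|v x|).+1; apply: usc => //.
  by rewrite (le_lt_trans (ler_norm _)) // truncnS_gt.
pose S := sup (v @` K).
have hS : has_sup (v @` K).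
  split; first by exists (v x0), x0.
  by exists n%:R => _ [y Ky <-]; rewrite ltW // hn.
have leS y : K y -> v y <= S by move=> Ky; apply: sup_upper_bound => //; exists y.
apply: contrapT => /forall2NP nomax.
have ltS y : K y -> v y < S.
  move=> Ky; rewrite lt_neqAle leS // andbT; apply/eqP => vS.
  by case: (nomax y) => // h; apply: h => z Kz; rewrite vS leS.
have [m hm] : exists m : nat, forall y, K y -> v y < S - m.+1%:R^-1.
  apply: (compact_uniform cK) => [i j x ij|x Kx].
    move=> /lt_le_trans; apply; rewrite lerD2l lerN2.
    by rewrite lef_pV2 ?posrE ?ltr0n // ler_nat.
  have [m hm] := ltr_add_invr (ltS x Kx).
  by exists m; apply: usc => //; rewrite ltrBrDr.
have := @sup_adherent _ (v @` K) m.+1%:R^-1 _ hS; rewrite invr_gt0 ltr0n.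
by move=> /(_ isT) [_ [y Ky <-]]; rewrite ltNge ltW // hm.
Qed.

Variable N : nat.
Implicit Types (x y z h k : 'rV[R]_N) (X : 'M[R]_N).

Lemma continuous_enorm_at (f : 'rV[R]_N -> R) x :
  (forall e, 0 < e -> exists2 s : R, 0 < s &
     forall h, enorm h < s -> `|f (x + h) - f x| < e) <->
  {for x, continuous f}.
Proof.
split=> [hf U /nbhs_ballP [e /= e0 he]|hf e e0].
  have [s s0 hs] := hf e e0; apply/nbhs_enormP; exists s => // h hlt.
  by apply: he; rewrite /ball /= distrC hs.
have /nbhs_enormP [s s0 hs] := hf _ (nbhsx_ballx (f x) e e0).
by exists s => // h /hs; rewrite /= /ball /= distrC.
Qed.

Lemma continuous_enorm : continuous (@enorm R N).
Proof.
move=> x; apply/continuous_enorm_at => e e0; exists e => // h hlt.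
rewrite ltr_norml; have := enormD x h; have := enormD (x + h) (- h).
rewrite addrK enormN => h1 h2; apply/andP; split; lra.
Qed.

Lemma continuous_dist y : continuous (fun x => enorm (x - y)).
Proof.
move=> x; apply: (@continuous_comp _ _ _ (fun z => z - y) (@enorm R N)).
  by apply: continuousB; [exact: cvg_id|exact: cst_continuous].
exact: continuous_enorm.
Qed.

Lemma continuous_qf X : continuous (qf X).
Proof.
move=> x; apply/continuous_enorm_at => e e0.
have [C C0 hC] := qf_bound X.
have D0 : 0 < C * (2 * enorm x + 1) + 1.
  by rewrite ltr_wpDl // mulr_ge0 // addr_ge0 // mulr_ge0 // enorm_ge0.
exists (Num.min 1 (e / (C * (2 * enorm x + 1) + 1))).
  by rewrite lt_min ltr01 divr_gt0.
move=> h; rewrite lt_min => /andP[h1]; rewrite ltr_pdivlMr // => h2.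
have -> : qf X (x + h) - qf X x =
   dot (x *m X) h + dot (h *m X) x + dot (h *m X) h.
  by rewrite /qf mulmxDl !dotE; ring.
have := ler_normD (dot (x *m X) h + dot (h *m X) x) (dot (h *m X) h).
have := ler_normD (dot (x *m X) h) (dot (h *m X) x).
have := hC x h; have := hC h x; have := hC h h.
have := enorm_ge0 h; have := enorm_ge0 x.
set a := `|dot (h *m X) h|; set b := `|dot (h *m X) x|; set c := `|dot (x *m X) h|.
set p := `|_ + _ + _|; set q := `|_ + _|; set X1 := enorm x; set H1 := enorm h.
move: h1 h2; rewrite -/X1 -/H1 => h1 h2 x0 h0 i1 i2 i3 i4 i5.
have i6 : C * H1 * H1 <= C * H1 * 1 by rewrite ler_wpM2l ?mulr_ge0 // ltW.
have E : C * X1 * H1 = C * H1 * X1 by ring.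
rewrite E in i3.
apply: le_lt_trans h2; nra.
Qed.

Lemma closed_bounded_compact (A : set 'rV[R]_N) (M : R) :
  closed A -> (forall x, A x -> enorm x <= M) -> compact A.
Proof.
move=> cA bA; apply: bounded_closed_compact => //.
exists M; split; first exact: num_real.
by move=> t Mt x /bA xM; apply: (le_trans (norm_le_enorm x)); rewrite (le_trans xM) // ltW.
Qed.

Lemma closed_cball y (s : R) : closed [set x | enorm (x - y) <= s].
Proof.
by apply: (@preimage_closed _ _ (fun x => enorm (x - y)) [set t | t <= s]);
   [move=> x _; exact: continuous_dist | exact: closed_le].
Qed.

Lemma compact_cball y (s : R) : compact [set x | enorm (x - y) <= s].
Proof.
apply: (@closed_bounded_compact _ (s + enorm y)); first exact: closed_cball.
by move=> x /= xs; rewrite -[x](subrK y) (le_trans (enormD _ _)) // lerD2r.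
Qed.

Lemma compact_sphere : compact [set x : 'rV[R]_N | enorm x = 1].
Proof.
apply: (@closed_bounded_compact _ 1); last by move=> x /= ->.
by apply: (@preimage_closed _ _ (@enorm R N) [set t | t = 1]);
   [move=> x _; exact: continuous_enorm | exact: closed_eq].
Qed.

End Compactness.

(** * The least eigenvalue *)

Section Spectral.
Variables (R : realType) (N : nat).
Implicit Types (h e : 'rV[R]_N) (X : 'M[R]_N).

Lemma quadratic_ge0_linear0 (a c : R) :
  (forall t, 0 <= 2 * t * a + t ^+ 2 * c) -> a = 0.
Proof.
move=> h; have c0 : 0 < 1 + `|c| by rewrite ltr_pwDl.
have := h (- a / (1 + `|c|)).
have -> : 2 * (- a / (1 + `|c|)) * a + (- a / (1 + `|c|)) ^+ 2 * c =
  - a ^+ 2 * (2 * (1 + `|c|) - c) / (1 + `|c|) ^+ 2 by field; rewrite gt_eqF.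
rewrite pmulr_lge0 ?invr_gt0 ?exprn_gt0 // mulNr oppr_ge0 pmulr_lle0; last first.
  by have := ler_norm c; have := normr_ge0 c; lra.
by move=> a2; apply/eqP; rewrite -sqrf_eq0 eq_le a2 sqr_ge0.
Qed.

(** A minimizer of the quadratic form on the unit sphere is an eigenvector,
    because the first variation of the Rayleigh quotient vanishes there. *)
Lemma P1minus_rayleigh X : (0 < N)%N -> X^T = X ->
  (exists2 e, dot e e = 1 & P1minus X = qf X e) /\
  (forall e, dot e e = 1 -> P1minus X <= qf X e).
Proof.
move=> N0 sX; pose i0 := Ordinal N0.
have unitE e : enorm e = 1 -> dot e e = 1 by rewrite -enorm_sqr => ->; rewrite expr1n.
have [||e|e eS emin] := @usc_attains_max R _ [set x : 'rV[R]_N | enorm x = 1]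
    (fun x => - qf X x).
- exact: compact_sphere.
- by exists (delta_mx ord0 i0); exact: enorm_delta.
- move=> _ a ha.
  have ce : continuous (fun x => - qf X x).
    by move=> x; apply: continuousN; exact: continuous_qf.
  by have /cvgr_lt/(_ a ha) := ce e; apply: filterS.
have {}emin h : qf X e * dot h h <= qf X h.
  have [->|h0] := eqVneq h 0; first by rewrite dot0l mulr0 qf0.
  have hp := enorm_gt0 h0.
  have := emin ((enorm h)^-1 *: h).
  rewrite /= enormZ ger0_norm ?invr_ge0 ?enorm_ge0 // mulVf ?gt_eqF //.
  move=> /(_ erefl); rewrite lerN2 qfZ -enorm_sqr exprVn.
  by rewrite [_^-1 * _]mulrC ler_pdivlMr // exprn_gt0.
have ee : dot e e = 1 by exact: unitE.
have var h : dot (e *m X) h = qf X e * dot e h.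
  apply/eqP; rewrite -subr_eq0; apply/eqP.
  apply: (@quadratic_ge0_linear0 _ (qf X h - qf X e * dot h h)) => t.
  have := emin (e + t *: h); rewrite -subr_ge0 (qfD _ _ sX) qfZ !dotE (dotC h e) ee.
  by apply: eq_ind; congr (_ <= _); ring.
have eig : e *m X = qf X e *: e.
  by apply/eqP; rewrite -subr_eq0; apply/eqP/dotxx_eq0; rewrite dotDl var dotNl dotZl subrr.
have lb : lbound [set a : R | eigenvalue X a] (qf X e).
  move=> a /= /eigenvalueP [v vX v0].
  have vv : 0 < dot v v by rewrite -enorm_sqr exprn_gt0 // enorm_gt0.
  by have := emin v; rewrite {2}/qf vX !dotE ler_pM2r.
have mem : eigenvalue X (qf X e).
  apply/eigenvalueP; exists e => //; apply/eqP => e0.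
  by move: ee; rewrite e0 dot0l => /eqP; rewrite eq_sym oner_eq0.
have PE : P1minus X = qf X e.
  apply/eqP; rewrite eq_le; apply/andP; split.
    by apply: ge_inf => //; exists (qf X e).
  by apply: lb_le_inf => //; exists (qf X e).
split; first by exists e.
by move=> h hh; rewrite PE -[leLHS]mulr1 -hh emin.
Qed.

End Spectral.

(** * Second-order Taylor expansion *)

Section Calculus.
Variables (R : realType) (N : nat).
Implicit Types (x y v h k p : 'rV[R]_N) (X : 'M[R]_N) (f phi : 'rV[R]_N -> R).

Lemma is_derive_quadratic f x v (a c : R) :
  (forall t, f (x + t *: v) = f x + t * a + t ^+ 2 * c) -> is_derive x v f a.
Proof.
move=> hf.
have cv : (fun h : R => h^-1 *: ((f \o shift x) (h *: v) - f x)) @ 0^' --> a.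
  have cc : continuous (fun h : R => a + h * c).
    move=> h; apply: cvgD; first exact: cvg_cst.
    by apply: cvgM; [exact: cvg_id|exact: cvg_cst].
  have cg : (fun h : R => a + h * c) @ 0^' --> a.
    by apply: cvg_within_filter; have := cc 0; rewrite /continuous_at mul0r addr0.
  apply: cvg_trans cg; apply: near_eq_cvg.
  near=> h; have h0 : h != 0 by near: h; exact: nbhs_dnbhs_neq.
  by rewrite /= [_ *: v + x]addrC hf /GRing.scale /=; field.
split; first by apply/cvg_ex; exists a.
exact: cvg_lim cv.
Unshelve. all: by end_near. Qed.

Lemma is_derive_line f x v (t : R) : derivable f (x + t *: v) v ->
  is_derive t (1 : R) (fun s : R => f (x + s *: v)) ('D_v f (x + t *: v)).
Proof.
have E : (fun h : R => h^-1 *: (((fun s : R => f (x + s *: v)) \o shift t) (h *: (1 : R))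
            - f (x + t *: v)))
       = (fun h : R => h^-1 *: ((f \o shift (x + t *: v)) (h *: v) - f (x + t *: v))).
  apply: funext => h; congr (_ *: (f _ - _)).
  by rewrite /= [_ *: (1 : R)]mulr1 scalerDl addrCA.
move=> df; split; first by rewrite /derivable E.
by rewrite /derive E.
Qed.

Lemma mean_value_line f x v (t : R) :
  (forall s, `|s| <= `|t| -> derivable f (x + s *: v) v) ->
  exists2 c, `|c| <= `|t| & f (x + t *: v) - f x = t * 'D_v f (x + c *: v).
Proof.
move=> df; set g := fun s : R => f (x + s *: v).
have dg s : `|s| <= `|t| -> is_derive s (1 : R) g ('D_v f (x + s *: v)).
  by move=> st; apply: is_derive_line; exact: df.
have g0 : f x = g 0 by rewrite /g scale0r addr0.
have cg a b : (forall s, s \in `[a, b] -> `|s| <= `|t|) ->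
    {within `[a, b], continuous g}.
  move=> ab; apply: derivable_within_continuous => s /ab /dg [].
  by [].
rewrite g0; have [t0|t0] := leP 0 t.
  have T s : s \in `[0, t] -> `|s| <= `|t|.
    by rewrite in_itv /= => /andP[s0 st]; rewrite !ger0_norm.
  have [|c ct ->] := @MVT_segment R g (fun s => 'D_v f (x + s *: v)) 0 t t0 _ (cg _ _ T).
    by move=> s; rewrite in_itv /= => /andP[s0 st]; apply/dg/T; rewrite in_itv /= !ltW.
  by exists c; [exact: T|rewrite subr0 mulrC].
have T s : s \in `[t, 0] -> `|s| <= `|t|.
  by rewrite in_itv /= => /andP[s0 st]; rewrite ler0_norm // ltr0_norm // lerN2.
have [|c ct E] := @MVT_segment R g (fun s => 'D_v f (x + s *: v)) t 0 (ltW t0) _ (cg _ _ T).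
  by move=> s; rewrite in_itv /= => /andP[s0 st]; apply/dg/T; rewrite in_itv /= !ltW.
exists c; first exact: T.
by rewrite -[LHS]opprB E sub0r mulrN opprK mulrC.
Qed.

(** Changing the coordinates one at a time reduces this to the mean value theorem
    on segments parallel to the axes. *)
Lemma increment_le f x h (eta : R) :
  (forall k, enorm k <= enorm h -> forall i : 'I_N,
     derivable f (x + k) (delta_mx ord0 i) /\ `|partial i f (x + k)| <= eta) ->
  `|f (x + h) - f x| <= N%:R * eta * enorm h.
Proof.
move=> hf.
(* tr j takes the first j coordinates from h *)
pose tr (j : nat) : 'rV[R]_N := \row_i (if (i < j)%N then h ord0 i else 0).
have normle k : (forall i, `|k ord0 i| <= `|h ord0 i|) -> enorm k <= enorm h.
  move=> kh; rewrite ler_enorm ?enorm_ge0 // enorm_sqr.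
  apply: ler_sum => i _; rewrite -!expr2 -(real_normK (num_real (k _ _))).
  by rewrite -(real_normK (num_real (h _ _))) ler_pXn2r ?nnegrE.
have eta0 (i : 'I_N) : 0 <= eta.
  by have [_] := hf _ (lexx _) i; apply: le_trans; exact: normr_ge0.
suff H j : (j <= N)%N -> `|f (x + tr j) - f x| <= j%:R * eta * enorm h.
  have hE : tr N = h by apply/rowP => i; rewrite mxE ltn_ord.
  by have := H N (leqnn N); rewrite hE.
elim: j => [_|j IH jN].
  have -> : tr 0%N = 0 by apply/rowP => i; rewrite !mxE ltn0.
  by rewrite addr0 subrr normr0 !mul0r.
pose i := Ordinal jN.
have trS : tr j.+1 = tr j + h ord0 i *: delta_mx ord0 i.
  apply/rowP => l; rewrite !mxE eqxx /= ltnS leq_eqVlt eq_sym.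
  have [->|li] := eqVneq l i; first by rewrite /= eqxx ltnn mulr1 add0r.
  have -> : (j == l :> nat) = false by apply: contra_neqF li => /eqP E; apply/val_inj.
  by rewrite /= mulr0 addr0.
have inb s : `|s| <= `|h ord0 i| -> enorm (tr j + s *: delta_mx ord0 i) <= enorm h.
  move=> sh; apply: normle => l; rewrite !mxE eqxx /=.
  have [->|li] := eqVneq l i; first by rewrite /= ltnn mulr1 add0r.
  by rewrite mulr0 addr0; case: ifP; rewrite ?normr0.
have [|c ch E] := @mean_value_line f (x + tr j) (delta_mx ord0 i) (h ord0 i).
  by move=> s /inb sh; rewrite -addrA; case: (hf _ sh i).
have -> : f (x + tr j.+1) - f x = (f (x + tr j.+1) - f (x + tr j)) + (f (x + tr j) - f x).
  by rewrite subrKA.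
apply: (le_trans (ler_normD _ _)).
have -> : j.+1%:R * eta * enorm h = eta * enorm h + j%:R * eta * enorm h.
  by rewrite -[j.+1%:R]natr1; ring.
apply: lerD; last exact: IH (ltnW jN).
rewrite trS addrA E normrM mulrC ler_pM // ?entry_le_enorm //.
by rewrite -addrA; case: (hf _ (inb _ ch) i).
Qed.

Definition C1_at f x : Prop :=
  exists2 s, 0 < s & forall h, enorm h < s -> forall i : 'I_N,
    derivable f (x + h) (delta_mx ord0 i) /\
    (forall e, 0 < e -> exists2 s', 0 < s' &
       forall k, enorm k < s' -> `|partial i f (x + k) - partial i f x| < e).

Lemma finite_radius (P : 'I_N -> R -> Prop) :
  (forall i s t, P i s -> t <= s -> P i t) ->
  (forall i, exists2 s, 0 < s & P i s) ->
  exists2 s, 0 < s & forall i, P i s.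
Proof.
move=> mono hP; pose s i := sval (cid2 (hP i)).
have s0 i : 0 < s i by rewrite /s; case: cid2.
have sP i : P i (s i) by rewrite /s; case: cid2.
exists (\big[Num.min/1]_i s i).
  by elim/big_ind: _ => // a b a0 b0; rewrite lt_min a0.
by move=> i; apply: (mono _ _ _ (sP i)); exact: bigmin_le.
Qed.

Lemma dot_derive p x (i : 'I_N) : is_derive x (delta_mx ord0 i) (dot p) (p ord0 i).
Proof.
apply: (@is_derive_quadratic _ _ _ _ 0) => t.
by rewrite !dotE dot_delta mulr0 addr0.
Qed.

Lemma first_order f x : C1_at f x -> forall e, 0 < e -> exists2 s, 0 < s &
  forall h, enorm h < s -> `|f (x + h) - f x - dot (grad f x) h| <= e * enorm h.
Proof.
move=> [s0 s0p hs0] e e0.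
have N1 : 0 < (N%:R + 1 : R) by rewrite ltr_wpDl.
pose e' := e / (N%:R + 1).
have e'0 : 0 < e' by rewrite divr_gt0.
have [|i|s1 s1p hs1] := @finite_radius (fun i s => forall k, enorm k < s ->
   `|partial i f (x + k) - partial i f x| < e').
- by move=> i s t hs ts k /lt_le_trans - /(_ _ ts); exact: hs.
- have z : enorm (0 : 'rV[R]_N) < s0 by rewrite enorm0.
  by have [_ /(_ e' e'0)] := hs0 _ z i.
exists (Num.min s0 s1); first by rewrite lt_min s0p.
move=> h; rewrite lt_min => /andP[hh0 hh1].
pose r y := f y - dot (grad f x) y.
have -> : f (x + h) - f x - dot (grad f x) h = r (x + h) - r x.
  by rewrite /r !dotE; ring.
apply: (le_trans (@increment_le r x h e' _)); last first.
  apply: ler_wpM2r; first exact: enorm_ge0.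
  by rewrite /e' mulrA ler_pdivrMr // mulrC ler_wpM2l ?ltW // ltrDl.
move=> k kh i; have k0 := le_lt_trans kh hh0; have k1 := le_lt_trans kh hh1.
have [dfi _] := hs0 _ k0 i.
have D : is_derive (x + k) (delta_mx ord0 i) r (partial i f (x + k) - grad f x ord0 i).
  apply: is_deriveB; [exact: derivableP|exact: dot_derive].
split; first exact: ex_derive.
by rewrite /partial (derive_val (is_derive := D)) /grad mxE ltW // hs1.
Qed.

Definition C2_at phi x : Prop :=
  [/\ exists2 s, 0 < s & forall h, enorm h < s ->
        forall i : 'I_N, derivable phi (x + h) (delta_mx ord0 i)
    & forall i : 'I_N, C1_at (partial i phi) x].

Lemma hessian_row phi x (i : 'I_N) h :
  dot (grad (partial i phi) x) h = (h *m (hessian phi x)^T) ord0 i.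
Proof.
by rewrite mxE /dot; apply: eq_bigr => j _; rewrite !mxE mulrC.
Qed.

Lemma grad_first_order phi x : C2_at phi x -> forall e, 0 < e ->
  exists2 s, 0 < s & forall h, enorm h < s -> forall i : 'I_N,
    [/\ derivable phi (x + h) (delta_mx ord0 i) &
    `|partial i phi (x + h) - partial i phi x
      - (h *m (hessian phi x)^T) ord0 i| <= e * enorm h].
Proof.
move=> [[s0 s0p d0] c1] e e0.
have [|i|s1 s1p hs1] := @finite_radius (fun i s => forall h, enorm h < s ->
   `|partial i phi (x + h) - partial i phi x - dot (grad (partial i phi) x) h|
      <= e * enorm h).
- by move=> i s t hs ts k /lt_le_trans - /(_ _ ts); exact: hs.
- exact: first_order.
exists (Num.min s0 s1); first by rewrite lt_min s0p.
move=> h; rewrite lt_min => /andP[hh0 hh1] i; split; first exact: d0.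
by rewrite -hessian_row; exact: hs1.
Qed.

(** Schwarz: both mixed derivatives are the limit of the same second
    difference quotient. *)
Lemma hessian_sym phi x : C2_at phi x -> (hessian phi x)^T = hessian phi x.
Proof.
move=> c2.
pose D (i j : 'I_N) (t : R) := phi (x + t *: delta_mx ord0 i + t *: delta_mx ord0 j)
  - phi (x + t *: delta_mx ord0 i) - phi (x + t *: delta_mx ord0 j) + phi x.
have key i j e : 0 < e -> exists2 s, 0 < s &
    forall t, 0 < t -> t < s -> `|D i j t - t ^+ 2 * hessian phi x i j| <= e * t ^+ 2.
  move=> e0; have e30 : 0 < e / 3 by rewrite divr_gt0.
  have [s s0 hs] := grad_first_order c2 e30.
  exists (s / 2); first by rewrite divr_gt0.
  move=> t t0; rewrite ltr_pdivlMr // mulrC => ts.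
  pose psi y := phi (y + t *: delta_mx ord0 j) - phi y.
  have nrm c : `|c| <= `|t| -> enorm (c *: delta_mx ord0 i : 'rV[R]_N) <= t /\
      enorm (c *: delta_mx ord0 i + t *: delta_mx ord0 j : 'rV[R]_N) <= 2 * t.
    rewrite [`|t|]gtr0_norm // => ct.
    have A : enorm (c *: delta_mx ord0 i : 'rV[R]_N) <= t by rewrite enormZ enorm_delta mulr1.
    split=> //; apply: (le_trans (enormD _ _)).
    by rewrite [enorm (t *: _)]enormZ enorm_delta mulr1 gtr0_norm // mulr_natl mulr2n lerD.
  have dpsi c : `|c| <= `|t| -> is_derive (x + c *: delta_mx ord0 i) (delta_mx ord0 i) psi
     (partial i phi (x + (c *: delta_mx ord0 i + t *: delta_mx ord0 j))
       - partial i phi (x + c *: delta_mx ord0 i)).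
    move=> /nrm [n1 n2].
    have [|d1 _] := hs (c *: delta_mx ord0 i) _ i; first by apply: le_lt_trans n1 _; lra.
    have [|d2 _] := hs (c *: delta_mx ord0 i + t *: delta_mx ord0 j) _ i.
      exact: le_lt_trans n2 _.
    apply: is_deriveB; last exact: derivableP.
    have E y : (fun z : R => z^-1 *: (((fun z0 => phi (z0 + t *: delta_mx ord0 j)) \o shift y)
            (z *: delta_mx ord0 i) - phi (y + t *: delta_mx ord0 j)))
        = (fun z : R => z^-1 *: ((phi \o shift (y + t *: delta_mx ord0 j))
            (z *: delta_mx ord0 i) - phi (y + t *: delta_mx ord0 j))).
      by apply: funext => z /=; rewrite addrA.
    split; first by rewrite /derivable E -addrA.
    by rewrite /derive E /partial /derive addrA.
  have [|c ct E] := @mean_value_line psi x (delta_mx ord0 i) t.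
    by move=> c /dpsi [].
  have -> : D i j t = psi (x + t *: delta_mx ord0 i) - psi x by rewrite /D /psi; ring.
  rewrite E (derive_val (is_derive := dpsi c ct)).
  have [n1 n2] := nrm c ct.
  have [|_ B1] := hs (c *: delta_mx ord0 i) _ i; first by apply: le_lt_trans n1 _; lra.
  have [|_ B2] := hs (c *: delta_mx ord0 i + t *: delta_mx ord0 j) _ i.
    exact: le_lt_trans n2 _.
  have hX : ((t *: delta_mx ord0 j : 'rV[R]_N) *m (hessian phi x)^T) ord0 i =
      t * hessian phi x i j by rewrite -scalemxAl -rowE !mxE.
  move: B2; rewrite mulmxDl mxE hX.
  move: B1; set a := (_ *m _) ord0 i; set H := hessian phi x i j.
  set P1 := partial i phi (x + c *: _); set P2 := partial i phi (x + (_ + _)).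
  set P0 := partial i phi x => B1 B2.
  have -> : t * (P2 - P1) - t ^+ 2 * H = t * ((P2 - P0 - (a + t * H)) - (P1 - P0 - a)) by ring.
  rewrite normrM gtr0_norm // [e * _]mulrC expr2 -mulrA ler_pM2l //.
  apply: (le_trans (ler_normB _ _)).
  have : e / 3 * enorm (c *: delta_mx ord0 i : 'rV[R]_N) <= e / 3 * t by rewrite ler_pM2l.
  have : e / 3 * enorm (c *: delta_mx ord0 i + t *: delta_mx ord0 j : 'rV[R]_N)
      <= e / 3 * (2 * t).
    by rewrite ler_pM2l.
  move: B1 B2; set b1 := `|_|; set b2 := `|_|; lra.
apply/matrixP => i j; rewrite mxE; apply/eqP; rewrite -subr_eq0 -normr_le0.
apply/ler_addgt0Pl => e e0; rewrite addr0.
have e20 : 0 < e / 2 by rewrite divr_gt0.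
have [s1 s1p h1] := key i j _ e20; have [s2 s2p h2] := key j i _ e20.
pose t := Num.min s1 s2 / 2.
have m0 : 0 < Num.min s1 s2 by rewrite lt_min s1p.
have t0 : 0 < t by rewrite divr_gt0.
have tm : t < Num.min s1 s2 by rewrite /t; lra.
move: tm; rewrite lt_min => /andP[ts1 ts2].
have := h1 t t0 ts1; have := h2 t t0 ts2.
have -> : D j i t = D i j t.
  by rewrite /D -!addrA [t *: delta_mx ord0 j + t *: _]addrC; congr (_ + _); ring.
move=> k1 k2; rewrite -(ler_pM2l (exprn_gt0 2 t0)).
rewrite -[X in X * `|_|](gtr0_norm (exprn_gt0 2 t0)) -normrM.
have -> : t ^+ 2 * (hessian phi x j i - hessian phi x i j) =
  (D i j t - t ^+ 2 * hessian phi x i j) - (D i j t - t ^+ 2 * hessian phi x j i) by ring.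
by apply: (le_trans (ler_normB _ _)); lra.
Qed.

(** The remainder has partial derivatives of size o(|h|), hence is o(|h|^2). *)
Lemma second_order phi x : C2_at phi x -> forall e, 0 < e -> exists2 s, 0 < s &
  forall h, enorm h < s ->
  `|phi (x + h) - phi x - dot (grad phi x) h - qf (hessian phi x) h / 2|
     <= e * enorm h ^+ 2.
Proof.
move=> c2 e e0.
have N1 : 0 < (N%:R + 1 : R) by rewrite ltr_wpDl.
pose e' := e / (N%:R + 1).
have e'0 : 0 < e' by rewrite divr_gt0.
have [s s0 hs] := grad_first_order c2 e'0.
have sX := hessian_sym c2; set X := hessian phi x in sX hs *.
exists s => // h hh.
pose q y := dot (grad phi x) y + qf X (y - x) / 2.
have dq k i : is_derive (x + k) (delta_mx ord0 i) q
    (partial i phi x + (k *m X) ord0 i).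
  apply: (@is_derive_quadratic _ _ _ _ (qf X (delta_mx ord0 i) / 2)) => t.
  rewrite /q (_ : x + k + _ - x = k + t *: delta_mx ord0 i); last by rewrite addrC addrA addKr.
  rewrite (_ : x + k - x = k); last by rewrite addrC addKr.
  by rewrite (qfD _ _ sX) qfZ !dotE !dot_delta [grad phi x ord0 i]mxE; field.
pose r y := phi y - q y.
have -> : phi (x + h) - phi x - dot (grad phi x) h - qf X h / 2 = r (x + h) - r x.
  rewrite /r /q subrr qf0 (_ : x + h - x = h); last by rewrite addrC addKr.
  by rewrite !dotE; ring.
apply: (le_trans (@increment_le r x h (e' * enorm h) _)); last first.
  rewrite expr2 !mulrA; apply: ler_wpM2r; first exact: enorm_ge0.
  apply: ler_wpM2r; first exact: enorm_ge0.
  by rewrite ler_pdivrMr // mulrC ler_wpM2l ?ltW // ltrDl.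
move=> k kh i; have ks := le_lt_trans kh hh.
have [d1 d2] := hs _ ks i.
have D : is_derive (x + k) (delta_mx ord0 i) r
    (partial i phi (x + k) - (partial i phi x + (k *m X) ord0 i)).
  by apply: is_deriveB; exact: derivableP.
split; first exact: ex_derive.
rewrite /partial (derive_val (is_derive := D)) opprD addrA.
move: d2; rewrite sX => /le_trans; apply.
by rewrite ler_wpM2l // ltW.
Qed.

End Calculus.

(** * Jets and viscosity inequalities *)

Section Jets.
Variables (R : realType) (N : nat).
Implicit Types (x y h k p e : 'rV[R]_N) (X : 'M[R]_N) (u v phi : 'rV[R]_N -> R)
  (Om : set 'rV[R]_N) (G : 'rV[R]_N -> R -> 'rV[R]_N -> R).

Definition jet_above v x p X : Prop := exists2 s, 0 < s &
  forall h, enorm h < s -> v (x + h) <= v x + dot p h + qf X h / 2.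

Definition jet_below v x p X : Prop := exists2 s, 0 < s &
  forall h, enorm h < s -> v x + dot p h + qf X h / 2 <= v (x + h).

(** The least eigenvalue enters as the infimum of the quadratic form over unit
    vectors, so that a test with a single direction e suffices in estimates. *)
Definition jet_sub Om G v : Prop := forall x p X e, Om x -> X^T = X ->
  jet_above v x p X -> dot e e = 1 -> 0 <= qf X e + G x (v x) p.

Definition jet_super Om G v : Prop := forall x p X eta, Om x -> X^T = X ->
  jet_below v x p X -> 0 < eta ->
  exists2 e, dot e e = 1 & qf X e + G x (v x) p < eta.

Definition usc_at v x : Prop := forall a, v x < a -> \forall y \near x, v y < a.

Lemma usc_atP v x : usc_at v x <->
  (forall a, v x < a -> exists2 s, 0 < s & forall h, enorm h < s -> v (x + h) < a).
Proof.
split=> h a va; first by have /nbhs_enormP := h a va.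
by apply/nbhs_enormP; exact: h.
Qed.

Lemma qf_sub_scalar X a h : qf (X - a%:M) h = qf X h - a * dot h h.
Proof. by rewrite /qf mulmxBr mul_mx_scalar !dotE. Qed.

Lemma continuous_usc v x : {for x, continuous v} -> usc_at v x.
Proof. by move=> cv a va; have /cvgr_lt/(_ a va) := cv; apply: filterS. Qed.

Lemma local_quadratic_ge0 (a c s : R) : 0 < s ->
  (forall t, `|t| < s -> 0 <= t * a + t ^+ 2 * c) -> a = 0 /\ 0 <= c.
Proof.
move=> s0 ht.
have half b : (forall t, 0 < t -> t < s -> 0 <= b + t * c) -> 0 <= b.
  move=> hb; rewrite leNgt; apply/negP => b0.
  have c1 : 0 < 1 + `|c| by rewrite ltr_pwDl.
  pose t := Num.min (s / 2) (- b / 2 / (1 + `|c|)).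
  have t0 : 0 < t by rewrite lt_min !divr_gt0 // oppr_gt0.
  have ts : t < s by rewrite gt_min; apply/orP; left; lra.
  have tb : t * (1 + `|c|) <= - b / 2 by rewrite -ler_pdivlMr // ge_min lexx orbT.
  have := hb t t0 ts; have := ler_norm c.
  have : t * c <= t * `|c| by rewrite ler_pM2l // ler_norm.
  lra.
have a1 : 0 <= a.
  apply: half => t t0 ts; have := ht t; rewrite gtr0_norm // => /(_ ts).
  by rewrite expr2 -mulrA -mulrDr pmulr_rge0.
have a2 : 0 <= - a.
  apply: half => t t0 ts; have := ht (- t); rewrite normrN gtr0_norm // => /(_ ts).
  by rewrite sqrrN mulNr -mulrN expr2 -mulrA -mulrDr pmulr_rge0.
have a0 : a = 0 by apply/eqP; rewrite eq_le a1 andbT -oppr_ge0.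
split=> //; have := ht (s / 2).
rewrite gtr0_norm ?divr_gt0 // a0 mulr0 add0r pmulr_rge0 ?exprn_gt0 ?divr_gt0 //.
by apply; lra.
Qed.

Lemma jet_compare p1 p2 X1 X2 s : 0 < s ->
  (forall h, enorm h < s -> dot p1 h + qf X1 h / 2 <= dot p2 h + qf X2 h / 2) ->
  p1 = p2 /\ forall e, qf X1 e <= qf X2 e.
Proof.
move=> s0 hs.
have key e : dot (p2 - p1) e = 0 /\ 0 <= (qf X2 e - qf X1 e) / 2.
  have e1 : 0 < enorm e + 1 by rewrite ltr_wpDl ?enorm_ge0.
  apply: (@local_quadratic_ge0 _ _ (s / (enorm e + 1))); first by rewrite divr_gt0.
  move=> t; rewrite ltr_pdivlMr // => ts.
  have := hs (t *: e); rewrite enormZ !qfZ !dotE.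
  have tt : `|t| * enorm e < s.
    by apply: le_lt_trans ts; rewrite ler_wpM2l // lerDl.
  by move=> /(_ tt); rewrite -subr_ge0; apply: eq_ind; congr (_ <= _); ring.
split=> [|e]; last by have [_] := key e; lra.
by apply/esym/eqP; rewrite -subr_eq0; apply/eqP/dotxx_eq0; case: (key (p2 - p1)).
Qed.

Lemma C2_on_at Om phi x : open Om -> C2_on Om phi -> Om x -> C2_at phi x.
Proof.
move=> oO [[_ c1] c2] Ox.
have /nbhs_enormP [s s0 hs] : nbhs x Om by exact: open_nbhs_nbhs.
split; first by exists s => // h /hs Oh i; case: (c1 i) => + _; apply.
move=> i; exists s => // h /hs Oh j; have [_ d2] := c2 i; have [d cj] := d2 j.
split; first exact: d.
move: cj; rewrite continuous_open_subspace // => /(_ x); rewrite inE => /(_ Ox).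
by move=> /continuous_enorm_at.
Qed.

(** Adding eps times the identity to the Hessian absorbs the Taylor remainder of
    the test function. *)
Lemma visc_sub_intro Om G v : (0 < N)%N -> open Om ->
  (forall x, Om x -> usc_at v x) -> jet_sub Om G v ->
  visc_sub Om (fun x s p X => P1minus X + G x s p) v.
Proof.
move=> N0 oO usc js; split=> [x Ox e e0|x phi Ox c2 [phix tch]].
  have := usc x Ox (v x + e); rewrite ltrDl => /(_ e0).
  by apply: filterS => y + _.
have c2x := C2_on_at oO c2 Ox; have sX := hessian_sym c2x.
have [[e ee ->] _] := P1minus_rayleigh N0 sX.
apply/ler_addgt0Pl => eps eps0; rewrite addrA.
have -> : eps + qf (hessian phi x) e = qf (hessian phi x + eps%:M) e.
  by rewrite qf_add qf_scalar ee mulr1 addrC.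
apply: js => //; first by rewrite raddfD /= tr_scalar_mx sX.
have /nbhs_enormP [s1 s10 h1] : nbhs x Om by exact: open_nbhs_nbhs.
have [s2 s20 h2] := second_order c2x (divr_gt0 eps0 (ltr0n _ 2)).
have /nbhs_enormP [s3 s30 h3] : nbhs x [set y | Om y -> v y <= phi y] by [].
exists (Num.min s1 (Num.min s2 s3)); first by rewrite !lt_min s10 s20.
move=> h; rewrite !lt_min => /and3P[hh1 hh2 hh3].
apply: le_trans (h3 _ hh3 (h1 _ hh1)) _.
have := h2 _ hh2; rewrite ler_norml => /andP[_].
rewrite qf_add qf_scalar -enorm_sqr phix; lra.
Qed.

Lemma visc_super_intro Om G v : (0 < N)%N -> open Om ->
  (forall x, Om x -> {for x, continuous v}) -> jet_super Om G v ->
  visc_super Om (fun x s p X => P1minus X + G x s p) v.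
Proof.
move=> N0 oO cv js; split=> [x Ox e e0|x phi Ox c2 [phix tch]].
  have : v x - e < v x by rewrite gtrDl oppr_lt0.
  by move=> ve; have /cvgr_gt/(_ _ ve) := cv x Ox; apply: filterS => y + _.
have c2x := C2_on_at oO c2 Ox; have sX := hessian_sym c2x.
have [_ ray] := P1minus_rayleigh N0 sX.
rewrite leNgt; apply/negP => Fpos.
set F := _ + _ in Fpos; pose eta := F / 2.
have eta0 : 0 < eta by rewrite divr_gt0.
have [||e ee] := js x (grad phi x) (hessian phi x - eta%:M) eta Ox _ _ eta0.
- by rewrite raddfB /= tr_scalar_mx sX.
- have /nbhs_enormP [s1 s10 h1] : nbhs x Om by exact: open_nbhs_nbhs.
  have [s2 s20 h2] := second_order c2x (divr_gt0 eta0 (ltr0n _ 2)).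
  have /nbhs_enormP [s3 s30 h3] : nbhs x [set y | Om y -> phi y <= v y] by [].
  exists (Num.min s1 (Num.min s2 s3)); first by rewrite !lt_min s10 s20.
  move=> h; rewrite !lt_min => /and3P[hh1 hh2 hh3].
  apply: le_trans (h3 _ hh3 (h1 _ hh1)).
  have := h2 _ hh2; rewrite ler_norml => /andP[+ _].
  rewrite qf_sub_scalar -enorm_sqr phix; lra.
rewrite qf_sub_scalar ee.
by have := ray e ee; rewrite /eta /F; lra.
Qed.

Definition paraboloid x p X (c : R) : 'rV[R]_N -> R :=
  fun y => c + dot p (y - x) + qf X (y - x) / 2.

Section Paraboloid.
Variables (x p : 'rV[R]_N) (X : 'M[R]_N) (c : R).
Hypothesis sX : X^T = X.

Lemma paraboloid_expand y h : paraboloid x p X c (y + h) =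
  paraboloid x p X c y + dot (p + (y - x) *m X) h + qf X h / 2.
Proof.
by rewrite /paraboloid (_ : y + h - x = y - x + h) 1?addrAC // (qfD _ _ sX) !dotE; field.
Qed.

Lemma continuous_paraboloid : continuous (paraboloid x p X c).
Proof.
move=> y; apply/continuous_enorm_at => e e0; have [C C0 hC] := qf_bound X.
set w := p + (y - x) *m X.
have D0 : 0 < enorm w + C + 1 by rewrite ltr_wpDl // addr_ge0 ?enorm_ge0.
exists (Num.min 1 (e / (enorm w + C + 1))); first by rewrite lt_min ltr01 divr_gt0.
move=> h; rewrite lt_min => /andP[h1]; rewrite ltr_pdivlMr // => he.
rewrite paraboloid_expand -/w.
have -> : paraboloid x p X c y + dot w h + qf X h / 2 - paraboloid x p X c y =
  dot w h + qf X h / 2 by ring.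
apply: le_lt_trans he; apply: (le_trans (ler_normD _ _)).
rewrite normrM (ger0_norm (_ : 0 <= 2^-1)) ?invr_ge0 //.
have := cauchy_schwarz_abs w h; have := hC h h; rewrite -/(qf X h).
have h0 := enorm_ge0 h; have w0 := enorm_ge0 w.
have : C * enorm h * enorm h <= C * enorm h * 1 by rewrite ler_wpM2l ?mulr_ge0 // ltW.
have := mulr_ge0 C0 h0.
set a := `|dot w h|; set b := `|qf X h|; nra.
Qed.

Lemma is_derive_paraboloid y (i : 'I_N) :
  is_derive y (delta_mx ord0 i) (paraboloid x p X c) ((p + (y - x) *m X) ord0 i).
Proof.
apply: (@is_derive_quadratic _ _ _ _ _ _ (qf X (delta_mx ord0 i) / 2)) => t.
by rewrite paraboloid_expand dotZr dot_delta qfZ mulrA.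
Qed.

Lemma partial_paraboloid (i : 'I_N) :
  partial i (paraboloid x p X c) =
  paraboloid x (delta_mx ord0 i *m X) 0 (p ord0 i).
Proof.
apply: funext => y; rewrite /partial (derive_val (is_derive := is_derive_paraboloid y i)).
rewrite /paraboloid mxE dot_mulmx sX /qf mulmx0 dot0l mul0r addr0.
by rewrite [dot (delta_mx _ _) _]dotC dot_delta.
Qed.

End Paraboloid.

Lemma partial_paraboloid2 x p X c (i j : 'I_N) : X^T = X ->
  partial j (partial i (paraboloid x p X c)) = fun=> X i j.
Proof.
move=> sX; rewrite partial_paraboloid // partial_paraboloid ?trmx0 //.
apply: funext => y; rewrite /paraboloid /qf !mulmx0 !dot0l mul0r !addr0.
by rewrite -rowE mxE.
Qed.

Lemma C2_on_paraboloid Om x p X c : X^T = X -> C2_on Om (paraboloid x p X c).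
Proof.
have C1 p' X' c' : X'^T = X' -> C1_on Om (paraboloid x p' X' c').
  move=> sX'; split; first exact/continuous_subspaceT/continuous_paraboloid.
  move=> i; split; first by move=> y _; case: (is_derive_paraboloid x p' c' sX' y i).
  rewrite partial_paraboloid //; apply/continuous_subspaceT.
  exact: (continuous_paraboloid (trmx0 _ _ _)).
move=> sX; split; first exact: C1.
by move=> i; rewrite partial_paraboloid //; apply: C1; rewrite trmx0.
Qed.

Lemma visc_sub_jet Om G v : (0 < N)%N ->
  visc_sub Om (fun x s p X => P1minus X + G x s p) v -> jet_sub Om G v.
Proof.
move=> N0 [_ vs] x p X e Ox sX [s s0 hs] ee.
have [_ ray] := P1minus_rayleigh N0 sX.
apply: le_trans (_ : P1minus X + G x (v x) p <= _); last by rewrite lerD2r ray.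
have := vs x (paraboloid x p X (v x)) Ox (C2_on_paraboloid _ _ _ _ sX).
have -> : grad (paraboloid x p X (v x)) x = p.
  apply/rowP => i; rewrite mxE partial_paraboloid // /paraboloid subrr.
  by rewrite dot0r qf0 mul0r !addr0.
have -> : hessian (paraboloid x p X (v x)) x = X.
  by apply/matrixP => i j; rewrite mxE partial_paraboloid2.
apply; split; first by rewrite /paraboloid subrr dot0r qf0 mul0r !addr0.
apply/nbhs_enormP; exists s => // h /hs; rewrite /paraboloid => + _.
by rewrite (addrC x h) addrK.
Qed.

End Jets.

(** * A priori estimates for subsolutions *)

Lemma cont_cst (R : realType) (T : topologicalType) (a : R) :
  continuous (fun _ : T => a).
Proof. by move=> x; exact: cvg_cst. Qed.

Lemma cont_opp (R : realType) (T : topologicalType) (f : T -> R) :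
  continuous f -> continuous (fun x => - f x).
Proof. by move=> cf x; apply: (cvgN (cf x)). Qed.

Lemma cont_add (R : realType) (T : topologicalType) (f g : T -> R) :
  continuous f -> continuous g -> continuous (fun x => f x + g x).
Proof. by move=> cf cg x; apply: (cvgD (cf x) (cg x)). Qed.

Lemma cont_mul (R : realType) (T : topologicalType) (f g : T -> R) :
  continuous f -> continuous g -> continuous (fun x => f x * g x).
Proof. by move=> cf cg x; apply: (cvgM (cf x) (cg x)). Qed.

Section Estimates.
Variables (R : realType) (N : nat).
Implicit Types (x y z h k p e : 'rV[R]_N) (X : 'M[R]_N) (v : 'rV[R]_N -> R)
  (Om : set 'rV[R]_N).

Lemma addrK_sub x h : x + h - x = h.
Proof. by rewrite addrC addKr. Qed.

Lemma near_lt_add (T : topologicalType) (v c : T -> R) (x : T) :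
  (forall a, v x < a -> \forall y \near x, v y < a) -> {for x, continuous c} ->
  forall a, v x + c x < a -> \forall y \near x, v y + c y < a.
Proof.
move=> uv cc a va; pose d := (a - (v x + c x)) / 2.
have d0 : 0 < d by rewrite divr_gt0 // subr_gt0.
have vd : v x < v x + d by rewrite ltrDl.
have cd : c x < c x + d by rewrite ltrDl.
have n1 := uv _ vd; have /cvgr_lt/(_ _ cd) n2 := cc.
apply: filterS2 n1 n2 => y; rewrite /d; lra.
Qed.

Lemma usc_mulc v (c : 'rV[R]_N -> R) x : (forall y, 0 < c y) ->
  usc_at v x -> {for x, continuous c} -> usc_at (fun y => v y * c y) x.
Proof.
move=> c0 uv cc a va; have cx := c0 x.
have [t /andP[vt ta]] : exists t, v x < t < a / c x.
  by exists ((v x + a / c x) / 2); rewrite !midf_lt // ltr_pdivlMr.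
have ct : {for x, continuous (fun y => t * c y)} by apply: continuousM; [exact: cst_continuous|].
have tc : t * c x < a by rewrite -ltr_pdivlMr.
have n1 := uv _ vt; have /cvgr_lt/(_ _ tc) n2 := ct.
apply: filterS2 n1 n2 => y vy; apply: lt_trans.
by rewrite ltr_pM2r.
Qed.

Lemma max_on_ball v (c : 'rV[R]_N -> R) y s : 0 <= s ->
  (forall x, usc_at v x) -> continuous c ->
  exists2 x, enorm (x - y) <= s &
    forall z, enorm (z - y) <= s -> v z + c z <= v x + c x.
Proof.
move=> s0 uv cc; apply: (@usc_attains_max R _ [set x | enorm (x - y) <= s]
  (fun x => v x + c x)) => [||x _ a va].
- exact: compact_cball.
- by exists y; rewrite /= subrr enorm0.
- by have := near_lt_add (uv x) (cc x) va; apply: filterS => z + _.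
Qed.

Lemma enorm_sub_cvx x y h : enorm (x + h - y) <= enorm (x - y) + enorm h.
Proof. by rewrite addrAC enormD. Qed.

Lemma enorm_sqrD x h :
  enorm (x + h) ^+ 2 = enorm x ^+ 2 + 2 * dot x h + dot h h.
Proof. by rewrite !enorm_sqr !dotE (dotC h x); ring. Qed.

Lemma unit_vec x : x != 0 -> dot ((enorm x)^-1 *: x) ((enorm x)^-1 *: x) = 1.
Proof.
by move=> /enorm_gt0 x0; rewrite !dotE -enorm_sqr; field; rewrite gt_eqF.
Qed.

(** This follows from |z + h|^2 = (|z| + a)^2 + c^2, where a and c are the lengths
    of the radial and the tangential part of h. What matters is that the quadratic
    has no second-order term in the radial direction. *)
Lemma enorm_le_quadratic z h : z != 0 -> enorm h <= enorm z / 2 ->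
  enorm (z + h) <= enorm z + dot ((enorm z)^-1 *: z) h
    + (dot h h - dot ((enorm z)^-1 *: z) h ^+ 2) / enorm z.
Proof.
move=> z0 hz; have zp := enorm_gt0 z0; set e := _ *: z.
have ee : dot e e = 1 by exact: unit_vec.
have ze : z = enorm z *: e by rewrite /e scalerA divff ?gt_eqF // scale1r.
set a := dot e h.
have ah : `|a| <= enorm h.
  by rewrite (le_trans (cauchy_schwarz_abs _ _)) // (enorm_unit ee) mul1r.
have [a1 a2] : - (enorm z / 2) <= a /\ a <= enorm z / 2.
  by move: (le_trans ah hz); rewrite ler_norml => /andP[].
pose c2 := dot h h - a ^+ 2.
have c0 : 0 <= c2.
  rewrite subr_ge0 -enorm_sqr -(real_normK (num_real a)) ler_pXn2r ?nnegrE //.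
  exact: enorm_ge0.
rewrite -/c2; set q := c2 / enorm z.
have q0 : 0 <= q by rewrite divr_ge0 // ltW.
have cq : c2 = q * enorm z by rewrite /q mulfVK // gt_eqF.
rewrite ler_enorm; last by lra.
have za : dot z h = enorm z * a by rewrite {1}ze dotZl.
have -> : dot (z + h) (z + h) = (enorm z + a) ^+ 2 + c2.
  by rewrite !dotE (dotC h z) za -enorm_sqr /c2; ring.
rewrite cq; nra.
Qed.

(** Comparison with a concave cone: in the radial direction the second derivative
    of L (t - (b+1) t^2 / 2) is - L (b+1), which beats the gradient term b L. *)
Lemma cone_comparison Om v (b K L c s : R) x0 :
  0 <= b -> 0 <= L -> K < L -> 0 < s -> (b + 1) * s <= 1 ->
  (forall x, usc_at v x) -> open Om ->
  jet_sub Om (fun _ _ p => b * enorm p + K) v ->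
  let g := fun t : R => c + L * (t - (b + 1) / 2 * t ^+ 2) in
  (forall y, enorm (y - x0) <= s ->
     (Om y /\ 0 < enorm (y - x0) < s) \/ v y <= g (enorm (y - x0))) ->
  forall y, enorm (y - x0) <= s -> v y <= g (enorm (y - x0)).
Proof.
move=> b0 L0 KL s0 bs uv oO js g bd y ys.
have cg : continuous (fun y => - g (enorm (y - x0))).
  have cd := @continuous_dist R N x0; apply: cont_opp.
  apply: cont_add; first exact: cont_cst.
  apply: cont_mul; first exact: cont_cst.
  apply: cont_add => //; apply: cont_opp; apply: cont_mul; first exact: cont_cst.
  by apply: cont_mul.
have [x xs xmax] := max_on_ball x0 (ltW s0) uv cg.
rewrite -subr_le0; apply: (le_trans (xmax y ys)); rewrite subr_le0.
case: (bd x xs) => // -[Ox /andP[x1 x2]]; exfalso.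
set z := x - x0 in xs x1 x2.
have z0 : z != 0 by apply: contraTneq x1 => ->; rewrite enorm0 ltxx.
pose e := (enorm z)^-1 *: z.
have ee : dot e e = 1 by exact: unit_vec.
have ze h : dot z h = enorm z * dot e h.
  by rewrite /e dotZl mulrA divff ?mul1r // gt_eqF.
pose p := (L * (1 - (b + 1) * enorm z)) *: e.
pose X := r1mx (L * (2 / enorm z - (b + 1))) (- (2 * L / enorm z)) e.
have bz : (b + 1) * enorm z <= 1.
  by apply: le_trans bs; rewrite ler_wpM2l ?addr_ge0 // ltW.
have pn : enorm p <= L.
  rewrite /p enormZ (enorm_unit ee) mulr1 ger0_norm; last first.
    by rewrite mulr_ge0 // subr_ge0.
  by rewrite -[leRHS]mulr1 ler_wpM2l // gerBl mulr_ge0 ?addr_ge0 // enorm_ge0.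
have Xe : qf X e = - L * (b + 1) by rewrite qf_r1mx ee; field; rewrite gt_eqF.
have := js x p X e Ox (r1mx_sym _ _ _) _ ee; rewrite Xe => jx.
suff /jx : jet_above v x p X.
  have : b * enorm p <= b * L by rewrite ler_wpM2l.
  lra.
exists (Num.min (s - enorm z) (enorm z / 2)).
  by rewrite lt_min subr_gt0 x2 divr_gt0.
move=> h; rewrite lt_min => /andP[h1 h2].
have := xmax (x + h); have -> : x + h - x0 = z + h by rewrite addrAC.
have zh : enorm (z + h) <= s by apply: le_trans (enormD _ _) _; lra.
move=> /(_ zh) mx.
have := enorm_le_quadratic z0 (ltW h2); rewrite -/e => nq.
have q0 : 0 <= enorm (z + h) by exact: enorm_ge0.
have n2 : enorm (z + h) ^+ 2 = enorm z ^+ 2 + 2 * enorm z * dot e h + dot h h.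
  by rewrite enorm_sqrD ze; ring.
rewrite /X qf_r1mx /p dotZl.
move: mx; rewrite /g -/z n2.
have E : L * (enorm (z + h)) <= L * (enorm z + dot e h + (dot h h - dot e h ^+ 2) / enorm z).
  by rewrite ler_wpM2l.
set A := (_ / _) in E.
have -> : (L * (2 / enorm z - (b + 1)) * dot h h + - (2 * L / enorm z) * dot e h ^+ 2) / 2 =
  L * A - L * (b + 1) / 2 * dot h h by rewrite /A; field; rewrite gt_eqF.
lra.
Qed.

Lemma orthogonal_unit z : (2 <= N)%N -> exists2 e, dot e e = 1 & dot e z = 0.
Proof.
move=> N2; pose i := Ordinal (ltnW N2 : (0 < N)%N); pose j := Ordinal N2.
pose w := z ord0 j *: delta_mx ord0 i - z ord0 i *: delta_mx ord0 j : 'rV[R]_N.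
have wz : dot w z = 0 by rewrite /w !dotE ![dot (delta_mx _ _) _]dotC !dot_delta; ring.
have [w0|w0] := eqVneq w 0; last first.
  exists ((enorm w)^-1 *: w); first exact: unit_vec.
  by rewrite dotZl wz mulr0.
exists (delta_mx ord0 i); first by rewrite -enorm_sqr enorm_delta expr1n.
have : w ord0 j = 0 by rewrite w0 mxE.
rewrite !mxE !eqxx /= mulr0 add0r mulr1 => /eqP; rewrite oppr_eq0 => /eqP zi.
by rewrite dotC dot_delta.
Qed.

Lemma unit_exists : (0 < N)%N -> exists e : 'rV[R]_N, dot e e = 1.
Proof.
by move=> N0; exists (delta_mx ord0 (Ordinal N0)); rewrite -enorm_sqr enorm_delta expr1n.
Qed.

Lemma expR_quadratic (s : R) : `|s| <= 1 / 2 -> expR (- s) <= 1 - s + 2 * s ^+ 2.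
Proof.
rewrite ler_norml => /andP[s1 s2].
have := expR_ge1Dx s; have := expR_gt0 (- s).
have : expR s * expR (- s) = 1 by rewrite -expRD subrr expR0.
set E := expR s; set F := expR (- s) => EF F0 Es.
have : (1 + s) * F <= 1 by rewrite -[leRHS]EF ler_wpM2r // ltW.
have s3 : 0 < 1 + s by lra.
rewrite -(ler_pM2l s3); nra.
Qed.

(** The Gaussian exp(- k |x - y|^2) has Hessian - 2 k times itself in every
    direction orthogonal to x - y; there are such directions as N >= 2. For k
    large this beats both b |Dw| (as b r < 1) and the zero-order term. *)
Lemma gaussian_bound Om v (b r m M : R) y : (2 <= N)%N ->
  0 <= b -> 0 < r -> b * r < 1 -> 0 <= m -> 0 <= M -> open Om ->
  (forall x, Om x -> enorm (x - y) < r) ->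
  (forall x, usc_at v x) -> (forall x, ~ Om x -> v x <= 0) ->
  jet_sub Om (fun _ s p => b * enorm p + m * `|s| + M) v ->
  forall x, v x <= M * expR ((m + 2) / (2 * (1 - b * r)) * r ^+ 2).
Proof.
move=> N2 b0 r0 br m0 M0 oO Ob uv voff js.
have d0 : 0 < 1 - b * r by rewrite subr_gt0.
set k := (m + 2) / _.
have k0 : 0 < k by rewrite divr_gt0 ?mulr_gt0 // ltr_wpDl.
have kE : 2 * k * (1 - b * r) = m + 2 by rewrite /k; field; rewrite gt_eqF.
clearbody k; pose t x := dot (x - y) (x - y).
have tE x : t x = enorm (x - y) ^+ 2 by rewrite enorm_sqr.
pose c x := expR (k * t x).
have cc : continuous c.
  move=> x; apply: (@continuous_comp _ _ _ (fun z => k * t z) expR); last exact: continuous_expR.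
  apply: cont_mul; first exact: cont_cst.
  rewrite (_ : t = (fun z => enorm (z - y) * enorm (z - y))).
    by have cd := @continuous_dist R N y; apply: cont_mul.
  by apply: funext => z; rewrite tE expr2.
have [|||x0 x0r xmax] := @usc_attains_max R _ [set x | enorm (x - y) <= r]
   (fun x => v x * c x).
- exact: compact_cball.
- by exists y; rewrite /= subrr enorm0 ltW.
- move=> x _ a va.
  have := usc_mulc (fun y => expR_gt0 (k * t y)) (uv x) (cc x) va.
  by apply: filterS => z + _.
have C0 : 0 <= M * expR (k * r ^+ 2) by rewrite mulr_ge0 // expR_ge0.
have [Ox0|nO] := pselect (Om x0); last first.
  move=> x; apply: (le_trans _ C0).
  have [Ox|] := pselect (Om x); last exact: voff.
  have := xmax x (ltW (Ob x Ox)) => h.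
  have := voff _ nO => v0; rewrite -(pmulr_lle0 _ (expR_gt0 (k * t x))).
  by apply: (le_trans h); rewrite pmulr_lle0 // expR_gt0.
have vM : v x0 <= M.
  rewrite leNgt; apply/negP => Mv.
  have v0 : 0 < v x0 by exact: le_lt_trans Mv.
  set z := x0 - y in x0r.
  have [e ee ez] := orthogonal_unit z N2.
  pose p := (- (2 * k * v x0)) *: z.
  (* second-order expansion of the Gaussian: - 2 k is raised by 1 to absorb the
     fourth-order terms, and only the direction z feels the rank-one part *)
  pose X := r1mx (v x0 * (1 - 2 * k)) (v x0 * (32 * k ^+ 2)) z.
  have := js x0 p X e Ox0 (r1mx_sym _ _ _) _ ee.
  rewrite qf_r1mx ee (dotC z e) ez expr0n /= mulr0 addr0 mulr1 => jx.
  suff /jx : jet_above v x0 p X.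
    have -> : enorm p = 2 * k * v x0 * enorm z.
      have kv : 0 < 2 * k * v x0 by apply: mulr_gt0 => //; apply: mulr_gt0.
      by rewrite /p enormZ normrN gtr0_norm.
    rewrite (gtr0_norm v0).
    have : b * (2 * k * v x0 * enorm z) <= b * (2 * k * v x0 * r).
      by rewrite ler_wpM2l // ler_wpM2l // mulr_ge0 ?mulr_ge0 // ltW.
    have : (2 * k * (1 - b * r)) * v x0 = (m + 2) * v x0 by rewrite kE.
    lra.
  have /nbhs_enormP [s1 s10 h1] : nbhs x0 Om by exact: open_nbhs_nbhs.
  have D0 : 0 < 8 * k * (r + 1) by rewrite !mulr_gt0 // addr_gt0.
  exists (Num.min s1 (Num.min 1 (1 / (8 * k * (r + 1))))).
    by rewrite !lt_min s10 ltr01 divr_gt0.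
  move=> h; rewrite !lt_min => /and3P[hs1 hs2 hs3].
  have hn := enorm_ge0 h; have zn := enorm_ge0 z.
  move: hs3; rewrite ltr_pdivlMr // => hs3.
  have zh := cauchy_schwarz_abs z h.
  have hh : dot h h = enorm h ^+ 2 by rewrite enorm_sqr.
  have := xmax (x0 + h) (ltW (Ob _ (h1 _ hs1))).
  pose s := k * (2 * dot z h + dot h h).
  have tE2 : t (x0 + h) = t x0 + (2 * dot z h + dot h h).
    rewrite /t -/z (_ : x0 + h - y = z + h); last by rewrite addrAC.
    by rewrite -enorm_sqr enorm_sqrD enorm_sqr addrA.
  rewrite /c tE2 mulrDr expRD -/s mulrA mulrAC ler_pM2r ?expR_gt0 // => vh.
  have {}vh : v (x0 + h) <= v x0 * expR (- s).
    by rewrite -ler_pdivrMr ?expR_gt0 // expRN invrK.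
  have zh2 : `|dot z h| <= r * enorm h.
    by apply: (le_trans zh); rewrite ler_wpM2r.
  have sb : `|s| <= 1 / 2.
    rewrite /s normrM (gtr0_norm k0).
    have := ler_normD (2 * dot z h) (dot h h).
    rewrite normrM (ger0_norm (ler0n _ 2)) (ger0_norm (dotxx_ge0 h)) hh => nd.
    have : k * `|2 * dot z h + enorm h ^+ 2| <= k * (2 * (r * enorm h) + enorm h).
      rewrite ler_pM2l //; apply: (le_trans nd); rewrite lerD ?ler_wpM2l //.
      by rewrite expr2 ler_piMl // ltW.
    have : 0 <= k * r * enorm h by rewrite !mulr_ge0 // ltW.
    have : 0 <= k * enorm h by rewrite !mulr_ge0 // ltW.
    lra.
  have := expR_quadratic sb => Es.
  have {}vh : v (x0 + h) <= v x0 * (1 - s + 2 * s ^+ 2).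
    by apply: (le_trans vh); rewrite ler_wpM2l // ltW.
  apply: (le_trans vh); rewrite qf_r1mx /p dotZl.
  have s2 : 2 * s ^+ 2 <= 16 * k ^+ 2 * dot z h ^+ 2 + dot h h / 2.
    have k2 : 8 * k ^+ 2 * dot h h <= 1.
      have ekh : k * enorm h <= 1 / 8.
        have : 0 <= k * enorm h * r by rewrite !mulr_ge0 // ltW.
        lra.
      have : 0 <= k * enorm h by rewrite !mulr_ge0 // ltW.
      rewrite hh; nra.
    have dh : 0 <= dot h h by exact: dotxx_ge0.
    have : 8 * k ^+ 2 * dot h h * dot h h <= 1 * dot h h by rewrite ler_wpM2r.
    have : 0 <= k ^+ 2 * (2 * dot z h - dot h h) ^+ 2 by rewrite mulr_ge0 ?sqr_ge0.
    rewrite /s; lra.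
  have : v x0 * (2 * s ^+ 2) <= v x0 * (16 * k ^+ 2 * dot z h ^+ 2 + dot h h / 2).
    by rewrite ler_wpM2l // ltW.
  rewrite /s; lra.
move=> x; have [Ox|/voff vx] := pselect (Om x); last exact: le_trans C0.
have h := xmax x (ltW (Ob x Ox)).
have c1 : 1 <= c x by rewrite /c -expR0 ler_expR mulr_ge0 ?dotxx_ge0 // ltW.
have [vx|vx] := leP (v x) 0; first exact: le_trans C0.
apply: (@le_trans _ _ (v x * c x)); first by rewrite ler_peMr // ltW.
apply: (le_trans h); apply: (@le_trans _ _ (M * c x0)).
  by rewrite ler_wpM2r // expR_ge0.
have tr : t x0 <= r ^+ 2.
  by rewrite tE; apply: lerXn2r; rewrite ?nnegrE ?enorm_ge0 // ltW.
by apply: ler_wpM2l => //; rewrite ler_expR; apply: ler_wpM2l tr; exact: ltW.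
Qed.

(** Minus half the power of x with respect to the sphere of centre y, radius r. *)
Definition pot (r : R) y x : R := (r ^+ 2 - dot (x - y) (x - y)) / 2.

Lemma pot_expand r y x h :
  pot r y (x + h) = pot r y x - dot (x - y) h - dot h h / 2.
Proof.
rewrite /pot (_ : x + h - y = (x - y) + h); last by rewrite addrAC.
by rewrite !dotE (dotC h x) (dotC h y); field.
Qed.

Lemma potE r y x : pot r y x = (r - enorm (x - y)) * (r + enorm (x - y)) / 2.
Proof. by rewrite /pot -enorm_sqr; ring. Qed.

Lemma continuous_pot r y : continuous (pot r y).
Proof.
move=> x; rewrite (_ : pot r y = paraboloid y 0 (r1mx (- 1) 0 0) (r ^+ 2 / 2)).
  by apply: continuous_paraboloid; exact: r1mx_sym.
by apply: funext => z; rewrite /paraboloid /pot dot0l qf_r1mx mul0r !addr0; field.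
Qed.

(** The paraboloid is concave, with Hessian - C in all directions and gradient at
    most C r, so that b r < 1 makes it a strict supersolution. *)
Lemma paraboloid_bound Om v (b r K C : R) y : (0 < N)%N ->
  0 <= b -> 0 < r -> 0 <= C -> K < C * (1 - b * r) -> open Om ->
  (forall x, Om x -> enorm (x - y) < r) ->
  (forall x, usc_at v x) -> (forall x, ~ Om x -> v x <= 0) ->
  jet_sub Om (fun _ _ p => b * enorm p + K) v ->
  forall x, Om x -> v x <= C * pot r y x.
Proof.
move=> N0 b0 r0 C0 CK oO Ob uv voff js.
have cc : continuous (fun x => - (C * pot r y x)).
  apply: cont_opp; apply: cont_mul; first exact: cont_cst.
  exact: continuous_pot.
have [x0 x0r xmax] := max_on_ball y (ltW r0) uv cc.
suff m0 : v x0 - C * pot r y x0 <= 0.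
  move=> x Ox; rewrite -subr_le0; apply: le_trans m0.
  exact: xmax (ltW (Ob x Ox)).
have [Ox0|nO] := pselect (Om x0); last first.
  rewrite subr_le0 (le_trans (voff _ nO)) // mulr_ge0 // potE.
  by rewrite divr_ge0 // mulr_ge0 // ?subr_ge0 // addr_ge0 ?enorm_ge0 // ltW.
exfalso; have [e ee] := unit_exists N0.
have := js x0 (- C *: (x0 - y)) (r1mx (- C) 0 0) e Ox0 (r1mx_sym _ _ _) _ ee.
rewrite qf_r1mx ee mul0r addr0 mulr1 enormZ normrN ger0_norm // => jx.
suff /jx : jet_above v x0 (- C *: (x0 - y)) (r1mx (- C) 0 0).
  have : b * (C * enorm (x0 - y)) <= b * (C * r).
    by rewrite ler_wpM2l // ler_wpM2l.
  lra.
have /nbhs_enormP [s1 s10 h1] : nbhs x0 Om by exact: open_nbhs_nbhs.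
exists s1 => // h /h1 Oh; have := xmax (x0 + h) (ltW (Ob _ Oh)).
by rewrite pot_expand qf_r1mx dotZl; lra.
Qed.

(** A cone with vertex on the graph over any point x0 lies above v off Om, by the
    linear bound near the boundary, and at distance 1 / (b + 1) from x0, as v is
    bounded; hence it lies above v in between. *)
Lemma subsolution_lipschitz Om v (b K C0 D : R) :
  0 <= b -> 0 <= K -> 0 <= C0 -> 0 <= D -> open Om ->
  (forall x, usc_at v x) -> (forall x, ~ Om x -> v x = 0) ->
  (forall x, `|v x| <= C0) ->
  (forall x z, Om x -> ~ Om z -> `|v x| <= D * enorm (x - z)) ->
  jet_sub Om (fun _ _ p => b * enorm p + K) v ->
  forall x y, `|v x - v y| <=
    (4 * C0 * (b + 1) + 2 * D + K + 1) * enorm (x - y).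
Proof.
move=> b0 K0 C00 D0 oO uv voff vb vD js.
set L := _ + 1.
have b1 : 0 < b + 1 by rewrite ltr_wpDl.
have Cb : 0 <= C0 * (b + 1) by rewrite mulr_ge0 // ltW.
have L0 : 0 < L by rewrite /L; lra.
have KL : K < L by rewrite /L; lra.
suff H x0 y : v y - v x0 <= L * enorm (y - x0).
  by move=> x y; rewrite ler_norml H andbT; have := H x y; rewrite enormB; lra.
pose s := (b + 1)^-1.
have s0 : 0 < s by rewrite invr_gt0.
have bs : (b + 1) * s = 1 by rewrite divff // gt_eqF.
have half t : 0 <= t -> t <= s -> t / 2 <= t - (b + 1) / 2 * t ^+ 2 <= t.
  move=> t0 ts; have bt : (b + 1) * t <= 1 by rewrite -[leRHS]bs ler_wpM2l // ltW.
  have : (b + 1) * t * t <= 1 * t by rewrite ler_wpM2r.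
  have : 0 <= (b + 1) * t * t by rewrite !mulr_ge0 // ltW.
  by move=> q1 q2; apply/andP; split; lra.
have [vy1 vy2] : - C0 <= v y /\ v y <= C0 by have := vb y; rewrite ler_norml => /andP[].
have [vx1 vx2] : - C0 <= v x0 /\ v x0 <= C0 by have := vb x0; rewrite ler_norml => /andP[].
have [ys|ys] := leP (enorm (y - x0)) s; last first.
  have : L * s <= L * enorm (y - x0) by rewrite ler_wpM2l // ltW.
  have : 4 * C0 <= L * s.
    rewrite -[leLHS]mulr1 -[X in _ * X <= _]bs mulrA ler_wpM2r ?ltW // /L; lra.
  lra.
case: (half _ (enorm_ge0 (y - x0)) ys) => /andP[_ /(ler_wpM2l (ltW L0))].
have [Ox0|nO] := pselect (Om x0); last first.
  move=> _; rewrite (voff _ nO) subr0.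
  have [Oy|nOy] := pselect (Om y); last first.
    by rewrite (voff _ nOy) mulr_ge0 ?enorm_ge0 // ltW.
  apply: (le_trans (ler_norm _)); apply: (le_trans (vD y x0 Oy nO)).
  by rewrite ler_wpM2r ?enorm_ge0 // /L; lra.
have := @cone_comparison Om v b K L (v x0) s x0 b0 (ltW L0) KL s0 _ uv oO js _ y ys.
rewrite bs => /(_ (lexx 1)) cc gy.
rewrite lerBlDl; apply: le_trans (cc _) _; last by rewrite lerD2l.
move=> z zs; have /andP[z1 z2] := half _ (enorm_ge0 (z - x0)) zs.
have [->|zx] := eqVneq z x0.
  by right; rewrite subrr enorm0 expr0n /= mulr0 subr0 mulr0 addr0.
have zp : 0 < enorm (z - x0) by rewrite enorm_gt0 // subr_eq0.
have zL := ler_wpM2l (ltW L0) z1.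
have [zlt|zge] := ltP (enorm (z - x0)) s; last first.
  have zE : enorm (z - x0) = s by apply/eqP; rewrite eq_le zs zge.
  right; rewrite zE in zL *.
  have [] : v z <= C0 by apply: le_trans (ler_norm _) (vb z).
  have : 4 * C0 <= L * s.
    by rewrite -[leLHS]mulr1 -[X in _ * X <= _]bs mulrA ler_wpM2r ?ltW // /L; lra.
  lra.
have [Oz|nOz] := pselect (Om z); first by left; rewrite zp.
right; rewrite (voff _ nOz).
have := vD x0 z Ox0 nOz; rewrite enormB ler_norml => /andP[vz _].
have : 2 * D * enorm (z - x0) <= L * enorm (z - x0).
  by rewrite ler_wpM2r ?enorm_ge0 // /L; lra.
lra.
Qed.

End Estimates.

(** * Perron's method *)

Section Perron.
Variables (R : realType) (N : nat) (Om Y : set 'rV[R]_N) (r b m M D : R).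
Variables (G : 'rV[R]_N -> R -> 'rV[R]_N -> R) (W : 'rV[R]_N -> R).
Implicit Types (x y z h k p e : 'rV[R]_N) (X : 'M[R]_N) (v : 'rV[R]_N -> R).

Hypotheses (N2 : (2 <= N)%N) (r0 : 0 < r) (b0 : 0 <= b) (br : b * r < 1)
  (m0 : 0 <= m) (M0 : 0 <= M) (D0 : 0 <= D) (oO : open Om) (Y0 : Y !=set0)
  (OmE : forall x, Om x <-> forall y, Y y -> enorm (x - y) < r).
Hypothesis G_le : forall x s p, Om x -> G x s p <= b * enorm p + m * `|s| + M.
Hypothesis G_cont : forall x s p, Om x -> forall eps, 0 < eps ->
  exists2 d, 0 < d & forall h t k, enorm h < d -> `|t| < d -> enorm k < d ->
    `|G (x + h) (s + t) (p + k) - G x s p| < eps.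

(** Being zero off Om and upper semicontinuous everywhere encodes the boundary
    condition from above; W gives it from below. *)
Definition perron_class v : Prop :=
  [/\ forall x, usc_at v x, forall x, ~ Om x -> v x = 0,
      forall x, W x <= v x & jet_sub Om G v].

Hypothesis W_mem : perron_class W.
Hypothesis W_ge : forall x z, Om x -> ~ Om z -> - (D * enorm (x - z)) <= W x.

Lemma pot_le_dist x z : Om x -> ~ Om z ->
  exists2 y, Y y & pot r y x <= r * enorm (x - z).
Proof.
move=> Ox nOz.
have [y Yy yz] : exists2 y, Y y & r <= enorm (z - y).
  apply: contrapT => /forall2NP h; apply: nOz; apply/OmE => y Yy.
  by case: (h y) => // /negP; rewrite -ltNge.
exists y => //; rewrite potE.
have xr := (OmE x).1 Ox y Yy; have := enorm_triangle x z y; rewrite (enormB z x).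
have := enorm_ge0 (x - y); set a := enorm (x - y) in xr *.
set c := enorm (x - z) => a0 tri.
have : (r - a) * (r + a) <= (r - a) * (2 * r) by rewrite ler_wpM2l; lra.
have : (r - a) * r <= c * r by rewrite ler_wpM2r //; lra.
lra.
Qed.

Lemma near_complement x : Om x -> exists2 z, ~ Om z & enorm (x - z) <= 2 * r.
Proof.
move=> Ox; have [y Yy] := Y0; have [e ee] := @unit_exists R N (ltnW N2).
exists (y + r *: e).
  by move=> /OmE /(_ y Yy); rewrite addrK_sub enormZ (enorm_unit ee) mulr1 gtr0_norm // ltxx.
rewrite opprD addrA; apply: (le_trans (enormD _ _)).
rewrite enormN enormZ (enorm_unit ee) mulr1 gtr0_norm // mulr_natl mulr2n lerD2r.
by rewrite ltW // (OmE x).1.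
Qed.

(** In turn: a bound from above, linear decay at the boundary, a Lipschitz bound.
    Each step turns lower-order terms into constants for the next one. As no
    constant depends on v, the supremum of the class is Lipschitz as well. *)
Lemma perron_lipschitz : exists2 L, 0 <= L &
  forall v, perron_class v -> forall x y, `|v x - v y| <= L * enorm (x - y).
Proof.
have [y0 Yy0] := Y0; have d0 : 0 < 1 - b * r by rewrite subr_gt0.
have Ob y x : Y y -> Om x -> enorm (x - y) < r by move=> Yy /OmE; apply.
pose C1 := M * expR ((m + 2) / (2 * (1 - b * r)) * r ^+ 2).
have C10 : 0 <= C1 by rewrite mulr_ge0 // expR_ge0.
pose C0 := C1 + 2 * r * D.
have C00 : 0 <= C0 by rewrite addr_ge0 // !mulr_ge0 // ltW.
pose K := m * C0 + M.
have K0 : 0 <= K by rewrite addr_ge0 // mulr_ge0.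
have KE : K = m * C0 + M by [].
clearbody K.
pose C := (K + 1) / (1 - b * r).
have CE : C * (1 - b * r) = K + 1 by rewrite /C mulfVK // gt_eqF.
have C_0 : 0 <= C by apply: divr_ge0; [lra|exact: ltW].
clearbody C.
pose D' := C * r + D.
have D'0 : 0 <= D' by rewrite addr_ge0 // mulr_ge0 // ltW.
exists (4 * C0 * (b + 1) + 2 * D' + K + 1).
  by rewrite !addr_ge0 // !mulr_ge0 // addr_ge0.
move=> v [uv voff vW js].
have voff' x : ~ Om x -> v x <= 0 by move=> /voff ->.
have vC1 x : v x <= C1.
  apply: (gaussian_bound N2 b0 r0 br m0 M0 oO (Ob _ ^~ Yy0) uv voff').
  move=> x' p X e Ox sX jv ee; apply: (le_trans (js x' p X e Ox sX jv ee)).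
  by rewrite lerD2l G_le.
have vlow x z : Om x -> ~ Om z -> - (D * enorm (x - z)) <= v x.
  by move=> Ox nOz; rewrite (le_trans (W_ge Ox nOz)).
have vC0 x : `|v x| <= C0.
  have [Ox|/voff ->] := pselect (Om x); last by rewrite normr0.
  rewrite ler_norml; apply/andP; split; last first.
    by apply: (le_trans (vC1 x)); rewrite lerDl !mulr_ge0 // ltW.
  have [z nOz xz] := near_complement Ox.
  have := vlow x z Ox nOz; have : D * enorm (x - z) <= D * (2 * r) by rewrite ler_wpM2l.
  rewrite /C0; lra.
have js' : jet_sub Om (fun _ _ p => b * enorm p + K) v.
  move=> x p X e Ox sX jv ee; apply: (le_trans (js x p X e Ox sX jv ee)).
  rewrite lerD2l (le_trans (G_le _ _ Ox)) // -addrA lerD2l KE lerD2r.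
  by rewrite ler_wpM2l.
have vD x z : Om x -> ~ Om z -> `|v x| <= D' * enorm (x - z).
  move=> Ox nOz; have [y Yy py] := pot_le_dist Ox nOz.
  have up : v x <= C * pot r y x.
    apply: (paraboloid_bound (ltnW N2) b0 r0 C_0 _ oO (Ob _ ^~ Yy) uv voff' js' Ox).
    by rewrite CE; lra.
  have : C * pot r y x <= C * (r * enorm (x - z)) by rewrite ler_wpM2l.
  have := vlow x z Ox nOz; have xz := enorm_ge0 (x - z).
  have : 0 <= C * r * enorm (x - z) by rewrite !mulr_ge0 // ltW.
  have : 0 <= D * enorm (x - z) by rewrite mulr_ge0.
  by rewrite /D' ler_norml => *; apply/andP; split; lra.
exact: (subsolution_lipschitz b0 K0 C00 D'0 oO uv voff vC0 vD js').
Qed.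

Definition perron_sup x : R := sup [set v x | v in perron_class].

Let u := perron_sup.

Lemma perron_has_sup x : has_sup [set v x | v in perron_class].
Proof.
have [L L0 hL] := perron_lipschitz.
split; first by exists (W x), W.
have [Ox|nO] := pselect (Om x).
  have [z nOz xz] := near_complement Ox.
  exists (L * enorm (x - z)) => _ [v vF <-].
  have [_ voff _ _] := vF; have := hL v vF x z.
  by rewrite (voff z nOz) subr0; apply: le_trans; exact: ler_norm.
by exists 0 => _ [v [_ voff _ _] <-]; rewrite voff.
Qed.

Lemma le_perron_sup v x : perron_class v -> v x <= u x.
Proof.
by move=> vF; apply: sup_upper_bound; [exact: perron_has_sup|exists v].
Qed.

Lemma perron_sup_approx x d : 0 < d -> exists2 v, perron_class v & u x - d < v x.
Proof.
move=> d0; have [_ [v vF <-] hv] := sup_adherent d0 (perron_has_sup x).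
by exists v.
Qed.

Lemma perron_sup_lipschitz L :
  (forall v, perron_class v -> forall x y, `|v x - v y| <= L * enorm (x - y)) ->
  forall x y, `|u x - u y| <= L * enorm (x - y).
Proof.
move=> hL.
have H x y : u x <= u y + L * enorm (x - y).
  apply: ge_sup; first by case: (perron_has_sup x).
  move=> _ [v vF <-]; have := hL v vF x y; have := le_perron_sup y vF.
  rewrite ler_norml => ? /andP[_]; lra.
by move=> x y; rewrite ler_norml; have := H x y; have := H y x;
  rewrite (enormB y x) => *; apply/andP; split; lra.
Qed.

Lemma perron_sup_off x : ~ Om x -> u x = 0.
Proof.
move=> nO; apply/eqP; rewrite eq_le; apply/andP; split; last first.
  by have [_ Woff _ _] := W_mem; rewrite -(Woff x nO) le_perron_sup.
apply: ge_sup; first by case: (perron_has_sup x).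
by move=> _ [v [_ voff _ _] <-]; rewrite voff.
Qed.

Lemma perron_sup_usc x : usc_at u x.
Proof.
have [L L0 hL] := perron_lipschitz.
apply/usc_atP => a ua; have L1 : 0 < L + 1 by rewrite ltr_wpDl.
exists ((a - u x) / (L + 1)); first by rewrite divr_gt0 // subr_gt0.
move=> h; rewrite ltr_pdivlMr // => hh.
have := perron_sup_lipschitz hL (x + h) x; rewrite addrK_sub ler_norml => /andP[_].
have := enorm_ge0 h; lra.
Qed.

(** If the supremum is touched from above at x, its near-optimal competitors are
    touched, by almost the same paraboloid, at points close to x. *)
Lemma perron_sup_sub : jet_sub Om G u.
Proof.
move=> x p X e Ox sX [s1 s10 jet] ee; rewrite leNgt; apply/negP => neg.
have [L L0 hL] := perron_lipschitz.
pose eta := - (qf X e + G x (u x) p) / 3.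
have eta0 : 0 < eta by rewrite divr_gt0 // oppr_gt0.
have etaE : qf X e + G x (u x) p = - (3 * eta) by rewrite /eta; field.
clearbody eta; have [s s0 Gs] := G_cont (u x) p Ox eta0.
pose X' := X + eta%:M.
have sX' : X'^T = X' by rewrite /X' raddfD /= tr_scalar_mx sX.
have [C C0 hC] := qf_bound X'.
have /nbhs_enormP [s2 s20 h2] : nbhs x Om by exact: open_nbhs_nbhs.
have CL : 0 < 2 * (C + L + 1) by rewrite mulr_gt0 // ltr_wpDl // addr_ge0.
(* the contact point is within tau of x, provided v x is within d of u x *)
pose tau := Num.min (Num.min s1 s2) (s / (2 * (C + L + 1))) / 2.
have min0 : 0 < Num.min (Num.min s1 s2) (s / (2 * (C + L + 1))).
  by rewrite !lt_min s10 s20 divr_gt0.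
have tau0 : 0 < tau by rewrite divr_gt0.
have : tau < Num.min (Num.min s1 s2) (s / (2 * (C + L + 1))) by rewrite /tau; lra.
rewrite !lt_min ltr_pdivlMr // => /andP[/andP[t1 t2] t3].
clearbody tau.
pose d := Num.min (s / 4) (eta / 2 * tau ^+ 2).
have d0 : 0 < d by rewrite lt_min divr_gt0 //= mulr_gt0 ?exprn_gt0 // divr_gt0.
have dm1 : d <= s / 4 by rewrite ge_min lexx.
have dm2 : d <= eta / 2 * tau ^+ 2 by rewrite ge_min lexx orbT.
clearbody d; have [v vF vd] := perron_sup_approx x d0.
have [uv _ _ vsub] := vF.
have cq : continuous (fun y => - paraboloid x p X' (u x) y).
  by apply: cont_opp; exact: continuous_paraboloid.
have [x1 x1t x1max] := max_on_ball x (ltW tau0) uv cq.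
pose h := x1 - x; have x1E : x1 = x + h by rewrite /h addrC subrK.
have qx : paraboloid x p X' (u x) x = u x.
  by rewrite /paraboloid subrr dot0r qf0 mul0r !addr0.
have qh k : paraboloid x p X' (u x) (x + k) = u x + dot p k + qf X k / 2 + eta / 2 * dot k k.
  by rewrite paraboloid_expand // qx subrr mul0mx addr0 /X' qf_add qf_scalar; ring.
have low : - d < v x1 - paraboloid x p X' (u x) x1.
  apply: lt_le_trans (x1max x _); last by rewrite subrr enorm0 ltW.
  by rewrite qx; lra.
have hs1 : enorm h < s1 by exact: le_lt_trans t1.
have ht : enorm h < tau.
  have := jet h hs1; have := le_perron_sup x1 vF.
  move: low; rewrite x1E qh -/h => low vu uj.
  have : eta / 2 * dot h h < eta / 2 * tau ^+ 2 by lra.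
  rewrite ltr_pM2l ?divr_gt0 // -enorm_sqr ltr_pXn2r ?nnegrE ?enorm_ge0 //.
  exact: ltW.
have Ox1 : Om x1 by rewrite x1E; apply: h2; exact: lt_trans t2.
have := vsub x1 (p + h *m X') X' e Ox1 sX' _ ee; rewrite /X' qf_add qf_scalar ee mulr1.
rewrite -/X' => jx; suff /jx : jet_above v x1 (p + h *m X') X'.
  have tv : `|v x1 - u x| < s.
    have := hL v vF x1 x; have := le_perron_sup x vF; rewrite -/h.
    have : L * enorm h <= L * tau by rewrite ler_wpM2l // ltW.
    have : 0 <= C * tau by rewrite mulr_ge0 // ltW.
    rewrite !ltr_norml ler_norml => i1 i2 i3 /andP[i4 i5]; apply/andP; split; lra.
  have tk : enorm (h *m X') < s.
    have hX : enorm (h *m X') <= C * enorm h.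
      have [->|hX0] := eqVneq (h *m X') 0; first by rewrite enorm0 mulr_ge0 ?enorm_ge0.
      have := hC h (h *m X'); rewrite -enorm_sqr normrX ger0_norm ?enorm_ge0 // expr2.
      by rewrite ler_pM2r // enorm_gt0.
    apply: (le_lt_trans hX).
    have : C * enorm h <= C * tau by rewrite ler_wpM2l // ltW.
    have : 0 <= L * tau by rewrite mulr_ge0 // ltW.
    lra.
  have th : enorm h < s.
    have : 0 <= L * tau by rewrite mulr_ge0 // ltW.
    have : 0 <= C * tau by rewrite mulr_ge0 // ltW.
    lra.
  have := Gs h (v x1 - u x) (h *m X') th tv tk.
  rewrite -x1E [u x + _]addrC subrK ltr_norml => /andP[_]; lra.
exists (tau - enorm h); first by rewrite subr_gt0.
move=> k hk; have := x1max (x1 + k).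
have -> : x1 + k - x = h + k by rewrite addrAC.
have hkt : enorm (h + k) <= tau by apply: (le_trans (enormD _ _)); lra.
move=> /(_ hkt); rewrite paraboloid_expand // -/h; lra.
Qed.

(** Where the supremum fails to be a supersolution, a small bump of the touching
    paraboloid glued onto it would be a larger competitor. *)
Lemma perron_sup_super : jet_super Om G u.
Proof.
move=> x p X eta Ox sX [s1 s10 jet] eta0.
apply: contrapT => /forall2NP nex.
have pos e : dot e e = 1 -> eta <= qf X e + G x (u x) p.
  by move=> ee; case: (nex e) => // /negP; rewrite -leNgt.
have eta20 : 0 < eta / 2 by rewrite divr_gt0.
have [s s0 Gs] := G_cont (u x) p Ox eta20.
pose X' := X - (eta / 2)%:M.
have sX' : X'^T = X' by rewrite /X' raddfB /= tr_scalar_mx sX.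
have [C C0 hC] := qf_bound X'.
have /nbhs_enormP [s2 s20 h2] : nbhs x Om by exact: open_nbhs_nbhs.
have CL : 0 < 2 * (enorm p + C + 1) by rewrite mulr_gt0 // ltr_wpDl // addr_ge0 ?enorm_ge0.
(* in the ball of radius sg the bump is a strict subsolution; lifted by d only, it
   stays below u outside the ball of radius sg / 2 *)
pose sg := Num.min (Num.min s1 s2) (Num.min 1 (s / (2 * (enorm p + C + 1)))).
have sg0 : 0 < sg by rewrite !lt_min s10 s20 ltr01 divr_gt0.
have : sg <= sg by [].
rewrite {2}/sg !le_min ler_pdivlMr // => /andP[/andP[t1 t2] /andP[t3 t4]].
clearbody sg; pose d := Num.min (s / 4) (eta / 4 * (sg / 2) ^+ 2).
have d0 : 0 < d by rewrite lt_min divr_gt0 //= mulr_gt0 ?exprn_gt0 // divr_gt0.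
have dm1 : d <= s / 4 by rewrite ge_min lexx.
have dm2 : d <= eta / 4 * (sg / 2) ^+ 2 by rewrite ge_min lexx orbT.
clearbody d; pose q := paraboloid x p X' (u x + d).
have qh h : q (x + h) = u x + d + dot p h + qf X h / 2 - eta / 4 * dot h h.
  rewrite /q paraboloid_expand // /paraboloid subrr mul0mx dot0r qf0 mul0r !addr0.
  by rewrite /X' qf_sub_scalar; field.
have qu y : sg / 2 <= enorm (y - x) -> enorm (y - x) < sg -> q y <= u y.
  move=> y1 y2; have yE : y = x + (y - x) by rewrite addrC subrK.
  have := jet (y - x) (lt_le_trans y2 t1); rewrite -yE.
  have : eta / 4 * (sg / 2) ^+ 2 <= eta / 4 * dot (y - x) (y - x).
    by rewrite ler_pM2l ?divr_gt0 // -enorm_sqr ler_pXn2r ?nnegrE ?enorm_ge0 // ltW // divr_gt0.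
  have := qh (y - x); rewrite -yE => ->; lra.
pose v y := if enorm (y - x) < sg then Num.max (u y) (q y) else u y.
have uv y : u y <= v y by rewrite /v; case: ifP => // _; rewrite le_max lexx.
have vlt y a : v y < a <-> u y < a /\ (enorm (y - x) < sg -> q y < a).
  rewrite /v; case: ifP => yx; last by split=> [|[]].
  by rewrite gt_max; split=> [/andP[]|[-> /(_ isT)]].
have vF : perron_class v.
  split.
  - move=> y a /vlt [ua qa].
    have n1 := perron_sup_usc ua.
    have [yx|yx] := ltP (enorm (y - x)) sg.
      have cq : {for y, continuous q} by exact: continuous_paraboloid.
      have /cvgr_lt/(_ _ (qa yx)) n2 := cq.
      by apply: filterS2 n1 n2 => z uz qz; apply/vlt.
    have cd : {for y, continuous (fun z => enorm (z - x))} by exact: continuous_dist.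
    have sy : sg / 2 < enorm (y - x) by lra.
    have /cvgr_gt/(_ _ sy) n2 := cd.
    apply: filterS2 n1 n2 => z uz zx; apply/vlt; split=> // zs.
    by apply: le_lt_trans uz; apply: qu => //; exact: ltW.
  - move=> y nO; rewrite /v ifF ?perron_sup_off //; apply/negP => ys.
    apply: nO; rewrite (_ : y = x + (y - x)); last by rewrite addrC subrK.
    by apply: h2; exact: lt_le_trans t2.
  - by move=> y; apply: le_trans (uv y); exact: le_perron_sup.
  - move=> y p1 X1 e Oy sX1 [s3 s30 j3] ee.
    have [vu|vu] := eqVneq (v y) (u y).
      rewrite vu; apply: perron_sup_sub => //; exists s3 => // h hs.
      by apply: (le_trans (uv _)); rewrite -vu j3.
    have [yx|yx] := ltP (enorm (y - x)) sg; last first.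
      by move: vu; rewrite /v ifF ?eqxx // ltNge yx.
    have vq : v y = q y.
      by move: vu; rewrite /v yx /Num.max; case: ifP => //; rewrite eqxx.
    have [p1E X1E] : p + (y - x) *m X' = p1 /\ forall e, qf X' e <= qf X1 e.
      apply: (@jet_compare _ _ _ _ _ _ (Num.min s3 (sg - enorm (y - x)))).
        by rewrite lt_min s30 subr_gt0.
      move=> h; rewrite lt_min => /andP[h3 h4].
      have := j3 h h3; rewrite vq.
      have : q (y + h) <= v (y + h).
        rewrite /v ifT ?le_max ?lexx ?orbT // (le_lt_trans (enorm_sub_cvx _ _ _)) //.
        lra.
      rewrite {1}/q paraboloid_expand // -/q; lra.
    set h := y - x in yx p1E; have yE : y = x + h by rewrite /h addrC subrK.
    have hh := enorm_ge0 h; have pp := enorm_ge0 p.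
    have hX : enorm (h *m X') <= C * enorm h.
      have [->|hX0] := eqVneq (h *m X') 0; first by rewrite enorm0 mulr_ge0.
      have := hC h (h *m X'); rewrite -enorm_sqr normrX ger0_norm ?enorm_ge0 // expr2.
      by rewrite ler_pM2r // enorm_gt0.
    have Ch : C * enorm h <= C * sg by rewrite ler_wpM2l // ltW.
    have ph : enorm p * enorm h <= enorm p * sg by rewrite ler_wpM2l // ltW.
    have Cs : 0 <= C * sg by rewrite mulr_ge0 // ltW.
    have ps : 0 <= enorm p * sg by rewrite mulr_ge0 // ltW.
    have th : enorm h < s by lra.
    have tk : enorm (h *m X') < s by lra.
    have tv : `|q y - u x| < s.
      rewrite (_ : q y - u x = d + (dot p h + qf X' h / 2)); last first.
        by rewrite yE qh /X' qf_sub_scalar; field.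
      apply: (le_lt_trans (ler_normD _ _)); rewrite gtr0_norm //.
      have := ler_normD (dot p h) (qf X' h / 2).
      rewrite [`|_ / 2|]normrM (ger0_norm (_ : 0 <= 2^-1)) ?invr_ge0 //.
      have := cauchy_schwarz_abs p h; have := hC h h; rewrite -/(qf X' h).
      have : C * enorm h * enorm h <= C * enorm h * 1.
        by rewrite ler_wpM2l ?mulr_ge0 // ltW // (lt_le_trans yx).
      set w := `|_ + _|; set w1 := `|qf _ _|; set w2 := `|dot _ _|; lra.
    have := Gs h (q y - u x) (h *m X') th tv tk.
    rewrite p1E -yE [u x + _]addrC subrK vq ltr_norml => /andP[+ _].
    have := X1E e; have := pos e ee; rewrite {1}/X' qf_sub_scalar ee; lra.
have := le_perron_sup x vF; rewrite leNgt => /negP; apply.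
rewrite /v subrr enorm0 sg0 lt_max; apply/orP; right.
by have := qh 0; rewrite addr0 dot0r qf0 dot0r => ->; lra.
Qed.

Lemma perron_existence : exists w : 'rV[R]_N -> R,
  [/\ exists L, forall x y, `|w x - w y| <= L * enorm (x - y),
      forall x, ~ Om x -> w x = 0, jet_sub Om G w & jet_super Om G w].
Proof.
have [L _ hL] := perron_lipschitz.
exists u; split; first by exists L; exact: perron_sup_lipschitz.
- exact: perron_sup_off.
- exact: perron_sup_sub.
- exact: perron_sup_super.
Qed.

End Perron.

(** * Convex domains cut out by balls *)

Section ConvexDomain.
Variables (R : realType) (N : nat) (Om Y : set 'rV[R]_N) (r : R).
Implicit Types (x y z h k p e : 'rV[R]_N) (X : 'M[R]_N) (v : 'rV[R]_N -> R).

Hypotheses (r0 : 0 < r) (oO : open Om)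
  (cY : compact Y) (Y0 : Y !=set0)
  (OmE : forall x, Om x <-> forall y, Y y -> enorm (x - y) < r).

(** A concave stand-in for the distance to the boundary; its negative is a maximum
    of paraboloids. *)
Definition rho x : R := inf [set pot r y x | y in Y].

Lemma rho_attained x :
  exists2 y, Y y & rho x = pot r y x /\ forall y', Y y' -> rho x <= pot r y' x.
Proof.
have potC y : pot r y x = pot r x y.
  by rewrite /pot -!enorm_sqr enormB.
have [y _ a ha|y Yy ymax] := @usc_attains_max R _ Y (fun y => - pot r y x) cY Y0.
  have cp : continuous (fun y => - pot r y x).
    apply: cont_opp; rewrite (_ : (fun y => _) = pot r x); first exact: continuous_pot.
    by apply: funext.
  have /cvgr_lt/(_ _ ha) := cp y.
  by apply: filterS => z + _.
have ylb : lbound [set pot r y x | y in Y] (pot r y x).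
  by move=> _ [z Yz <-]; rewrite -lerN2 ymax.
have E : rho x = pot r y x.
  apply/eqP; rewrite eq_le; apply/andP; split.
    by apply: ge_inf; [exists (pot r y x)|exists y].
  by apply: lb_le_inf => //; exists (pot r y x), y.
by exists y => //; split=> // z Yz; rewrite E -lerN2 ymax.
Qed.

Lemma rho_gt0 x : Om x -> 0 < rho x.
Proof.
move=> Ox; have [y Yy [-> _]] := rho_attained x.
have := (OmE x).1 Ox y Yy; rewrite potE => xy.
by rewrite divr_gt0 // mulr_gt0 ?subr_gt0 // ltr_pwDl ?enorm_ge0.
Qed.

Lemma rho_le_dist x z : Om x -> ~ Om z -> rho x <= r * enorm (x - z).
Proof.
move=> Ox nOz; have [y Yy py] := pot_le_dist OmE Ox nOz.
by have [_ _ [_ h]] := rho_attained x; apply: le_trans (h y Yy) py.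
Qed.

Lemma rho_margin x y : Om x -> Y y -> enorm (x - y) <= r - rho x / r.
Proof.
move=> Ox Yy; have [_ _ [_ /(_ y Yy)]] := rho_attained x.
have := (OmE x).1 Ox y Yy; rewrite potE; have := enorm_ge0 (x - y).
set a := enorm _ => a0 ar h; rewrite lerBrDr -lerBrDl ler_pdivrMr //.
apply: (le_trans h).
have : (r - a) * (r + a) <= (r - a) * (2 * r) by rewrite ler_wpM2l; lra.
lra.
Qed.

Lemma usc_opp_rho (C : R) x : 0 <= C -> Om x -> usc_at (fun z => - (C * rho z)) x.
Proof.
move=> C0 Ox; apply/usc_atP => a ha.
have d0 : 0 < a + C * rho x by lra.
have Cr : 0 < C * (r + 1) + 1 by rewrite ltr_wpDl // mulr_ge0 // addr_ge0 // ltW.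
exists (Num.min 1 ((a + C * rho x) / (C * (r + 1) + 1))).
  by rewrite lt_min ltr01 divr_gt0.
move=> h; rewrite lt_min ltr_pdivlMr // => /andP[h1 h2].
have [y Yy [-> _]] := rho_attained (x + h).
have [_ _ [_ /(_ y Yy) px]] := rho_attained x.
have xy := (OmE x).1 Ox y Yy.
have h0 := enorm_ge0 h.
have low : rho x - (r + 1) * enorm h <= pot r y (x + h).
  rewrite pot_expand -enorm_sqr.
  have := cauchy_schwarz (x - y) h.
  have : enorm (x - y) * enorm h <= r * enorm h by rewrite ler_wpM2r // ltW.
  have : enorm h ^+ 2 <= enorm h by rewrite expr2 ler_piMl // ltW.
  lra.
have : C * (rho x - (r + 1) * enorm h) <= C * pot r y (x + h) by rewrite ler_wpM2l.
lra.
Qed.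

(** At x the barrier - C rho, a maximum of paraboloids, equals one of them, and
    that one touches v from below. *)
Lemma barrier_jet v (C : R) x p X : 0 <= C -> Om x ->
  (forall z, Om z -> - (C * rho z) <= v z) -> v x = - (C * rho x) ->
  jet_above v x p X ->
  enorm p <= C * r /\ forall e, dot e e = 1 -> C <= qf X e.
Proof.
move=> C0 Ox vge vx [s s0 hs].
have [y Yy [ry _]] := rho_attained x.
have /nbhs_enormP [s1 s10 h1] : nbhs x Om by exact: open_nbhs_nbhs.
have [||pE XE] := @jet_compare R N (C *: (x - y)) p (r1mx C 0 0) X (Num.min s s1).
- by rewrite lt_min s0.
- move=> h; rewrite lt_min => /andP[hh hh1].
  have Oh := h1 _ hh1; have := hs h hh; have := vge _ Oh.
  have [_ _ [_ /(_ y Yy)]] := rho_attained (x + h).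
  rewrite vx ry pot_expand qf_r1mx dotZl mul0r addr0 => i1 i2 i3.
  have : C * rho (x + h) <= C * (pot r y x - dot (x - y) h - dot h h / 2).
    by rewrite ler_wpM2l.
  lra.
split; last by move=> e ee; have := XE e; rewrite qf_r1mx ee; lra.
by rewrite -pE enormZ ger0_norm // ler_wpM2l // ltW // (OmE x).1.
Qed.

(** For d > 0 these compact sets exhaust Om; for d = 0 the set is a compact convex
    one containing Om, used in place of the closure. *)
Definition shrunk (d : R) : set 'rV[R]_N :=
  [set x | forall y, Y y -> enorm (x - y) <= r - d].

Lemma shrunk_sub d : 0 < d -> shrunk d `<=` Om.
Proof. by move=> d0 x hx; apply/OmE => y /hx /le_lt_trans; apply; rewrite gtrBl. Qed.

Lemma compact_shrunk d : compact (shrunk d).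
Proof.
have [y0 Yy0] := Y0.
apply: (@subclosed_compact _ (shrunk d) [set x | enorm (x - y0) <= r - d]).
- rewrite (_ : shrunk d = \bigcap_(y in Y) [set x | enorm (x - y) <= r - d]).
    by apply: closed_bigI => y _; exact: closed_cball.
  by apply/seteqP; split=> x hx y Yy; exact: hx.
- exact: compact_cball.
- by move=> x; apply.
Qed.

Lemma shrunk_cvx (z x : 'rV[R]_N) (a s d : R) : 0 <= s -> s <= 1 ->
  shrunk a z -> shrunk d x -> shrunk ((1 - s) * a + s * d) (z + s *: (x - z)).
Proof.
move=> s0 s1 hz hx y Yy.
rewrite (_ : z + s *: (x - z) - y = (1 - s) *: (z - y) + s *: (x - y)); last first.
  by rewrite !scalerBr !scalerBl !scale1r; apply/rowP => i; rewrite !mxE; ring.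
apply: (le_trans (enormD _ _)); rewrite !enormZ !ger0_norm ?subr_ge0 //.
have := ler_wpM2l s0 (hx y Yy).
have s1' : 0 <= 1 - s by rewrite subr_ge0.
have := ler_wpM2l s1' (hz y Yy); lra.
Qed.

Lemma shrunk_add x h d : shrunk d x -> shrunk (d - enorm h) (x + h).
Proof.
move=> hx y Yy; apply: (le_trans (enorm_sub_cvx _ _ _)).
by have := hx y Yy; lra.
Qed.

Lemma Om_shrunk0 x : Om x -> shrunk 0 x.
Proof. by move=> /OmE h y /h; rewrite subr0 => /ltW. Qed.

Lemma interior_shrunk z : Om z -> exists2 a, 0 < a & shrunk a z.
Proof.
move=> /OmE Oz.
have [y _ a ha|y Yy ymax] := @usc_attains_max R _ Y (fun y => enorm (z - y)) cY Y0.
  have cp : {for y, continuous (fun y => enorm (z - y))}.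
    rewrite (_ : (fun y => _) = (fun y => enorm (y - z))); first exact: continuous_dist.
    by apply: funext => t; rewrite enormB.
  by have /cvgr_lt/(_ _ ha) := cp; apply: filterS => t + _.
exists (r - enorm (z - y)); first by rewrite subr_gt0 Oz.
by move=> y' /ymax; rewrite subKr.
Qed.

Lemma shrunk_diam x z d : Om z -> 0 <= d -> shrunk d x -> enorm (x - z) <= 2 * r.
Proof.
move=> /OmE Oz d0 hx; have [y Yy] := Y0.
have := enorm_triangle y x z; have := hx y Yy; have := Oz y Yy.
by rewrite (enormB y z); lra.
Qed.

(** * Hopf's lemma for negative subsolutions *)

Variables (b : R) (w : 'rV[R]_N -> R).
Hypotheses (b0 : 0 <= b) (uw : forall x, usc_at w x)
  (woff : forall x, ~ Om x -> w x = 0) (wneg : forall x, Om x -> w x < 0)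
  (wsub : jet_sub Om (fun _ _ p => b * enorm p) w).

Lemma w_le0 x : w x <= 0.
Proof. by have [/wneg/ltW|/woff ->] := pselect (Om x). Qed.

(** Harnack-type bound, from the cone with vertex at the lower point. *)
Lemma negative_sub_loc_bounded x0 : Om x0 -> \forall x \near x0, 2 * w x0 <= w x.
Proof.
move=> Ox0; have /nbhs_enormP [s1 s10 h1] : nbhs x0 Om by exact: open_nbhs_nbhs.
have b1 : 0 < b + 1 by rewrite ltr_wpDl.
pose s := Num.min (s1 / 3) (b + 1)^-1.
have s0 : 0 < s by rewrite lt_min invr_gt0 b1 divr_gt0.
have ss1 : s <= s1 / 3 by rewrite ge_min lexx.
have bs : (b + 1) * s <= 1.
  by rewrite -ler_pdivlMl // mulr1 ge_min lexx orbT.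
clearbody s; apply/nbhs_enormP; exists (s / 4); first by rewrite divr_gt0.
move=> h hs; set x := x0 + h.
have h0 := enorm_ge0 h.
have Ox : Om x by apply: h1; lra.
have wx := wneg Ox.
pose gs := s - (b + 1) / 2 * s ^+ 2.
have gs2 : s / 2 <= gs.
  have : (b + 1) * s * s <= 1 * s by rewrite ler_wpM2r // ltW.
  rewrite /gs; lra.
have gs0 : 0 < gs by apply: lt_le_trans gs2; rewrite divr_gt0.
pose L := - w x / gs.
have L0 : 0 < L by rewrite divr_gt0 // oppr_gt0.
have LE : L * gs = - w x by rewrite /L mulfVK // gt_eqF.
have js : jet_sub Om (fun _ _ p => b * enorm p + 0) w.
  by move=> y p X e Oy sX jy ee; rewrite addr0; exact: (wsub Oy sX jy ee).
have := @cone_comparison R N Om w b 0 L (w x) s x b0 (ltW L0) L0 s0 bs uw oO js _ x0.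
have xx : enorm (x0 - x) = enorm h by rewrite enormB /x addrK_sub.
rewrite xx => cc.
have {cc}: w x0 <= w x + L * (enorm h - (b + 1) / 2 * enorm h ^+ 2).
  apply: cc; last by lra.
  move=> y ys; have [->|yx] := eqVneq y x.
    by right; rewrite subrr enorm0 expr0n /= mulr0 subr0 mulr0 addr0.
  have yp : 0 < enorm (y - x) by rewrite enorm_gt0 // subr_eq0.
  have [ylt|yge] := ltP (enorm (y - x)) s; last first.
    have -> : enorm (y - x) = s by apply/eqP; rewrite eq_le ys yge.
    by right; rewrite -/gs LE subrr w_le0.
  left; rewrite yp; split=> //.
  rewrite (_ : y = x0 + (y - x0)); last by rewrite addrC subrK.
  apply: h1; apply: (le_lt_trans (enorm_triangle x y x0)).
  by rewrite /x addrK_sub -/x; lra.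
have : L * (enorm h - (b + 1) / 2 * enorm h ^+ 2) <= L * (gs / 2).
  rewrite ler_pM2l //; apply: (@le_trans _ _ (s / 4)); last by lra.
  have : 0 <= (b + 1) / 2 * enorm h ^+ 2 by rewrite mulr_ge0 ?sqr_ge0 ?divr_ge0 // ltW.
  lra.
lra.
Qed.

Lemma negative_sub_bounds d : 0 < d -> exists m, 0 < m /\
  forall x, shrunk d x -> w x <= - m /\ - w x <= m^-1.
Proof.
move=> d0.
have loc x : shrunk d x -> exists n : nat, \forall z \near x, shrunk d z ->
    w z <= - n.+1%:R^-1 /\ - w z <= n.+1%:R.
  move=> /(shrunk_sub d0) Ox; have wx := wneg Ox.
  have [n1 hn1] := ltr_add_invr wx; rewrite addrC -ltrBrDl sub0r in hn1.
  pose n2 := Num.truncn (- (2 * w x)).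
  have hn2 : - (2 * w x) < n2.+1%:R by exact: truncnS_gt.
  exists (maxn n1 n2).
  have f1 := uw hn1; have f2 := negative_sub_loc_bounded Ox.
  apply: filterS2 f1 f2 => z z1 z2 _; split.
    apply: (le_trans (ltW z1)); rewrite lerN2 lef_pV2 ?posrE ?ltr0n //.
    by rewrite ler_nat ltnS leq_maxl.
  apply: (@le_trans _ _ n2.+1%:R); last by rewrite ler_nat ltnS leq_maxr.
  by apply: ltW; apply: le_lt_trans hn2; rewrite lerN2.
have [|n hn] := compact_uniform (compact_shrunk (d := d)) _ loc.
  move=> i j z ij [z1 z2]; split.
    by apply: (le_trans z1); rewrite lerN2 lef_pV2 ?posrE ?ltr0n // ler_nat.
  by apply: (le_trans z2); rewrite ler_nat.
exists n.+1%:R^-1; split; first by rewrite invr_gt0 ltr0n.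
by move=> x /hn; rewrite invrK.
Qed.

(** A convex decreasing function of s in [0, 1] that vanishes at 1 with slope - A;
    K measures its curvature relative to that slope. *)
Definition hopf_profile (A K s : R) : R := A * ((1 - s) + K * (1 - s) ^+ 2).

Lemma one_sided_quadratic_ge0 (al be : R) :
  (forall t, 0 < t -> t <= 1 -> 0 <= t * al + t ^+ 2 * be) -> 0 <= al.
Proof.
move=> ht; rewrite leNgt; apply/negP => al0.
have b1 : 0 < 1 + `|be| by rewrite ltr_pwDl.
pose t := Num.min 1 (- al / 2 / (1 + `|be|)).
have t0 : 0 < t by rewrite lt_min ltr01 !divr_gt0 // oppr_gt0.
have t1 : t <= 1 by rewrite ge_min lexx.
have tb : t * (1 + `|be|) <= - al / 2 by rewrite -ler_pdivlMr // ge_min lexx orbT.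
clearbody t.
have : 0 <= al + t * be.
  by have := ht t t0 t1; rewrite expr2 -mulrA -mulrDr pmulr_rge0.
have : t * be <= t * `|be| by rewrite ler_pM2l // ler_norm.
lra.
Qed.

Lemma hopf_profile_le (A K sg s : R) : 0 < A -> 0 < K -> K * sg <= 1 / 2 ->
  1 - sg <= s -> s <= 1 -> hopf_profile A K s <= 3 / 2 * A * (1 - s).
Proof.
move=> A0 K0 Ksg s1 s2; have u0 : 0 <= 1 - s by rewrite subr_ge0.
have Ku : K * (1 - s) <= K * sg by rewrite ler_pM2l //; lra.
have Kuu : K * (1 - s) * (1 - s) <= 1 / 2 * (1 - s).
  by rewrite ler_wpM2r // (le_trans Ku).
rewrite /hopf_profile [3 / 2 * A]mulrC -mulrA ler_pM2l //; lra.
Qed.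

Lemma shifted_parameter (sg s t : R) :
  `|t| < Num.min (s - (1 - sg)) (1 - s) -> 1 - sg <= s + t /\ s + t <= 1.
Proof.
rewrite lt_min !ltr_norml => /andP[/andP[t1 t2] /andP[t3 t4]].
by split; lra.
Qed.

Definition penalized_profile (A K eps : R) z (q : 'rV[R]_N * 'rV[R]_N * R) : R :=
  hopf_profile A K q.2 - enorm (q.1.1 - (z + q.2 *: (q.1.2 - z))) ^+ 2 / (2 * eps).

Lemma continuous_penalized_profile (A K eps : R) z :
  continuous (penalized_profile A K eps z).
Proof.
have c2 : continuous (fun q : 'rV[R]_N * 'rV[R]_N * R => q.2) by move=> q; exact: cvg_snd.
have c11 : continuous (fun q : 'rV[R]_N * 'rV[R]_N * R => q.1.1).
  by move=> q; apply: (@cvg_comp _ _ _ fst fst _ _ _ cvg_fst); exact: cvg_fst.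
have c12 : continuous (fun q : 'rV[R]_N * 'rV[R]_N * R => q.1.2).
  by move=> q; apply: (@cvg_comp _ _ _ fst snd _ _ _ cvg_fst); exact: cvg_snd.
have c1s : continuous (fun q : 'rV[R]_N * 'rV[R]_N * R => 1 - q.2).
  by apply: cont_add; [exact: cont_cst|exact: cont_opp].
have cn : continuous (fun q : 'rV[R]_N * 'rV[R]_N * R =>
    enorm (q.1.1 - (z + q.2 *: (q.1.2 - z)))).
  move=> q; apply: (@continuous_comp _ _ _
    (fun q : 'rV[R]_N * 'rV[R]_N * R => q.1.1 - (z + q.2 *: (q.1.2 - z))) (@enorm R N)).
    apply: (cvgB (c11 q)); apply: (cvgD (cvg_cst _)).
    by apply: (cvgZ (c2 q)); apply: (cvgB (c12 q)); exact: cvg_cst.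
  exact: continuous_enorm.
apply: cont_add.
  apply: cont_mul; first exact: cont_cst.
  apply: cont_add => //; apply: cont_mul; first exact: cont_cst.
  exact: (cont_mul c1s c1s).
apply: cont_opp; apply: cont_mul; last exact: cont_cst.
exact: (cont_mul cn cn).
Qed.

Lemma hopf_slope (A a K nl nq : R) : 0 < A -> 0 < a ->
  K = 4 * b * r ^+ 2 / a + 1 -> 0 < nl -> nl <= 2 * r -> a * nq <= 2 * A ->
  b * nq < 2 * A * K / nl ^+ 2.
Proof.
move=> A0 a0 KE l0 lr aq.
apply: (@le_lt_trans _ _ (2 * b * A / a)).
  by rewrite ler_pdivlMr //; have := ler_wpM2l b0 aq; lra.
have bA : 0 <= 2 * b * A / a.
  by rewrite divr_ge0 // ?(ltW a0) // mulr_ge0 ?(ltW A0) // mulr_ge0.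
have l2 : nl ^+ 2 <= 4 * r ^+ 2.
  have : nl ^+ 2 <= (2 * r) ^+ 2 by apply: lerXn2r; rewrite ?nnegrE ?mulr_ge0 // ltW.
  lra.
rewrite ltr_pdivlMr ?exprn_gt0 //; have := ler_wpM2l bA l2.
have -> : 2 * b * A / a * (4 * r ^+ 2) = 2 * A * (K - 1).
  by rewrite KE; field; rewrite gt_eqF.
lra.
Qed.

(** At an interior maximum the penalty gradient q is at once the gradient of a test
    function for w at y1 and an outward normal direction at xi1. The latter bounds
    |q| by the slope of the profile, as xi ranges over a set containing a ball
    about z; the former has second derivative - 2 A K / |xi1 - z|^2 along the ray
    from z, which K makes too negative for the subsolution w. *)
Lemma hopf_interior (z y1 xi1 : 'rV[R]_N) (a A K sg eps s1 : R) :
  0 < a -> shrunk a z -> 0 < A -> K = 4 * b * r ^+ 2 / a + 1 -> 0 < K ->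
  sg <= 1 / 2 -> K * sg <= 1 / 2 -> 0 < eps ->
  Om y1 -> shrunk 0 xi1 -> 1 - sg < s1 -> s1 < 1 ->
  (forall y xi s, shrunk 0 y -> shrunk 0 xi -> 1 - sg <= s -> s <= 1 ->
     w y + penalized_profile A K eps z (y, xi, s) <=
     w y1 + penalized_profile A K eps z (y1, xi1, s1)) -> False.
Proof.
move=> a0 sz A0 KE K0 sg1 Ksg eps0 Oy1 hxi1 s1gt s1lt1 qmax.
have s10 : 0 < s1 by lra.
set T := z + s1 *: (xi1 - z).
have hy1 : shrunk 0 y1 by exact: Om_shrunk0.
pose q := eps^-1 *: (y1 - T).
have yT : y1 - T = eps *: q by rewrite /q scalerA divff ?gt_eqF // scale1r.
clearbody q; pose gam := A * (1 + 2 * K * (1 - s1)).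
have gamE t : hopf_profile A K (s1 + t) = hopf_profile A K s1 - gam * t + A * K * t ^+ 2.
  by rewrite /hopf_profile /gam; ring.
have gamA : A <= gam.
  have Ks : 0 <= K * (1 - s1) by apply: mulr_ge0; [exact: ltW|rewrite subr_ge0 ltW].
  by have := mulr_ge0 (ltW A0) Ks; rewrite /gam; lra.
have gam2 : gam <= 2 * A.
  have : K * (1 - s1) <= K * sg by rewrite ler_pM2l //; lra.
  move=> i1; have : A * (2 * (K * (1 - s1))) <= A * 1 by rewrite ler_pM2l //; lra.
  rewrite /gam; lra.
have gam0 : 0 < gam by apply: lt_le_trans gamA.
clearbody gam.
set c := penalized_profile A K eps z in qmax.
have cE y' xi' s' k : y' - (z + s' *: (xi' - z)) = eps *: q + k ->
    c (y', xi', s') = hopf_profile A K s' -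
      (eps ^+ 2 * dot q q + 2 * eps * dot q k + dot k k) / (2 * eps).
  move=> E; rewrite /c /penalized_profile /= E enorm_sqrD enorm_sqr.
  by rewrite !(dotZl, dotZr); congr (_ - _ / _); ring.
have c1 : c (y1, xi1, s1) = hopf_profile A K s1 - eps ^+ 2 * dot q q / (2 * eps).
  by rewrite (cE _ _ _ 0) ?addr0 -?yT // !dot0r mulr0 !addr0.
clearbody c.
set l := xi1 - z.
have gq : gam = dot q l.
  have [|t ht|] := @local_quadratic_ge0 R (gam - dot q l) (dot l l / (2 * eps) - A * K)
      (Num.min (s1 - (1 - sg)) (1 - s1)).
  - by rewrite lt_min !subr_gt0 s1gt.
  - have [r1 r2] := shifted_parameter ht.
    have := qmax y1 xi1 (s1 + t) hy1 hxi1 r1 r2.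
    rewrite c1 (cE _ _ _ (- t *: l)); last first.
      by rewrite -yT /T -/l; apply/rowP => i; rewrite !mxE; ring.
    rewrite gamE !(dotZl, dotZr) -subr_ge0.
    by apply: eq_ind; congr (_ <= _); field; rewrite gt_eqF.
  by move=> /eqP; rewrite subr_eq0 => /eqP.
have nrm xi' : shrunk 0 xi' -> dot q (xi' - xi1) <= 0.
  move=> hxi'; rewrite -oppr_ge0 -(pmulr_rge0 _ s10).
  apply: (@one_sided_quadratic_ge0 _ (s1 ^+ 2 * dot (xi' - xi1) (xi' - xi1) / (2 * eps))).
  move=> t t0 t1.
  have ht : shrunk 0 (xi1 + t *: (xi' - xi1)).
    by have := shrunk_cvx (ltW t0) t1 hxi1 hxi'; rewrite !mulr0 addr0.
  have := qmax y1 _ s1 hy1 ht (ltW s1gt) (ltW s1lt1).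
  rewrite c1 (cE _ _ _ (- (s1 * t) *: (xi' - xi1))); last first.
    by rewrite -yT /T; apply/rowP => i; rewrite !mxE; ring.
  rewrite -subr_ge0 !(dotZl, dotZr).
  by apply: eq_ind; congr (_ <= _); field; rewrite gt_eqF.
have q0 : q != 0.
  by apply: contraTneq gam0 => qz; rewrite gq qz dot0l ltxx.
have qn := enorm_gt0 q0.
have aq : a * enorm q <= gam.
  have E : enorm ((a / enorm q) *: q) = a.
    have aq0 : 0 <= a / enorm q by apply: divr_ge0; exact: ltW.
    by rewrite enormZ (ger0_norm aq0) mulfVK // gt_eqF.
  have := shrunk_add ((a / enorm q) *: q) sz; rewrite E subrr => hz.
  have := nrm _ hz; rewrite gq /l !dotE -enorm_sqr.
  have -> : a / enorm q * enorm q ^+ 2 = a * enorm q by field; rewrite gt_eqF.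
  lra.
have l0 : l != 0 by apply: contraTneq gam0 => lz; rewrite gq lz dot0r ltxx.
have ln := enorm_gt0 l0.
pose e := (enorm l)^-1 *: l.
have ee : dot e e = 1 by exact: unit_vec.
have lE : l = enorm l *: e by rewrite /e scalerA divff ?gt_eqF // scale1r.
clearbody e.
pose X := r1mx (eps^-1) (- eps^-1 - 2 * A * K / enorm l ^+ 2) e.
have jx : jet_above w y1 q X -> 0 <= qf X e + b * enorm q.
  by move=> jX; exact: (wsub Oy1 (r1mx_sym _ _ _) jX ee).
rewrite /X qf_r1mx ee -/X in jx.
suff /jx : jet_above w y1 q X.
  have l2 : enorm l <= 2 * r.
    apply: (shrunk_diam _ (lexx 0) hxi1); exact: shrunk_sub sz.
  have aq2 := le_trans aq gam2.
  have := hopf_slope A0 a0 KE ln l2 aq2; lra.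
have /nbhs_enormP [d d0 hd] : nbhs y1 Om by exact: open_nbhs_nbhs.
exists (Num.min d (Num.min (s1 - (1 - sg)) (1 - s1) * enorm l)).
  by rewrite lt_min d0 mulr_gt0 // lt_min !subr_gt0 s1gt.
move=> h; rewrite lt_min => /andP[h1 h2].
have Oh := Om_shrunk0 (hd _ h1).
pose t := dot e h / enorm l.
have [r1 r2] : 1 - sg <= s1 + t /\ s1 + t <= 1.
  apply: shifted_parameter.
  rewrite /t normrM (gtr0_norm (_ : 0 < (enorm l)^-1)) ?invr_gt0 // ltr_pdivrMr //.
  apply: le_lt_trans h2; apply: (le_trans (cauchy_schwarz_abs _ _)).
  by rewrite (enorm_unit ee) mul1r.
have := qmax (y1 + h) xi1 (s1 + t) Oh hxi1 r1 r2.
rewrite c1 (cE _ _ _ (h - t *: l)); last first.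
  by rewrite -yT /T -/l; apply/rowP => i; rewrite !mxE; ring.
have eq1 : dot q l * t = dot q (t *: l) by rewrite dotZr mulrC.
have tl : t *: l = dot e h *: e by rewrite {1}lE scalerA /t mulfVK // gt_eqF.
have -> : dot q (h - t *: l) = dot q h - gam * t by rewrite dotDr dotNr -eq1 gq.
have -> : dot (h - t *: l) (h - t *: l) = dot h h - dot e h ^+ 2.
  by rewrite tl !dotE ee (dotC h e); ring.
rewrite gamE.
have -> : qf X h / 2 = (dot h h - dot e h ^+ 2) / (2 * eps) - A * K * t ^+ 2.
  by rewrite /X qf_r1mx /t; field; rewrite !gt_eqF.
rewrite -subr_ge0 => H; rewrite -subr_ge0; move: H.
by apply: eq_ind; congr (_ <= _); field; rewrite gt_eqF.
Qed.

(** The doubling step: a penalty compares w at y with a profile of the parameter s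
    at z + s (xi - z). The error on the right is what a point y on the boundary,
    at distance at least (1 - s) a from z + s (xi - z), can contribute. *)
Lemma hopf_doubling (z : 'rV[R]_N) (a A K sg eps : R) :
  0 < a -> shrunk a z -> 0 < A -> K = 4 * b * r ^+ 2 / a + 1 ->
  0 < sg -> sg <= 1 / 2 -> K * sg <= 1 / 2 ->
  (forall x, shrunk (sg * a / 2) x -> w x <= - A) ->
  0 < eps -> 2 * eps * A <= (sg * a / 2) ^+ 2 ->
  forall y xi s, shrunk 0 y -> shrunk 0 xi -> 1 - sg <= s <= 1 ->
  w y + penalized_profile A K eps z (y, xi, s) <= A ^+ 2 * (2 * eps) / a ^+ 2.
Proof.
move=> a0 sz A0 KE sg0 sg1 Ksg wA eps0 epsA y xi s hy hxi hs.
have K1 : 1 <= K.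
  have p0 : 0 <= 4 * b * r ^+ 2 by rewrite mulr_ge0 ?sqr_ge0 // mulr_ge0.
  by rewrite KE lerDr; apply: divr_ge0 => //; exact: ltW.
have K0 : 0 < K by apply: lt_le_trans K1.
set B := _ / a ^+ 2.
have B0 : 0 <= B by rewrite divr_ge0 ?sqr_ge0 // mulr_ge0 ?sqr_ge0 // mulr_ge0 // ltW.
set c := penalized_profile A K eps z.
have cc : continuous c by exact: continuous_penalized_profile.
pose S : set ('rV[R]_N * 'rV[R]_N * R) :=
  (shrunk 0 `*` shrunk 0) `*` [set t | 1 - sg <= t <= 1].
have cS : compact S.
  apply: compact_setX; first by apply: compact_setX; exact: compact_shrunk.
  rewrite (_ : [set t | _] = `[1 - sg, 1]%classic); first exact: segment_compact.
  by apply/seteqP; split=> t /=; rewrite in_itv.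
have [|q _ t qt|[[y1 xi1] s1] [[/= hy1 hxi1] /andP[s1l s1u]] qmax] :=
    @usc_attains_max R _ S (fun q => w q.1.1 + c q) cS.
- by exists (y, xi, s).
- have c11 : {for q, continuous (fun q : 'rV[R]_N * 'rV[R]_N * R => q.1.1)}.
    by apply: (@cvg_comp _ _ _ fst fst _ _ _ cvg_fst); exact: cvg_fst.
  have uq a' : w q.1.1 < a' -> \forall q' \near q, w q'.1.1 < a'.
    by move=> wa; exact: (c11 _ (uw wa)).
  by have := near_lt_add uq (cc q) qt; apply: filterS => q' + _.
apply: (le_trans (qmax (y, xi, s) _)); first by split.
rewrite leNgt; apply/negP => big.
have {}qmax y' xi' s' : shrunk 0 y' -> shrunk 0 xi' -> 1 - sg <= s' -> s' <= 1 ->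
    w y' + c (y', xi', s') <= w y1 + c (y1, xi1, s1).
  move=> h1 h2 h3 h4; apply: (qmax (y', xi', s')).
  by split=> //=; rewrite h3 h4.
set T := z + s1 *: (xi1 - z).
set n := enorm (y1 - T).
have n0 : 0 <= n by exact: enorm_ge0.
have big' : B < w y1 + hopf_profile A K s1 - n ^+ 2 / (2 * eps) by rewrite -addrA.
have s10 : 0 < s1 by lra.
have p_le := hopf_profile_le A0 K0 Ksg s1l s1u.
have TA : shrunk ((1 - s1) * a) T.
  have := shrunk_cvx (ltW s10) s1u sz hxi1.
  by rewrite mulr0 addr0.
have e2 : 0 < 2 * eps by rewrite mulr_gt0.
have Oy1 : Om y1.
  apply: contrapT => nO.
  have wy := woff nO.
  have nT : (1 - s1) * a <= n.
    rewrite leNgt; apply/negP => nlt; apply: nO.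
    apply: (@shrunk_sub ((1 - s1) * a - n)); first by rewrite subr_gt0.
    rewrite (_ : y1 = T + (y1 - T)); last by rewrite addrC subrK.
    exact: shrunk_add.
  have n2 : ((1 - s1) * a) ^+ 2 <= n ^+ 2.
    by rewrite ler_pXn2r ?nnegrE // mulr_ge0 ?subr_ge0 // ltW.
  move: big'; rewrite wy add0r; apply/negP; rewrite -leNgt.
  set u := 1 - s1 in p_le nT n2.
  apply: (@le_trans _ _ (3 / 2 * A * u - (u * a) ^+ 2 / (2 * eps))).
    by rewrite lerB // ler_pM2r ?invr_gt0.
  rewrite -subr_ge0.
  (* complete the square in u *)
  have -> : B - (3 / 2 * A * u - (u * a) ^+ 2 / (2 * eps)) =
     ((u * a ^+ 2 - 3 / 4 * A * (2 * eps)) ^+ 2 + 7 / 16 * (A * (2 * eps)) ^+ 2)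
       / (2 * eps * a ^+ 2).
    by rewrite /B; field; rewrite !gt_eqF.
  by rewrite divr_ge0 ?addr_ge0 ?sqr_ge0 ?mulr_ge0 ?sqr_ge0 // ltW.
have wy1 := wneg Oy1.
have nn0 : 0 <= n ^+ 2 / (2 * eps) by rewrite divr_ge0 ?sqr_ge0 // ltW.
have s1lt1 : s1 < 1.
  rewrite lt_neqAle s1u andbT; apply/eqP => s1E.
  by move: big'; rewrite /hopf_profile s1E subrr expr0n /= mulr0 addr0 mulr0; lra.
have s1gt : 1 - sg < s1.
  rewrite lt_neqAle s1l andbT; apply/eqP => s1E.
  have pA : hopf_profile A K s1 <= A.
    apply: (le_trans p_le); rewrite -s1E subKr.
    have : A * sg <= A * (1 / 2) by rewrite ler_pM2l.
    lra.
  have [nth|nth] := leP n (sg * a / 2).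
    have : w y1 <= - A.
      apply: wA; move=> y' Yy'; rewrite (_ : y1 = T + (y1 - T)); last by rewrite addrC subrK.
      have := shrunk_add (y1 - T) TA Yy'; rewrite -/n -s1E subKr; lra.
    lra.
  have : (sg * a / 2) ^+ 2 < n ^+ 2.
    by rewrite ltr_pXn2r ?nnegrE // divr_ge0 // mulr_ge0 // ltW.
  have : A <= (sg * a / 2) ^+ 2 / (2 * eps) by rewrite ler_pdivlMr // mulrC.
  move=> i1 i2; have : (sg * a / 2) ^+ 2 / (2 * eps) < n ^+ 2 / (2 * eps).
    by rewrite ltr_pM2r // invr_gt0.
  lra.
exact: (hopf_interior a0 sz A0 KE K0 sg1 Ksg eps0 Oy1 hxi1 s1gt s1lt1 qmax).
Qed.

(** Let the penalty tend to 0 in the doubling estimate, with x as y, and with xi on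
    the ray from z through x such that x = z + s (xi - z), 1 - s = d / (4 r).
    Convexity puts xi into the compact set; the boundary may have corners. *)
Lemma hopf : Om !=set0 -> exists c d0, [/\ 0 < c, 0 < d0 &
  forall x d, Om x -> 0 <= d -> d <= d0 -> shrunk d x -> w x <= - (c * d)].
Proof.
move=> [z Oz]; have [a a0 sz] := interior_shrunk Oz.
pose K := 4 * b * r ^+ 2 / a + 1.
have K0 : 0 < K.
  by rewrite ltr_wpDl // divr_ge0 ?(ltW a0) // mulr_ge0 ?sqr_ge0 // mulr_ge0.
pose sg := Num.min (1 / 2) (1 / 2 / K).
have sg0 : 0 < sg by rewrite lt_min !divr_gt0.
have sg1 : sg <= 1 / 2 by rewrite ge_min lexx.
have Ksg : K * sg <= 1 / 2 by rewrite mulrC -ler_pdivlMr // ge_min lexx orbT.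
have th0 : 0 < sg * a / 2 by rewrite divr_gt0 // mulr_gt0.
have [A [A0 wA]] := negative_sub_bounds th0.
have wA1 x : shrunk (sg * a / 2) x -> w x <= - A by case/wA.
have hd := hopf_doubling a0 sz A0 erefl sg0 sg1 Ksg wA1.
clearbody sg; exists (A / (4 * r)), (4 * r * sg).
have r4 : 0 < 4 * r by rewrite mulr_gt0.
split; rewrite ?divr_gt0 // ?mulr_gt0 // => x d Ox d0 dle hx.
pose s := 1 - d / (4 * r).
have ds : d / (4 * r) <= sg by rewrite ler_pdivrMr // mulrC.
have dp : 0 <= d / (4 * r) by rewrite divr_ge0 // ltW.
have s12 : 1 / 2 <= s by rewrite /s; lra.
have s0 : 0 < s by lra.
have dE : d = (1 - s) * (4 * r) by rewrite /s; field; rewrite gt_eqF.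
pose xi := z + s^-1 *: (x - z).
have xz := shrunk_diam Oz d0 hx.
have hxi : shrunk 0 xi.
  have xiE : xi = x + (xi - x) by rewrite addrC subrK.
  have nx : enorm (xi - x) <= d.
    have -> : xi - x = (s^-1 - 1) *: (x - z).
      by rewrite /xi; apply/rowP => i; rewrite !mxE; ring.
    have s1 : 0 <= s^-1 - 1 by rewrite subr_ge0 invf_ge1 // /s; lra.
    rewrite enormZ ger0_norm //; apply: (le_trans (ler_wpM2l s1 xz)).
    rewrite -(ler_pM2l s0) mulrA mulrBr divff ?gt_eqF // mulr1 {1}/s subKr.
    have -> : d / (4 * r) * (2 * r) = d / 2 by field; rewrite gt_eqF.
    by have := ler_wpM2r d0 s12; lra.
  by move=> y Yy; have := shrunk_add (xi - x) hx Yy; rewrite -xiE; lra.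
have h0 : shrunk 0 x by move=> y /hx; lra.
have hs : 1 - sg <= s <= 1 by apply/andP; rewrite /s; split; lra.
have xT : x - (z + s *: (xi - z)) = 0.
  rewrite /xi (_ : z + _ - z = s^-1 *: (x - z)) ?addrK_sub // scalerA divff ?gt_eqF //.
  by rewrite scale1r (addrC z) subrK subrr.
have : w x + hopf_profile A K s <= 0.
  apply/ler_addgt0Pl => eta eta0; rewrite addr0.
  pose eps := Num.min ((sg * a / 2) ^+ 2 / (2 * A)) (eta * a ^+ 2 / (2 * A ^+ 2)).
  have eps0 : 0 < eps.
    by rewrite lt_min !divr_gt0 ?mulr_gt0 ?exprn_gt0 // ?divr_gt0 ?mulr_gt0.
  have A2 : 0 < 2 * A by rewrite mulr_gt0.
  have e1 : 2 * eps * A <= (sg * a / 2) ^+ 2.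
    by rewrite mulrAC -ler_pdivlMl // mulrC ge_min lexx.
  have A22 : 0 < 2 * A ^+ 2 by rewrite mulr_gt0 // exprn_gt0.
  have e2 : eps * (2 * A ^+ 2) <= eta * a ^+ 2.
    by rewrite -ler_pdivlMr // ge_min lexx orbT.
  have := hd eps eps0 e1 x xi s h0 hxi hs.
  rewrite /penalized_profile /= xT enorm0 expr0n /= mul0r subr0 => /le_trans; apply.
  by rewrite ler_pdivrMr ?exprn_gt0 //; lra.
have : A * (1 - s) <= hopf_profile A K s.
  rewrite /hopf_profile ler_pM2l // lerDl mulr_ge0 ?sqr_ge0 //; exact: ltW.
have -> : A / (4 * r) * d = A * (1 - s) by rewrite /s; field; rewrite gt_eqF.
lra.
Qed.

End ConvexDomain.

(** * Lower barriers *)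

Section LowerBarrier.
Variables (R : realType) (N : nat) (Om Y : set 'rV[R]_N) (r b M mu : R).
Variables (H : 'rV[R]_N -> 'rV[R]_N -> R) (f : 'rV[R]_N -> R).
Implicit Types (x y z h p e : 'rV[R]_N) (X : 'M[R]_N) (v V w : 'rV[R]_N -> R).

Definition zero_ext V x : R := if `[< Om x >] then V x else 0.

Lemma zero_extE V x : Om x -> zero_ext V x = V x.
Proof. by move=> Ox; rewrite /zero_ext asboolT. Qed.

Lemma zero_ext_off V x : ~ Om x -> zero_ext V x = 0.
Proof. by move=> nO; rewrite /zero_ext asboolF. Qed.

Hypothesis oO : open Om.

Lemma zero_ext_usc V : (forall x, Om x -> V x <= 0) ->
  (forall x, Om x -> forall a, V x < a -> \forall y \near within Om (nbhs x), V y < a) ->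
  forall x, usc_at (zero_ext V) x.
Proof.
move=> V0 uV x a; have [Ox|nO] := pselect (Om x).
  rewrite zero_extE // => va.
  have n1 : \forall y \near x, Om y -> V y < a by exact: uV.
  have n2 : \forall y \near x, Om y by exact: open_nbhs_nbhs.
  by apply: filterS2 n1 n2 => y hy Oy; rewrite zero_extE //; exact: hy.
rewrite zero_ext_off // => a0; apply: filterE => y.
have [Oy|nOy] := pselect (Om y); last by rewrite zero_ext_off.
by rewrite zero_extE // (le_lt_trans (V0 y Oy)).
Qed.

Lemma usc_within V x : usc_at V x ->
  forall a, V x < a -> \forall y \near within Om (nbhs x), V y < a.
Proof. by move=> uV a /uV; apply: filterS. Qed.

Lemma jet_above_local V V' x p X : Om x -> (forall y, Om y -> V' y = V y) ->
  jet_above V x p X -> jet_above V' x p X.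
Proof.
move=> Ox VV [s s0 hs].
have /nbhs_enormP [s1 s10 h1] : nbhs x Om by exact: open_nbhs_nbhs.
exists (Num.min s s1); first by rewrite lt_min s0.
by move=> h; rewrite lt_min => /andP[/hs hh /h1 Oh]; rewrite !VV.
Qed.

Hypotheses (N2 : (2 <= N)%N) (r0 : 0 < r) (cY : compact Y) (Y0 : Y !=set0)
  (OmE : forall x, Om x <-> forall y, Y y -> enorm (x - y) < r)
  (b0 : 0 <= b) (br : b * r < 1) (M0 : 0 <= M).
Hypotheses (H_le : forall x p, Om x -> `|H x p| <= b * enorm p)
  (H_hom : forall x t p, Om x -> 0 <= t -> H x (t *: p) = t * H x p)
  (f_le : forall x, Om x -> `|f x| <= M).

Definition lower_order (nu : R) (g : 'rV[R]_N -> R) :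
  'rV[R]_N -> R -> 'rV[R]_N -> R := fun x s p => H x p + nu * s - g x.

Definition lower_barrier W : Prop :=
  perron_class Om (lower_order mu f) W W /\
  exists2 D, 0 <= D &
    forall x z, Om x -> ~ Om z -> - (D * enorm (x - z)) <= W x.

(** Zero is a subsolution when f <= 0: jets from above of a constant have zero
    gradient and nonnegative Hessian. *)
Lemma lower_barrier_zero : (forall x, Om x -> f x <= 0) -> lower_barrier (fun=> 0).
Proof.
move=> f0; split; last first.
  by exists 0 => // x z _ _; rewrite mul0r oppr0.
split=> //; first by move=> x a a0; apply: filterE.
move=> x p X e Ox sX [s s0 hs] ee.
have [|pE XE] := @jet_compare R N 0 p 0 X s s0.
  by move=> h /hs; rewrite dot0l /qf mulmx0 dot0l; lra.
have := XE e; rewrite {1}/qf mulmx0 dot0l => Xe.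
have := H_le p Ox; rewrite -[in enorm _]pE enorm0 mulr0 normr_le0 => /eqP Hp.
by have := f0 x Ox; rewrite /lower_order Hp mulr0; lra.
Qed.

Lemma barrier_zero_ext (V : 'rV[R]_N -> R) (C : R) : 0 <= C ->
  (forall x, Om x -> V x <= 0) ->
  (forall x, Om x -> forall a, V x < a -> \forall y \near within Om (nbhs x), V y < a) ->
  (forall x, Om x -> - (C * rho Y r x) <= V x) ->
  jet_sub Om (lower_order mu f) V -> lower_barrier (zero_ext V).
Proof.
move=> C0 V0 uV Vge jV; split; last first.
  exists (C * r); first by rewrite mulr_ge0 // ltW.
  move=> x z Ox nOz; rewrite zero_extE //; apply: le_trans (Vge x Ox).
  by rewrite lerN2 -mulrA ler_wpM2l // (rho_le_dist cY Y0 OmE).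
split=> //; first exact: zero_ext_usc.
  by move=> x; exact: zero_ext_off.
move=> x p X e Ox sX jx ee; rewrite zero_extE //; apply: jV => //.
by apply: jet_above_local jx => // y Oy; rewrite zero_extE.
Qed.

Lemma rho_barrier_jet V (C : R) x p X e : 0 <= C -> Om x ->
  (forall z, Om z -> - (C * rho Y r z) <= V z) -> V x = - (C * rho Y r x) ->
  jet_above V x p X -> dot e e = 1 -> C * (1 - b * r) <= qf X e + H x p.
Proof.
move=> C0 Ox Vge Vx jx ee.
have [pC XC] := barrier_jet oO cY Y0 OmE C0 Ox Vge Vx jx.
have := XC e ee; have := ler_wpM2l b0 pC; have := H_le p Ox.
by rewrite ler_norml => /andP[+ _]; lra.
Qed.

(** When mu <= 0 the zero-order term of the nonpositive - C rho has a good sign. *)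
Lemma lower_barrier_nonpos : mu <= 0 -> exists W, lower_barrier W.
Proof.
move=> mu0; have d0 : 0 < 1 - b * r by rewrite subr_gt0.
pose C := M / (1 - b * r).
have C0 : 0 <= C by apply: divr_ge0 => //; exact: ltW.
have CE : C * (1 - b * r) = M by rewrite /C mulfVK // gt_eqF.
clearbody C; have rho0 x (Ox : Om x) := ltW (rho_gt0 r0 cY Y0 OmE Ox).
exists (zero_ext (fun x => - (C * rho Y r x))).
apply: (@barrier_zero_ext _ C) => //.
- by move=> x /rho0 rx; rewrite oppr_le0 mulr_ge0.
- by move=> x Ox; apply: usc_within; exact: (usc_opp_rho r0 cY Y0 OmE).
- move=> x p X e Ox sX jx ee.
  have := rho_barrier_jet C0 Ox (fun _ _ => lexx _) erefl jx ee.
  have : 0 <= mu * - (C * rho Y r x) by rewrite mulr_le0 // oppr_le0 mulr_ge0 // rho0.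
  have := f_le Ox; rewrite ler_norml CE /lower_order => /andP[_]; lra.
Qed.

(** Young's inequality for t / s and 1. *)
Lemma powR_tangent (g s t : R) : 1 < g -> 0 < s -> 0 <= t ->
  s `^ g + g * s `^ (g - 1) * (t - s) <= t `^ g.
Proof.
move=> g1 s0 t0; have g0 : 0 < g by lra.
have gg : 0 < g - 1 by lra.
have ts0 : 0 <= t / s by rewrite divr_ge0 // ltW.
have := @conjugate_powR R (t / s) 1 g (g / (g - 1)) ts0 ler01 g0 (divr_gt0 g0 gg).
rewrite invf_div -[X in X + _]mul1r -mulrDl addrC subrK divff ?gt_eqF //.
move=> /(_ erefl); rewrite mulr1 powR1 mul1r => young.
have tE : t `^ g = s `^ g * (t / s) `^ g.
  by rewrite -powRM ?(ltW s0) // mulrC mulfVK // gt_eqF.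
have sE : s `^ g = s * s `^ (g - 1).
  rewrite -{2}(powRr1 (ltW s0)) -powRD; first by rewrite addrC subrK.
  by rewrite (gt_eqF s0) implybT.
have {}young : g * (t / s) - (g - 1) <= (t / s) `^ g.
  have := ler_wpM2l (ltW g0) young.
  by rewrite mulrDr ![g * (_ / g)]mulrC !mulfVK ?gt_eqF //; lra.
rewrite tE; apply: le_trans (ler_wpM2l (powR_ge0 s g) young).
rewrite {2}sE le_eqVlt; apply/orP; left; apply/eqP.
by rewrite sE; field; rewrite gt_eqF.
Qed.

(** The concave power t^(1/g) of -w turns a jet of -(-w)^(1/g) into a multiple of
    itself as a jet of w, because t^g lies above its tangents. *)
Lemma jet_above_power w V (g : R) x p X : 1 < g -> Om x -> w x < 0 ->
  (forall z, Om z -> - (- w z) `^ g^-1 <= V z) -> (forall z, Om z -> w z < 0) ->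
  V x = - (- w x) `^ g^-1 -> X^T = X ->
  jet_above V x p X -> exists2 k, 0 < k &
    jet_above w x (k *: p) (k *: X) /\ k * (- w x) `^ g^-1 = g * - w x.
Proof.
move=> g1 Ox wx Vge w0 Vx sX [s s0 hs].
have g0 : 0 < g by lra.
set B := (- w x) `^ g^-1 in Vx *.
have B0 : 0 < B by rewrite powR_gt0 // oppr_gt0.
have Bg z : Om z -> ((- w z) `^ g^-1) `^ g = - w z.
  move=> Oz; rewrite -powRrM mulVf ?gt_eqF // powRr1 // oppr_ge0 ltW //; exact: w0.
have BE : B * B `^ (g - 1) = - w x.
  rewrite -[in RHS](Bg x Ox) -/B -{1}(powRr1 (ltW B0)) -powRD; first by rewrite addrC subrK.
  by rewrite (gt_eqF B0) implybT.
pose k := g * B `^ (g - 1).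
exists k; first by rewrite mulr_gt0 // powR_gt0.
split; last by rewrite /k -BE; ring.
have /nbhs_enormP [s1 s10 h1] : nbhs x Om by exact: open_nbhs_nbhs.
pose Q := paraboloid x p X (- B).
have Qh h : Q (x + h) = - B + dot p h + qf X h / 2 by rewrite /Q /paraboloid addrK_sub.
have Q0 : Q x < 0.
  by have := Qh 0; rewrite addr0 dot0r qf0 mul0r !addr0 => ->; rewrite oppr_lt0.
have cQ : {for x, continuous Q} by exact: continuous_paraboloid.
have /nbhs_enormP [s2 s20 h2] : \forall y \near x, Q y < 0 by have /cvgr_lt/(_ _ Q0) := cQ.
exists (Num.min s (Num.min s1 s2)); first by rewrite !lt_min s0 s10.
move=> h; rewrite !lt_min => /and3P[hh1 hh2 hh3].
have Oh := h1 _ hh2; have Qn := h2 _ hh3.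
have := hs h hh1; rewrite Vx -Qh => VQ.
have up : - Q (x + h) <= (- w (x + h)) `^ g^-1.
  by have := Vge _ Oh; lra.
have Q1 : 0 <= - Q (x + h) by rewrite oppr_ge0 ltW.
have := powR_tangent g1 B0 Q1.
have pw : (- Q (x + h)) `^ g <= ((- w (x + h)) `^ g^-1) `^ g.
  by apply: ge0_ler_powR; rewrite ?nnegrE ?powR_ge0 // ltW.
move=> tan; have := le_trans tan pw.
rewrite (Bg _ Oh) (Bg _ Ox : B `^ g = - w x) -/k Qh qf_scale dotZl.
clear tan pw Q1 up VQ Qn cQ Q0 Qh h2 BE Bg; clearbody k B; lra.
Qed.

Section Glueing.
Variables (w : 'rV[R]_N -> R) (nu g C t1 m1 de : R).

Definition glued_barrier x : R := Num.max (- (C * rho Y r x)) (- (- w x) `^ g^-1).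

Hypotheses (mu0 : 0 < mu) (g1 : 1 < g) (gnu : g * mu < nu) (C0 : 0 < C) (m10 : 0 < m1)
  (uw : forall x, usc_at w x) (wneg : forall x, Om x -> w x < 0)
  (wsub : jet_sub Om (lower_order nu (fun=> 0)) w).

Lemma glued_barrier_usc x : Om x ->
  forall a, glued_barrier x < a -> \forall y \near within Om (nbhs x), glued_barrier y < a.
Proof.
move=> Ox a; rewrite /glued_barrier gt_max => /andP[u1 u2].
have g0 : 0 < g by exact: lt_trans g1.
have n1 := usc_opp_rho r0 cY Y0 OmE (ltW C0) Ox u1.
have n2 : \forall y \near x, Om y -> - (- w y) `^ g^-1 < a.
  have [a0|a0] := leP 0 a.
    apply: filterE => y Oy; apply: lt_le_trans a0.
    by rewrite oppr_lt0 powR_gt0 // oppr_gt0 wneg.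
  have A0 : 0 <= - a by rewrite oppr_ge0 ltW.
  have wa : w x < - ((- a) `^ g).
    rewrite ltrNr -[ltRHS](powRr1 (_ : 0 <= _)) ?oppr_ge0 ?ltW ?wneg //.
    rewrite -(mulVf (lt0r_neq0 g0)) powRrM; apply: gt0_ltr_powR => //;
      rewrite ?nnegrE ?powR_ge0 //.
    by rewrite ltrNl.
  have := uw wa; apply: filterS => y wy Oy; rewrite ltrNl.
  rewrite -[ltLHS](powRr1 A0) -(mulfV (lt0r_neq0 g0)) powRrM.
  apply: gt0_ltr_powR; rewrite ?invr_gt0 ?nnegrE ?powR_ge0 //.
    by rewrite oppr_ge0 ltW // wneg.
  by rewrite ltrNr.
by apply: filterS2 n1 n2 => y y1 y2 Oy; rewrite gt_max y1 y2.
Qed.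

Hypotheses (deE : mu * de = (1 - b * r) / 2)
  (deep : forall x, Om x -> de <= rho Y r x -> (- w x) `^ g^-1 < C * rho Y r x)
  (shallow : forall x, Om x -> rho Y r x <= t1 -> C * rho Y r x <= (- w x) `^ g^-1)
  (wm1 : forall x, Om x -> t1 <= rho Y r x -> w x <= - m1).

(** Near the boundary - C rho is a strict subsolution, since there the zero-order
    term costs at most half of C (1 - b r); away from the boundary -(-w)^(1/g) is
    one, as g mu < nu. The glueing hypotheses say that each function is the larger
    one only where it is a strict subsolution. *)
Lemma glued_barrier_strict : exists2 eta, 0 < eta &
  forall x p X e, Om x -> X^T = X -> jet_above glued_barrier x p X -> dot e e = 1 ->
    eta <= qf X e + H x p + mu * glued_barrier x.
Proof.
have g0 : 0 < g by exact: lt_trans g1.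
have gi : 0 < g^-1 by rewrite invr_gt0.
have an : 0 < g^-1 * nu - mu by rewrite subr_gt0 mulrC ltr_pdivlMr // mulrC.
have d0 : 0 < 1 - b * r by rewrite subr_gt0.
pose V := glued_barrier; rewrite -/V.
have Vge1 x : - (C * rho Y r x) <= V x by rewrite le_max lexx.
have Vge2 x : - (- w x) `^ g^-1 <= V x by rewrite le_max lexx orbT.
exists (Num.min (C * (1 - b * r) / 2) ((g^-1 * nu - mu) * m1 `^ g^-1)).
  by rewrite lt_min divr_gt0 ?mulr_gt0 // powR_gt0.
move=> x p X e Ox sX jx ee; rewrite ge_min.
have [Vx|Vx] := eqVneq (V x) (- (C * rho Y r x)).
  apply/orP; left.
  have main := rho_barrier_jet (ltW C0) Ox (fun z _ => Vge1 z) Vx jx ee.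
  have rd : rho Y r x < de.
    rewrite ltNge; apply/negP => /(deep Ox); apply/negP; rewrite -leNgt.
    by rewrite -lerN2 -Vx.
  have : mu * (C * rho Y r x) <= mu * (C * de) by rewrite ler_pM2l // ler_pM2l // ltW.
  have -> : mu * (C * de) = C * (mu * de) by ring.
  rewrite Vx deE; move: main; lra.
apply/orP; right.
have VB : V x = - (- w x) `^ g^-1.
  by move: Vx; rewrite /V /glued_barrier /Num.max; case: ifP => //; rewrite eqxx.
have BC : (- w x) `^ g^-1 < C * rho Y r x.
  rewrite lt_neqAle -lerN2 -VB Vge1 andbT; apply: contra_neq Vx => <-.
  exact: VB.
have tx : t1 <= rho Y r x.
  by rewrite leNgt; apply/negP => /ltW /(shallow Ox); rewrite leNgt BC.
have [k k0 [jw kB]] := jet_above_power g1 Ox (wneg Ox) (fun z _ => Vge2 z) wneg VB sX jx.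
have skX : (k *: X)^T = k *: X by rewrite linearZ /= sX.
have := wsub Ox skX jw ee; rewrite qf_scale /lower_order (H_hom p Ox (ltW k0)) subr0.
have wE : w x = - (g^-1 * k * (- w x) `^ g^-1).
  by rewrite -mulrA kB mulrA mulVf ?mul1r ?opprK // gt_eqF.
have mB : m1 `^ g^-1 <= (- w x) `^ g^-1.
  apply: ge0_ler_powR; rewrite ?nnegrE ?(ltW gi) ?(ltW m10) //.
    by rewrite oppr_ge0 ltW // wneg.
  by rewrite lerNr wm1.
have mB' := ler_wpM2l (ltW an) mB; rewrite VB.
set Bx := (- w x) `^ g^-1 in wE mB' *.
rewrite wE (_ : _ + _ = k * (qf X e + H x p - g^-1 * nu * Bx)); last by ring.
rewrite pmulr_rge0 // => main; apply: (le_trans mB'); move: main; lra.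
Qed.

End Glueing.

(** The constant C makes - C rho the smaller function away from the boundary, where
    w is bounded; by Hopf's lemma it is the larger one near the boundary, as
    rho^al is much larger than rho there. *)
Lemma glueing_constants w (al de : R) : 0 < al -> al < 1 -> 0 < de -> Om !=set0 ->
  (forall x, usc_at w x) -> (forall x, ~ Om x -> w x = 0) ->
  (forall x, Om x -> w x < 0) -> jet_sub Om (fun _ _ p => b * enorm p) w ->
  exists C t1 m1, [/\ 0 < C, 0 < m1,
    forall x, Om x -> de <= rho Y r x -> (- w x) `^ al < C * rho Y r x,
    forall x, Om x -> rho Y r x <= t1 -> C * rho Y r x <= (- w x) `^ al &
    forall x, Om x -> t1 <= rho Y r x -> w x <= - m1].
Proof.
move=> al0 al1 de0 Om0 uw woff wneg wsub.
have [c [th0 [c0 th00 hopfw]]] := hopf r0 oO cY Y0 OmE b0 uw woff wneg wsub Om0.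
have rho_shrunk x : Om x -> shrunk Y r (rho Y r x / r) x.
  by move=> Ox y Yy; exact: (rho_margin r0 cY Y0 OmE).
have shrunk_mono x d1 d2 : d1 <= d2 -> shrunk Y r d2 x -> shrunk Y r d1 x.
  by move=> d12 hx y Yy; apply: (le_trans (hx y Yy)); rewrite lerD2l lerN2.
have rho0 x (Ox : Om x) := rho_gt0 r0 cY Y0 OmE Ox.
have w00 x : Om x -> 0 <= - w x by move=> /wneg wx; rewrite oppr_ge0 ltW.
have bounds t : 0 < t -> exists m, 0 < m /\
    forall x, Om x -> t <= rho Y r x -> w x <= - m /\ - w x <= m^-1.
  move=> t0; have tr : 0 < t / r by rewrite divr_gt0.
  have [m [m0 hm]] := negative_sub_bounds oO Y0 OmE b0 uw woff wneg wsub tr.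
  exists m; split=> // x Ox tx; apply: hm; apply: shrunk_mono (rho_shrunk x Ox).
  by rewrite ler_pM2r ?invr_gt0.
have [m2 [m20 hm2]] := bounds de de0.
pose C := m2^-1 `^ al / de + 1.
have C0 : 0 < C by rewrite ltr_wpDl // divr_ge0 ?powR_ge0 // ltW.
pose K := (c / r) `^ al / C.
have K0 : 0 < K by rewrite divr_gt0 // powR_gt0 // divr_gt0.
(* so that rho^(1 - al) <= K when rho <= t1 *)
pose t1 := Num.min (r * th0) (K `^ (1 - al)^-1).
have t10 : 0 < t1 by rewrite lt_min mulr_gt0 // powR_gt0.
have al10 : 0 < 1 - al by rewrite subr_gt0.
have [m1 [m10 hm1]] := bounds t1 t10.
exists C, t1, m1; split=> // [x Ox dx|x Ox|x Ox tx]; last by case: (hm1 x Ox tx).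
  have [_ wm] := hm2 x Ox dx.
  apply: (@le_lt_trans _ _ (m2^-1 `^ al)).
    by apply: ge0_ler_powR; rewrite ?nnegrE ?(ltW al0) ?w00 // invr_ge0 ltW.
  apply: (@lt_le_trans _ _ (C * de)); last by rewrite ler_pM2l.
  by rewrite /C mulrDl mulfVK ?gt_eqF // mul1r ltrDl.
rewrite le_min => /andP[x1 x2]; have rx := rho0 x Ox.
have rr : 0 <= rho Y r x / r by rewrite divr_ge0 // ltW.
have := hopfw x (rho Y r x / r) Ox rr _ (rho_shrunk x Ox).
rewrite ler_pdivrMr // mulrC => /(_ x1) hw.
have cr : 0 <= c / r by rewrite divr_ge0 // ltW.
have low : (c / r * rho Y r x) `^ al <= (- w x) `^ al.
  apply: ge0_ler_powR; rewrite ?nnegrE ?(ltW al0) ?w00 //.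
    by rewrite mulr_ge0 // ltW.
  move: hw; rewrite lerNr; apply: le_trans.
  by rewrite le_eqVlt; apply/orP; left; apply/eqP; ring.
apply: le_trans low; rewrite powRM ?(ltW rx) //.
have rE : rho Y r x = rho Y r x `^ al * rho Y r x `^ (1 - al).
  rewrite -powRD; first by rewrite addrC subrK powRr1 // ltW.
  by rewrite (gt_eqF rx) implybT.
have rK : rho Y r x `^ (1 - al) <= K.
  have -> : K = (K `^ (1 - al)^-1) `^ (1 - al).
    by rewrite -powRrM mulVf ?gt_eqF // powRr1 // ltW.
  by apply: ge0_ler_powR; rewrite ?nnegrE ?powR_ge0 // ltW.
rewrite {1}rE mulrCA [leRHS]mulrC; apply: ler_wpM2l; first exact: powR_ge0.
have := ler_wpM2l (ltW C0) rK.
by rewrite /K mulrC [C * (_ / _)]mulrC mulfVK ?gt_eqF // mulrC.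
Qed.

Lemma lower_barrier_pos (nu : R) w : 0 < mu -> mu < nu -> Om !=set0 ->
  (forall x, Om x -> w x < 0) ->
  (forall x, Om x -> forall a, w x < a -> \forall y \near within Om (nbhs x), w y < a) ->
  jet_sub Om (lower_order nu (fun=> 0)) w -> exists W, lower_barrier W.
Proof.
move=> mu0 munu Om0 wneg uw wsub.
have nu0 : 0 < nu by exact: lt_trans munu.
pose w0 := zero_ext w.
have w0E x : Om x -> w0 x = w x by exact: zero_extE.
have w0off x : ~ Om x -> w0 x = 0 by exact: zero_ext_off.
have w0neg x : Om x -> w0 x < 0 by move=> Ox; rewrite w0E // wneg.
have uw0 x : usc_at w0 x by apply: zero_ext_usc => // y /wneg /ltW.
have w0sub : jet_sub Om (lower_order nu (fun=> 0)) w0.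
  move=> x p X e Ox sX jx ee; rewrite w0E //; apply: wsub => //.
  by apply: jet_above_local jx => // y Oy; rewrite w0E.
have w0sub' : jet_sub Om (fun _ _ p => b * enorm p) w0.
  move=> x p X e Ox sX jx ee; apply: (le_trans (w0sub x p X e Ox sX jx ee)).
  rewrite lerD2l /lower_order subr0; have := H_le p Ox; rewrite ler_norml => /andP[_ hH].
  by rewrite -[leRHS]addr0 lerD // mulr_ge0_le0 ?(ltW nu0) // ltW // w0neg.
have numu : 1 < nu / mu by rewrite ltr_pdivlMr // mul1r.
(* 1 / g is less than 1 and nu / g is still greater than mu *)
pose g := (1 + nu / mu) / 2.
have g1 : 1 < g by rewrite /g ltr_pdivlMr // mul1r ltrD2l.
have gnu : g * mu < nu.
  by rewrite -ltr_pdivlMr // /g ltr_pdivrMr // mulr_natr mulr2n ltrD2r.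
have g0 : 0 < g by exact: lt_trans g1.
have gi : 0 < g^-1 by rewrite invr_gt0.
have gi1 : g^-1 < 1 by rewrite invf_lt1.
clearbody g; pose de := (1 - b * r) / (2 * mu).
have de0 : 0 < de by rewrite divr_gt0 ?subr_gt0 // mulr_gt0.
have deE : mu * de = (1 - b * r) / 2 by rewrite /de; field; rewrite gt_eqF.
have [C [t1 [m1 [C0 m10 deep shallow wm1]]]] :=
  glueing_constants gi gi1 de0 Om0 uw0 w0off w0neg w0sub'.
have [eta eta0 strict] :=
  glued_barrier_strict mu0 g1 gnu C0 m10 w0neg w0sub deE deep shallow wm1.
pose T := (M + 1) / eta.
have T0 : 0 < T by rewrite divr_gt0 // ltr_wpDl.
have TE : T * eta = M + 1 by rewrite /T mulfVK // gt_eqF.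
clearbody T; pose V := glued_barrier w0 g C; exists (zero_ext (fun x => T * V x)).
have Vx0 x : Om x -> V x <= 0.
  move=> Ox; rewrite /V /glued_barrier ge_max !oppr_le0 powR_ge0 andbT.
  by rewrite mulr_ge0 ?(ltW C0) // ltW // (rho_gt0 r0 cY Y0 OmE).
apply: (@barrier_zero_ext _ (T * C)).
- by rewrite mulr_ge0 // ltW.
- by move=> x Ox; rewrite mulr_ge0_le0 ?Vx0 // ltW.
- move=> x Ox a va.
  have {}va : V x < a / T by rewrite ltr_pdivlMr // mulrC.
  have := glued_barrier_usc g1 C0 uw0 w0neg Ox va; apply: filterS => y yV.
  by rewrite mulrC -ltr_pdivlMr // yV.
- by move=> x Ox; rewrite -mulrA -mulrN ler_pM2l // /V /glued_barrier le_max lexx.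
- move=> x p X e Ox sX [s s0 hs] ee.
  have sTX : (T^-1 *: X)^T = T^-1 *: X by rewrite linearZ /= sX.
  have jT : jet_above V x (T^-1 *: p) (T^-1 *: X).
    exists s => // h /hs hh; rewrite dotZl qf_scale -(ler_pM2l T0).
    apply: (le_trans hh); rewrite le_eqVlt; apply/orP; left; apply/eqP.
    by field; rewrite gt_eqF.
  have Ti : 0 <= T^-1 by rewrite invr_ge0 ltW.
  have := strict x _ _ e Ox sTX jT ee; rewrite qf_scale (H_hom p Ox Ti) => es.
  have fM : f x <= M by apply: le_trans (f_le Ox); exact: ler_norm.
  have := ler_wpM2l (ltW T0) es; rewrite TE !mulrDr !mulrA divff ?gt_eqF // !mul1r.
  rewrite /lower_order (mulrC T mu) -mulrA => M1.
  rewrite addrA subr_ge0 addrA; apply: (le_trans fM); apply: le_trans M1.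
  by rewrite lerDl.
Qed.

End LowerBarrier.

(** * Existence of a solution *)

Section Assembly.
Variables (R : realType) (N : nat).
Implicit Types (x y z h p : 'rV[R]_N) (Om Y : set 'rV[R]_N).

Lemma closure_sub_closed (T : topologicalType) (A B : set T) :
  closed B -> A `<=` B -> closure A `<=` B.
Proof. by move=> /closure_id BE AB; rewrite BE; exact: closureS. Qed.

(** The centres may be taken to form a compact set: passing to their closure does
    not change the intersection, because the domain is open. *)
Lemma class_C_compact_centres (r : R) Om : (0 < N)%N -> 0 < r -> class_C r Om ->
  exists Y, [/\ compact Y, Y !=set0 &
    forall x, Om x <-> forall y, Y y -> enorm (x - y) < r].
Proof.
move=> N0 r0 [[oO _ [x0 Ox0] [M OM]] [Y OmE]].
have Om_in x y : Om x -> Y y -> enorm (x - y) < r by rewrite OmE => + Yy; apply.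
exists (closure Y); split.
- apply: (@subclosed_compact _ (closure Y) [set y | enorm (y - x0) <= r]).
  + exact: closed_closure.
  + exact: compact_cball.
  + apply: closure_sub_closed; first exact: closed_cball.
    by move=> y Yy /=; rewrite enormB ltW // Om_in.
- apply: contrapT => Ye.
  have allOm x : Om x.
    by rewrite OmE => y Yy; exfalso; apply: Ye; exists y; exact: subset_closure.
  have [e ee] := @unit_exists R N N0.
  have := OM ((`|M| + 1) *: e) (allOm _).
  rewrite enormZ (enorm_unit ee) mulr1 ger0_norm ?addr_ge0 //.
  by have := ler_norm M; lra.
- move=> x; split=> [Ox y Yy|hx]; last first.
    by rewrite OmE => y Yy; apply: hx; exact: subset_closure.
  rewrite ltNge; apply/negP => rxy.
  have xy : x - y != 0 by apply: contraTneq rxy => ->; rewrite enorm0 -ltNge.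
  have nxy := enorm_gt0 xy.
  have /nbhs_enormP [s s0 hs] : nbhs x Om by exact: open_nbhs_nbhs.
  pose h := (s / 2 / enorm (x - y)) *: (x - y).
  have s20 : 0 < s / 2 by rewrite divr_gt0.
  have hn : enorm h = s / 2.
    by rewrite /h enormZ ger0_norm ?mulfVK ?gt_eqF // divr_ge0 // ltW.
  have Oh : Om (x + h) by apply: hs; rewrite hn; lra.
  have : closure Y `<=` [set y' | enorm (y' - (x + h)) <= r].
    apply: closure_sub_closed; first exact: closed_cball.
    by move=> y' Yy' /=; rewrite enormB ltW // Om_in.
  move=> /(_ y Yy) /=; rewrite enormB.
  have -> : x + h - y = (1 + s / 2 / enorm (x - y)) *: (x - y).
    by rewrite scalerDl scale1r addrAC.
  rewrite enormZ ger0_norm; last by rewrite addr_ge0 // divr_ge0 // ltW.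
  by rewrite mulrDl mul1r mulfVK ?gt_eqF //; lra.
Qed.

Lemma drift_bound (r : R) Om (H : 'rV[R]_N -> 'rV[R]_N -> R) : 0 < r -> Om !=set0 ->
  (forall x t xi, Om x -> 0 <= t -> H x (t *: xi) = t * H x xi) ->
  (bH Om H * r%:E < 1%:E)%E ->
  exists b, [/\ 0 <= b, b * r < 1 &
    forall x p, Om x -> `|H x p| <= b * enorm p].
Proof.
move=> r0 [x0 Ox0] Hhom hb.
have ub x p : Om x -> enorm p < 1 -> ((`|H x p|)%:E <= bH Om H)%E.
  move=> Ox p1; apply: ereal_sup_ubound; exists (x, p) => //.
  by split=> //; rewrite /eball /= subr0.
have := ub x0 0 Ox0; rewrite enorm0 ltr01 => /(_ isT).
move: hb ub; case: (bH Om H) => [b| |].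
- rewrite -EFinM lte_fin => br ub; rewrite lee_fin => b0.
  have {}b0 : 0 <= b by apply: le_trans b0.
  exists b; split=> // x p Ox.
  have [->|p0] := eqVneq p 0.
    have -> : H x 0 = 0 by rewrite -(scale0r 0) Hhom // mul0r.
    by rewrite normr0 enorm0 mulr0.
  have pn := enorm_gt0 p0.
  apply/ler_addgt0Pl => e e0.
  have D0 : 0 < b * enorm p + 1 by rewrite ltr_wpDl // mulr_ge0 // ltW.
  pose t := e / (b * enorm p + 1); have t0 : 0 < t by rewrite divr_gt0.
  have tE : t * (b * enorm p + 1) = e by rewrite /t mulfVK // gt_eqF.
  clearbody t; pose l := enorm p * (1 + t).
  have l0 : 0 < l by rewrite mulr_gt0 // addr_gt0.
  have lq : enorm (l^-1 *: p) < 1.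
    rewrite enormZ ger0_norm ?invr_ge0 ?(ltW l0) // mulrC ltr_pdivrMr // mul1r /l.
    by rewrite ltr_pMr // ltrDl.
  have := ub x _ Ox lq; rewrite lee_fin => Hq.
  have -> : H x p = l * H x (l^-1 *: p).
    by rewrite -(Hhom _ _ _ Ox (ltW l0)) scalerA divff ?gt_eqF // scale1r.
  rewrite normrM (gtr0_norm l0).
  have := ler_wpM2l (ltW l0) Hq; rewrite /l; lra.
- by rewrite gt0_mulye // ?lte_fin.
- by move=> _ _; rewrite leeNy_eq.
Qed.

Lemma lower_order_cont Om (H : 'rV[R]_N -> 'rV[R]_N -> R) (f : 'rV[R]_N -> R) (mu : R) :
  open Om ->
  {within Om `*` [set: 'rV[R]_N],
     continuous (fun p : 'rV[R]_N * 'rV[R]_N => H p.1 p.2)} ->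
  {within Om, continuous f} ->
  forall x s p, Om x -> forall eps, 0 < eps ->
  exists2 d, 0 < d & forall h t k, enorm h < d -> `|t| < d -> enorm k < d ->
    `|lower_order H mu f (x + h) (s + t) (p + k) - lower_order H mu f x s p| < eps.
Proof.
move=> oO Hc fc x s p Ox eps eps0.
have e3 : 0 < eps / 3 by rewrite divr_gt0.
have [d1 d10 f1] : exists2 d, 0 < d & forall h, enorm h < d -> `|f (x + h) - f x| < eps / 3.
  move: fc; rewrite continuous_open_subspace // => /(_ x); rewrite inE => /(_ Ox).
  by move=> /continuous_enorm_at; apply.
have [d2 d20 H2] : exists2 d, 0 < d & forall h k, enorm h < d -> enorm k < d ->
    `|H (x + h) (p + k) - H x p| < eps / 3.
  have oOT : open (Om `*` [set: 'rV[R]_N]).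
    rewrite openE => -[a c] [/= Oa _]; exists (Om, setT) => //=.
    by split; [exact: open_nbhs_nbhs|exact: filterT].
  move: Hc; rewrite continuous_open_subspace // => /(_ (x, p)).
  rewrite inE => /(_ (conj Ox I)) Hxp.
  have [[A B] [/= /nbhs_enormP [a a0 hA] /nbhs_enormP [c c0 hB]] AB] :=
    Hxp _ (nbhsx_ballx (H x p) _ e3).
  exists (Num.min a c); first by rewrite lt_min a0.
  move=> h k; rewrite !lt_min => /andP[ha _] /andP[_ kc].
  by have := AB (x + h, p + k) (conj (hA _ ha) (hB _ kc)); rewrite /= /ball /= distrC.
have m1 : 0 < `|mu| + 1 by rewrite ltr_wpDl.
exists (Num.min (Num.min d1 d2) (eps / 3 / (`|mu| + 1))).
  by rewrite !lt_min d10 d20 divr_gt0.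
move=> h t k; rewrite !lt_min => /andP[/andP[h1 h2] _] /andP[_ t3] /andP[/andP[_ k2] _].
have := f1 h h1; have := H2 h k h2 k2.
have mt : `|mu * t| < eps / 3.
  rewrite normrM; move: t3; rewrite ltr_pdivlMr // => t3.
  by apply: le_lt_trans t3; rewrite mulrC ler_wpM2l // lerDl.
move: mt; rewrite /lower_order !ltr_norml mulrDr.
by move=> /andP[a1 a2] /andP[a3 a4] /andP[a5 a6]; apply/andP; split; lra.
Qed.

Lemma eqF_lower_order (H : 'rV[R]_N -> 'rV[R]_N -> R) (mu : R) f :
  eqF H mu f = (fun x s p X => P1minus X + lower_order H mu f x s p).
Proof.
apply: funext => x; apply: funext => s; apply: funext => p; apply: funext => X.
by rewrite /eqF /lower_order !addrA.
Qed.

End Assembly.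

Theorem theorem5p2 (R : realType) (N : nat) (hN : (2 <= N)%N)
  (r : R) (hr : 0 < r)
  (Om : set 'rV[R]_N) (hOm : class_C r Om)
  (H : 'rV[R]_N -> 'rV[R]_N -> R)
  (Hcont : {within Om `*` [set: 'rV[R]_N],
              continuous (fun p : 'rV[R]_N * 'rV[R]_N => H p.1 p.2)})
  (Hhom : forall x t xi, Om x -> 0 <= t -> H x (t *: xi) = t * H x xi)
  (Hmod : exists omega : R -> R, is_modulus omega /\
     forall x y xi, Om x -> Om y ->
       `|H x xi - H y xi| <= omega (enorm (x - y) * (1 + enorm xi)))
  (hb : (bH Om H * r%:E < 1%:E)%E)
  (f : 'rV[R]_N -> R)
  (fcont : {within Om, continuous f})
  (fbound : exists M : R, forall x, Om x -> `|f x| <= M)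
  (mu : R)
  (hmu : (mu%:E < mu1minus Om H)%E \/ (forall x, Om x -> f x <= 0)) :
  exists u : 'rV[R]_N -> R,
    [/\ Lip (closure Om) u,
        visc_sol Om (eqF H mu f) u &
        forall x, (closure Om `\` interior Om) x -> u x = 0].
Proof.
have N0 : (0 < N)%N by exact: ltnW.
have [[oO _ Om0 _] _] := hOm.
have [Y [cY Y0 OmE]] := class_C_compact_centres N0 hr hOm.
have [b [b0 br H_le]] := drift_bound hr Om0 Hhom hb.
have [M f_le] := fbound.
have M0 : 0 <= M by have [x0 Ox0] := Om0; exact: le_trans (f_le x0 Ox0).
have H_hom x t p (Ox : Om x) (t0 : 0 <= t) := Hhom x t p Ox t0.
have [W [W_mem [D D0 W_ge]]] : exists W, lower_barrier Om mu H f W.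
  case: hmu => [|f0]; last by exists (fun=> 0); exact: (lower_barrier_zero mu H_le f0).
  have [mu0 _|mu0] := leP mu 0.
    exact: (lower_barrier_nonpos oO hr cY Y0 OmE b0 br M0 H_le f_le).
  move=> /ereal_sup_gt [_ [nu [w [wneg wsub]] <-]]; rewrite lte_fin => munu.
  apply: (lower_barrier_pos oO hr cY Y0 OmE b0 br M0 H_le H_hom f_le mu0 munu Om0 wneg).
    move=> x Ox a wa; have := wsub.1 x Ox (a - w x); rewrite subr_gt0 => /(_ wa).
    by rewrite addrC subrK.
  by move: wsub; rewrite eqF_lower_order; exact: visc_sub_jet.
have G_le x s p : Om x -> lower_order H mu f x s p <= b * enorm p + `|mu| * `|s| + M.
  move=> Ox; have := H_le x p Ox; have := f_le x Ox; have := ler_norm (mu * s).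
  rewrite normrM !ler_norml /lower_order => ms /andP[f1 f2] /andP[_ h2]; lra.
have [u [[L uL] uoff usub usuper]] := perron_existence hN hr b0 br (normr_ge0 mu) M0 D0
  oO Y0 OmE G_le (lower_order_cont mu oO Hcont fcont) W_mem W_ge.
have cu : continuous u.
  move=> x; apply/continuous_enorm_at => e e0.
  have L1 : 0 < `|L| + 1 by rewrite ltr_wpDl.
  exists (e / (`|L| + 1)); first by rewrite divr_gt0.
  move=> h; rewrite ltr_pdivlMr // => he; apply: le_lt_trans he.
  apply: (le_trans (uL _ _)); rewrite addrK_sub mulrC ler_wpM2l ?enorm_ge0 //.
  by have := ler_norm L; lra.
exists u; split.
- by exists L => x y _ _; exact: uL.
- rewrite eqF_lower_order; split.
  + exact: continuous_subspaceT.
  + by apply: visc_sub_intro => // x _; apply: continuous_usc; exact: cu.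
  + by apply: visc_super_intro => // x _; exact: cu.
- move=> x [_ nO]; apply: uoff => Ox; apply: nO.
  exact: open_nbhs_nbhs.
Qed.
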